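(* Let $(R,\mathfrak{m})$ be a Noetherian local ring, $\Bbbk=R/\mathfrak{m}$ its residue field, and $\mathrm{gr}_{\mathfrak{m}}(R)=\bigoplus_{j\ge 0}\mathfrak{m}^j/\mathfrak{m}^{j+1}$ its associated graded ring. Let $M,N$ be finite (i.e. finitely generated) $R$-modules with $\mathfrak{m}$-stable filtrations $\mathcal{M}$ of $M$ and $\mathcal{N}$ of $N$. Then there exist $\mathfrak{m}$-stable filtrations on each $\mathrm{Tor}_i^R(M,N)$, $i\ge 0$, such that, with $\mathrm{gr}(\mathrm{Tor}_i^R(M,N))$ denoting the associated graded module with respect to this filtration, the Hilbert series $$\sum_{i,j}\dim_{\Bbbk}\mathrm{gr}\big(\mathrm{Tor}_i^R(M,N)\big)_j\, z^it^j$$ is obtained from the Hilbert series $$\sum_{i,j}\dim_{\Bbbk}\mathrm{Tor}_i^{\mathrm{gr}_{\mathfrak{m}}(R)}\big(\mathrm{gr}_{\mathcal{M}}(M),\mathrm{gr}_{\mathcal{N}}(N)\big)_j\, z^it^j$$ by negative consecutive cancellations, i.e. by subtracting terms of the form $z^{i+1}t^a+z^{i}t^b$ with $a<b$.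
   Context: Filtrations: for a finitely generated $R$-module $M$, a descending filtration $\mathcal{M}=\{M^j\}_{j\in\mathbb{N}}$ (with $\mathbb{N}=\{0,1,2,\dots\}$) of $M$ by $R$-submodules is called $\mathfrak{m}$-stable if $M^0=M$, $\mathfrak{m}M^j\subseteq M^{j+1}$ for all $j\ge 0$, and $\mathfrak{m}M^j=M^{j+1}$ for all sufficiently large $j$. The associated graded module of $M$ with respect to an $\mathfrak{m}$-stable filtration $\mathcal{M}$ is $\mathrm{gr}_{\mathcal{M}}(M)=\bigoplus_{j\ge 0}M^j/M^{j+1}$; it is a finitely generated graded $\mathrm{gr}_{\mathfrak{m}}(R)$-module, with degree $j$ component $M^j/M^{j+1}$. When the filtration is clear, one writes $\mathrm{gr}(M)$. Grading on Tor: for graded modules $A,B$ over the graded ring $G=\mathrm{gr}_{\mathfrak{m}}(R)$, each $\mathrm{Tor}_i^G(A,B)$ carries its natural internal grading (computed from a graded free $G$-resolution of $A$ with degree-preserving differentials), and $\mathrm{Tor}_i^G(A,B)_j$ denotes its component of internal degree $j$. Negative consecutive cancellations: a series $Q(z,t)=\sum_{i,j} q_{i,j}z^it^j$ is obtained from a series $P(z,t)=\sum_{i,j}p_{i,j}z^it^j$ (coefficients nonnegative integers) by negative consecutive cancellations if there are nonnegative integers $c_{i,a,b}$, indexed by integers $i\ge 0$ and $0\le a<b$, such that $$P(z,t)-Q(z,t)=\sum_{i\ge 0}\ \sum_{0\le a<b} c_{i,a,b}\,\big(z^{i+1}t^a+z^it^b\big).$$ Infinitely many of the $c_{i,a,b}$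 may be nonzero, but only finitely many contribute to the coefficient of any given monomial $z^it^j$. *)

(* Defs.v *)
From HB Require Import structures.
From mathcomp Require Import all_boot all_algebra finmap.
From mathcomp Require Import boolp classical_sets functions cardinality fsbigop.

Set Implicit Arguments.
Unset Strict Implicit.
Unset Printing Implicit Defensive.

Import GRing.Theory.

Local Open Scope ring_scope.

Section Submodule.
Variables (A : pzRingType) (V : lmodType A).

Record submod (S : submodClosed V) :=
  Submod { submod_val :> V; submod_valP : submod_val \in S }.

Definition full_pred : {pred V} := predT.
Lemma full_pred_closed : subsemimod_closed full_pred. Proof. by []. Qed.
HB.instance Definition _ :=
  GRing.isSubmodClosed.Build A V full_pred full_pred_closed.
Definition full : submodClosed V := full_pred.

Variable S : submodClosed V.
HB.instance Definition _ := [isSub of submod S for @submod_val S].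
HB.instance Definition _ := [Choice of submod S by <:].
HB.instance Definition _ := [SubChoice_isSubLmodule of submod S by <:].
End Submodule.

Section QuotientModule.
Local Open Scope quotient_scope.
Variables (A : pzRingType) (V : lmodType A) (S : submodClosed V).

Definition quot_pred : {pred V} := S.
HB.instance Definition _ := GRing.isZmodClosed.Build V quot_pred
  (GRing.submod_closedB (submodClosedP S)).

Definition lquot : Type := Quotient.quot quot_pred.
HB.instance Definition _ := GRing.Zmodule.on lquot.

Definition lproj (x : V) : lquot := \pi_(Quotient.quot quot_pred) x.

Definition lrepr (t : lquot) : V := @repr V (Quotient.quot quot_pred) t.

Lemma lreprK : cancel lrepr lproj.
Proof. by move=> t; rewrite /lproj /lrepr reprK. Qed.

Lemma lproj_eq x y : (lproj x = lproj y) <-> x - y \in S.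
Proof.
have -> : (x - y \in S) = (lproj x == lproj y) by rewrite /lproj -Quotient.idealrBE.
by split=> /eqP.
Qed.

Lemma lproj_is_zmod_morphism : zmod_morphism lproj.
Proof. exact: pi_is_zmod_morphism. Qed.
HB.instance Definition _ :=
  GRing.isZmodMorphism.Build V lquot lproj lproj_is_zmod_morphism.

Definition lquot_scale (a : A) (t : lquot) : lquot := lproj (a *: lrepr t).

Lemma lquot_scaleE a x : lquot_scale a (lproj x) = lproj (a *: x).
Proof.
apply/lproj_eq; rewrite -scalerBr rpredZ //.
by apply/lproj_eq; rewrite lreprK.
Qed.

Lemma lquot_scaleA a b t :
  lquot_scale a (lquot_scale b t) = lquot_scale (a * b) t.
Proof. by rewrite -[t]lreprK !lquot_scaleE scalerA. Qed.
Lemma lquot_scale1 : left_id 1 lquot_scale.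
Proof. by move=> t; rewrite -[t]lreprK lquot_scaleE scale1r. Qed.
Lemma lquot_scaleDr : right_distributive lquot_scale +%R.
Proof.
move=> a t u; rewrite -[t]lreprK -[u]lreprK -raddfD !lquot_scaleE.
by rewrite scalerDr raddfD.
Qed.
Lemma lquot_scaleDl t : {morph lquot_scale^~ t : a b / a + b}.
Proof.
by move=> a b /=; rewrite -[t]lreprK !lquot_scaleE scalerDl raddfD.
Qed.
HB.instance Definition _ := GRing.Zmodule_isLmodule.Build A lquot
  lquot_scaleA lquot_scale1 lquot_scaleDr lquot_scaleDl.

Lemma lproj_is_scalable : scalable lproj.
Proof. by move=> a x; rewrite -lquot_scaleE. Qed.
HB.instance Definition _ :=
  GRing.isScalable.Build A V lquot *:%R lproj lproj_is_scalable.
End QuotientModule.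

Section DirectSum.
Local Open Scope classical_set_scope.
Variables (A : pzRingType) (V : lmodType A) (B : Type) (S : B -> submodClosed V).

Definition dsum_pred : {pred B -> V} :=
  [pred f : B -> V | `[< finite_set [set b | f b != 0] /\ forall b, f b \in S b >]].

Lemma dsum_pred_closed : subsemimod_closed dsum_pred.
Proof.
apply/GRing.submod_closed_semi; split.
  apply/asboolP; split=> [|b]; last by rewrite rpred0.
  by rewrite (_ : mkset _ = set0) // -subset0 => b /=; rewrite eqxx.
move=> a f g /asboolP[ff fS] /asboolP[gf gS]; apply/asboolP; split=> [|b]; last first.
  by rewrite rpredD ?rpredZ.
apply: (@sub_finite_set _ _ ([set b | f b != 0] `|` [set b | g b != 0])).
  move=> b /=; apply: contraNP => /not_orP[/negP/negbNE/eqP f0 /negP/negbNE/eqP g0].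
  by apply/eqP; rewrite -[LHS]/(a *: f b + g b) f0 g0 scaler0 addr0.
by rewrite finite_setU.
Qed.
HB.instance Definition _ :=
  GRing.isSubmodClosed.Build A (B -> V) dsum_pred dsum_pred_closed.

Definition dsum : submodClosed (B -> V) := dsum_pred.
End DirectSum.

(* V^(B), the direct sum of copies of V indexed by B. *)
Notation copower B V := (submod (dsum (fun _ : B => full V))).

Section Filtration.
Variables (R : comPzRingType) (M : lmodType R).
Implicit Types (I : {pred R}) (S : submodClosed M).

Definition idealM_pred I S : {pred M} :=
  [pred x | `[< exists2 s : seq (R * M),
    {in s, forall u, u.1 \in I /\ u.2 \in S} & x = \sum_(u <- s) u.1 *: u.2 >]].

Lemma idealM_closed I S : subsemimod_closed (idealM_pred I S).
Proof.
apply/GRing.submod_closed_semi; split.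
  by apply/asboolP; exists [::]; rewrite ?big_nil.
move=> a x y /asboolP[s sIS ->] /asboolP[t tIS ->]; apply/asboolP.
exists ([seq (u.1, a *: u.2) | u <- s] ++ t) => [u|]; last first.
  rewrite big_cat big_map scaler_sumr; congr (_ + _).
  by apply: eq_bigr => u _; rewrite /= !scalerA mulrC.
rewrite mem_cat => /orP[/mapP[v /sIS[vI vS] ->]|/tIS//].
by split=> //=; rewrite rpredZ.
Qed.
HB.instance Definition _ I S :=
  GRing.isSubmodClosed.Build R M (idealM_pred I S) (idealM_closed I S).

Definition idealM I S : submodClosed M := idealM_pred I S.

Lemma idealMS I S : {subset idealM I S <= S}.
Proof.
move=> _ /asboolP[s sIS ->]; rewrite big_seq rpred_sum // => u /sIS[_ uS].
by rewrite rpredZ.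
Qed.

Record stable_filtration (m : {pred R}) := StableFiltration {
  fil :> nat -> submodClosed M;
  fil0 : forall x, x \in fil 0;
  fil_desc : forall j, {subset fil j.+1 <= fil j};
  fil_mul : forall j, {subset idealM m (fil j) <= fil j.+1};
  fil_stable : exists k, forall j, (k <= j)%N -> idealM m (fil j) =i fil j.+1
}.
End Filtration.

Section AdicFiltration.
Variables (R : comPzRingType) (m : {pred R}).

Fixpoint ideal_power (j : nat) : submodClosed R^o :=
  if j is k.+1 then idealM m (ideal_power k) else full R^o.

Lemma ideal_power0 x : x \in ideal_power 0. Proof. by []. Qed.
Lemma ideal_power_desc j : {subset ideal_power j.+1 <= ideal_power j}.
Proof. exact: idealMS. Qed.
Lemma ideal_power_mul j : {subset idealM m (ideal_power j) <= ideal_power j.+1}.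
Proof. by []. Qed.
Lemma ideal_power_stable : exists k, forall j, (k <= j)%N ->
  idealM m (ideal_power j) =i ideal_power j.+1.
Proof. by exists 0%N. Qed.

Definition adic : stable_filtration R^o m :=
  StableFiltration ideal_power0 ideal_power_desc ideal_power_mul
    ideal_power_stable.
End AdicFiltration.

Section IdealPower.
Variables (R : comPzRingType) (m : {pred R}) (M : lmodType R).
Variable F : stable_filtration M m.

Lemma fil_ideal_power i j (a : R) x :
  a \in ideal_power m i -> x \in F j -> a *: x \in F (i + j)%N.
Proof.
elim: i a x => [|i IH] a x; first by move=> _ xF; rewrite rpredZ.
move=> /asboolP[s sIS ->] xF; rewrite scaler_suml big_seq rpred_sum // => u us.
have [u1 u2] := sIS u us; rewrite -scalerA addSn; apply: fil_mul.
apply/asboolP; exists [:: (u.1, u.2 *: x)]; last by rewrite big_seq1.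
by move=> v; rewrite inE => /eqP -> /=; split=> //; apply: IH.
Qed.
End IdealPower.

Section Convolution.
Variables (R : comPzRingType) (M : lmodType R).
Implicit Types (f g : nat -> R^o) (h : nat -> M).

Definition conv f h : nat -> M := fun n => \sum_(i < n.+1) f i *: h (n - i)%N.

Definition conv1 : nat -> R^o := fun n => (n == 0%N)%:R.

Lemma conv1f h : conv conv1 h = h.
Proof.
apply/funext => n; rewrite /conv big_ord_recl /= subn0 scale1r big1 ?addr0 //.
by move=> i _; rewrite scale0r.
Qed.

Lemma convDr f h h' : conv f (h + h') = conv f h + conv f h'.
Proof.
apply/funext => n; rewrite /conv -[RHS]big_split.
by apply: eq_bigr => i _; exact: scalerDr.
Qed.

Lemma convDl f g h : conv (f + g) h = conv f h + conv g h.
Proof.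
apply/funext => n; rewrite /conv -[RHS]big_split.
by apply: eq_bigr => i _; exact: scalerDl.
Qed.
End Convolution.

Section ConvolutionAC.
Variables (R : comPzRingType) (M : lmodType R).
Implicit Types (f g : nat -> R^o) (h : nat -> M).

Lemma convC f g : conv f g = conv g f.
Proof.
apply/funext => n; rewrite /conv (reindex_inj rev_ord_inj) /=.
apply: eq_bigr => i _; have ile : (i <= n)%N by rewrite -ltnS.
by rewrite subSS subKn // [LHS]mulrC.
Qed.

Lemma convA f g h : conv f (conv g h) = conv (conv f g) h.
Proof.
apply/funext => n; rewrite /conv.
transitivity (\sum_(i < n.+1) \sum_(k < n.+1 | (i <= k)%N)
    (f i * g (k - i)%N) *: h (n - k)%N).
  apply: eq_bigr => i _; have ile : (i <= n)%N by rewrite -ltnS.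
  rewrite scaler_sumr.
  rewrite -(big_geq_mkord i n.+1 xpredT
    (fun k => (f i * g (k - i)%N) *: h (n - k)%N)).
  rewrite -[X in _ = \sum_(X <= _ < _) _]add0n big_addn subSn // big_mkord.
  by apply: eq_bigr => j _; rewrite scalerA addnK addnC subnDA.
rewrite (exchange_big_dep xpredT) //=; apply: eq_bigr => k _.
rewrite scaler_suml (big_ord_widen_cond n.+1 xpredT
  (fun i => (f i * g (k - i)%N) *: h (n - k)%N)) //.
Qed.
End ConvolutionAC.

Section AssociatedGraded.
Local Open Scope classical_set_scope.
Variables (R : comPzRingType) (m : {pred R}) (M : lmodType R).
Variable F : stable_filtration M m.

Definition next_pred : {pred submod (dsum F)} :=
  [pred f | `[< forall j, submod_val f j \in F j.+1 >]].

Lemma next_pred_closed : subsemimod_closed next_pred.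
Proof.
apply/GRing.submod_closed_semi; split.
  by apply/asboolP => j; rewrite [submod_val _ _](_ : _ = 0) ?rpred0.
move=> a f g /asboolP fF /asboolP gF; apply/asboolP => j.
by rewrite [submod_val _ _](_ : _ = a *: submod_val f j + submod_val g j)
  ?rpredD ?rpredZ.
Qed.
HB.instance Definition _ :=
  GRing.isSubmodClosed.Build R _ next_pred next_pred_closed.

(* The direct sum of the quotients F j / F j.+1, as the quotient of the direct
   sum of the F j by the direct sum of the F j.+1. *)
Definition gr : Type := lquot (next_pred : submodClosed _).
HB.instance Definition _ := GRing.Lmodule.on gr.

Definition gr_proj : submod (dsum F) -> gr := @lproj R _ next_pred.
Definition gr_repr : gr -> submod (dsum F) := @lrepr R _ next_pred.

Lemma gr_reprK : cancel gr_repr gr_proj. Proof. exact: lreprK. Qed.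
Lemma gr_proj_eq f g : (gr_proj f = gr_proj g) <->
  forall j, submod_val f j - submod_val g j \in F j.+1.
Proof. by split=> [/lproj_eq/asboolP|H]; [|apply/lproj_eq/asboolP]. Qed.
Lemma gr_projD : {morph gr_proj : f g / f + g}.
Proof. exact: raddfD. Qed.

(* The copy of F j / F j.+1 in degree j. *)
Definition gr_comp (j : nat) : {pred gr} :=
  [pred t | `[< exists2 f : submod (dsum F),
    (forall k, k != j -> submod_val f k = 0) & t = gr_proj f >]].
End AssociatedGraded.

Section GradedAction.
Local Open Scope classical_set_scope.
Variables (R : comPzRingType) (m : {pred R}) (M : lmodType R).
Variable F : stable_filtration M m.

Lemma conv_dsum (f : submod (dsum (adic m))) (g : submod (dsum F)) :
  conv (submod_val f) (submod_val g) \in dsum F.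
Proof.
have /asboolP[/finite_seqP[s sE] fF] := submod_valP f.
have /asboolP[/finite_seqP[t tE] gF] := submod_valP g.
apply/asboolP; split=> [|n]; last first.
  rewrite rpred_sum // => i _.
  have iE : (i + (n - i) = n)%N by rewrite subnKC // -ltnS.
  by rewrite -[n in F n]iE; apply: fil_ideal_power.
apply: (@sub_finite_set _ _ [set` [seq (i + j)%N | i <- s, j <- t]]) => // n.
apply: contraPP => /= nst; apply/negP/negPn/eqP/big1 => i _.
have [->|fi] := eqVneq (submod_val f i) 0; first by rewrite scale0r.
have [->|gi] := eqVneq (submod_val g (n - i)%N) 0; first by rewrite scaler0.
case: nst; apply/allpairsP; exists (i : nat, (n - i)%N) => /=; split.
- by have : [set` s] (i : nat) by rewrite -sE.
- by have : [set` t] (n - i)%N by rewrite -tE.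
- by rewrite subnKC // -ltnS.
Qed.

(* The action induced by the products F i x F j -> F (i + j); for F = adic m it
   is the multiplication of gr_m(R). *)
Definition gr_act (a : gr (adic m)) (t : gr F) : gr F :=
  gr_proj (Submod (conv_dsum (gr_repr a) (gr_repr t))).

Lemma gr_actE f g : gr_act (gr_proj f) (gr_proj g) =
  gr_proj (Submod (conv_dsum f g)).
Proof.
have /gr_proj_eq Hf := gr_reprK (gr_proj f).
have /gr_proj_eq Hg := gr_reprK (gr_proj g).
rewrite /gr_act; move: (gr_repr (gr_proj f)) Hf => f' Hf.
move: (gr_repr (gr_proj g)) Hg => g' Hg.
apply/gr_proj_eq => n; rewrite /= /conv -sumrB rpred_sum // => i _.
have iE : (i + (n - i) = n)%N by rewrite subnKC // -ltnS.
rewrite -(subrK (submod_val f' i *: submod_val g (n - i)%N)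
  (submod_val f' i *: submod_val g' (n - i)%N)) -addrA -scalerBr -scalerBl.
have /asboolP[_ f'F] := submod_valP f'; have /asboolP[_ gF] := submod_valP g.
rewrite rpredD //.
  rewrite (_ : fil F n.+1 = F (i + (n - i).+1)%N); last by rewrite addnS iE.
  exact: fil_ideal_power.
rewrite (_ : fil F n.+1 = F (i.+1 + (n - i))%N); last by rewrite addSn iE.
exact: fil_ideal_power.
Qed.

Lemma gr_actDr a : {morph gr_act a : t u / t + u}.
Proof.
move=> t u; rewrite -[a]gr_reprK -[t]gr_reprK -[u]gr_reprK -gr_projD !gr_actE.
by rewrite -gr_projD; congr gr_proj; apply: val_inj; rewrite /= convDr.
Qed.

Lemma gr_actDl t : {morph gr_act^~ t : a b / a + b}.
Proof.
move=> a b /=; rewrite -[a]gr_reprK -[t]gr_reprK -[b]gr_reprK -gr_projD !gr_actE.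
by rewrite -gr_projD; congr gr_proj; apply: val_inj; rewrite /= convDl.
Qed.
End GradedAction.

Section GradedRing.
Local Open Scope classical_set_scope.
Variables (R : comPzRingType) (m : {pred R}).

Lemma conv1_dsum : @conv1 R \in dsum (adic m).
Proof.
apply/asboolP; split=> [|[|j]]; rewrite ?rpred0 //.
by apply: (@sub_finite_set _ _ [set 0%N]) => // -[|j] //=; rewrite eqxx.
Qed.

Definition gr1 : gr (adic m) := gr_proj (Submod conv1_dsum).

Lemma gr_act1 (M : lmodType R) (F : stable_filtration M m) :
  left_id gr1 (@gr_act R m M F).
Proof.
move=> t; rewrite -[t]gr_reprK gr_actE.
by congr gr_proj; apply: val_inj; rewrite /= conv1f.
Qed.

Lemma gr_actA (M : lmodType R) (F : stable_filtration M m) a b (t : gr F) :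
  gr_act a (gr_act b t) = gr_act (gr_act a b) t.
Proof.
rewrite -[a]gr_reprK -[b]gr_reprK -[t]gr_reprK !gr_actE.
by congr gr_proj; apply: val_inj; rewrite /= convA.
Qed.

Lemma gr_actC : commutative (@gr_act R m R^o (adic m)).
Proof.
move=> a b; rewrite -[a]gr_reprK -[b]gr_reprK !gr_actE.
by congr gr_proj; apply: val_inj; rewrite /= convC.
Qed.

Definition gr_ring : Type := gr (adic m).
HB.instance Definition _ := GRing.Zmodule.on gr_ring.
HB.instance Definition _ := GRing.Zmodule_isComPzRing.Build gr_ring
  (@gr_actA R^o (adic m)) gr_actC (@gr_act1 R^o (adic m))
  (fun a b c => @gr_actDl R m R^o (adic m) c a b).

Definition gr_ring_comp (j : nat) : {pred gr_ring} := gr_comp (F := adic m) j.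

(* R / m = m^0 / m^1, as the subring gr_m(R)_0 of gr_m(R). *)
Definition residue_field : {pred gr_ring} := gr_ring_comp 0.
End GradedRing.
Arguments gr_ring_comp {R} m j _.
Arguments residue_field {R} m _.

Section GradedModule.
Variables (R : comPzRingType) (m : {pred R}) (M : lmodType R).
Variable F : stable_filtration M m.

Definition gr_mod : Type := gr F.
HB.instance Definition _ := GRing.Zmodule.on gr_mod.
HB.instance Definition _ := GRing.Zmodule_isLmodule.Build (gr_ring m) gr_mod
  (@gr_actA R m M F) (@gr_act1 R m M F) (@gr_actDr R m M F) (@gr_actDl R m M F).

Definition gr_mod_comp (j : nat) : {pred gr_mod} := gr_comp (F := F) j.
End GradedModule.
Arguments gr_mod_comp {R m M} F j _.

Section TensorFree.
Local Open Scope classical_set_scope.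
Variables (A : comPzRingType) (N : lmodType A).

Lemma basis_vec_dsum (B : choiceType) (b : B) :
  (fun x => (x == b)%:R : A^o) \in dsum (fun _ : B => full A^o).
Proof.
apply/asboolP; split=> //; apply: (@sub_finite_set _ _ [set b]) => // x /=.
by have [->//|_] := eqVneq x b; rewrite eqxx.
Qed.

Definition basis_vec (B : choiceType) (b : B) : copower B A^o :=
  Submod (basis_vec_dsum b).

Lemma tens_dsum (B : Type) (v : copower B A^o) (n : N) :
  (fun b => submod_val v b *: n) \in dsum (fun _ : B => full N).
Proof.
apply/asboolP; split=> //; have /asboolP[vf _] := submod_valP v.
apply: sub_finite_set vf => b /=; apply: contraNN => /eqP ->.
by rewrite scale0r.
Qed.

(* The element v (x) n of A^(B) (x) N = N^(B). *)
Definition tens (B : Type) (v : copower B A^o) (n : N) : copower B N :=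
  Submod (tens_dsum v n).

Lemma tens_linear (B : Type) (v : copower B A^o) : linear (tens v).
Proof.
move=> a n n'; apply: val_inj; apply/funext => b /=.
rewrite -[RHS]/(a *: (submod_val v b *: n) + submod_val v b *: n').
by rewrite scalerDr !scalerA mulrC.
Qed.
HB.instance Definition _ (B : Type) v :=
  GRing.isLinear.Build A N (copower B N) *:%R (@tens B v) (tens_linear v).

(* d (x) N : N^(B) -> N^(C), for d : A^(B) -> A^(C). *)
Definition tens_map (B C : choiceType) (d : copower B A^o -> copower C A^o)
    (g : copower B N) : copower C N :=
  \sum_(b \in [set: B]) tens (d (basis_vec b)) (submod_val g b).

Lemma tens_map_linear (B C : choiceType) (d : copower B A^o -> copower C A^o) :
  linear (tens_map d).
Proof.
move=> a f g; have /asboolP[ff _] := submod_valP f.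
have /asboolP[gf _] := submod_valP g.
have tE (h : copower B N) : [set b | submod_val h b != 0] `<=`
    [set b | submod_val f b != 0] `|` [set b | submod_val g b != 0] ->
  tens_map d h = \sum_(b <- fset_set ([set b | submod_val f b != 0] `|`
    [set b | submod_val g b != 0])) tens (d (basis_vec b)) (submod_val h b).
  move=> hS; apply: fsbigTE => b; rewrite in_fset_set ?finite_setU // => bS.
  have [->|h0] := eqVneq (submod_val h b) 0; first by rewrite linear0.
  by case/negP: bS; apply/mem_set/hS.
rewrite !tE; first last.
- move=> b /=; apply: contraNP => /not_orP[/negP/negbNE/eqP f0 /negP/negbNE/eqP g0].
  by apply/eqP; rewrite -[LHS]/(a *: submod_val f b + submod_val g b) f0 g0 scaler0 addr0.
- by move=> b; left.
- by move=> b; right.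
rewrite scaler_sumr -big_split; apply: eq_bigr => b _ /=.
by rewrite -linearP.
Qed.
HB.instance Definition _ (B C : choiceType) d :=
  GRing.isLinear.Build A (copower B N) (copower C N) *:%R (@tens_map B C d)
    (@tens_map_linear B C d).
End TensorFree.

Record free_resolution (A : comPzRingType) (M : lmodType A) := FreeResolution {
  basis : nat -> choiceType;
  dif : forall i, {linear copower (basis i.+1) A^o -> copower (basis i) A^o};
  aug : {linear copower (basis 0) A^o -> M};
  aug_surj : forall x, exists v, aug v = x;
  aug_exact : forall v, aug v = 0 <-> exists w, dif 0 w = v;
  dif_exact : forall i v, dif i v = 0 <-> exists w, dif i.+1 w = v
}.

Section Tor.
Variables (A : comPzRingType) (M : lmodType A).
Variables (P : free_resolution M) (N : lmodType A).

Definition tor_dif i : copower (basis P i.+1) N -> copower (basis P i) N :=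
  tens_map (dif P i).

Definition cycle_pred i : {pred copower (basis P i) N} :=
  match i return {pred copower (basis P i) N} with
  | 0 => predT
  | k.+1 => [pred z | tor_dif (i := k) z == 0]
  end.

Arguments cycle_pred : clear implicits.

Lemma cycle_pred_closed i : subsemimod_closed (cycle_pred i).
Proof.
case: i => [//|k]; apply/GRing.submod_closed_semi; split.
  by apply/eqP; exact: linear0.
move=> a z w /eqP z0 /eqP w0; apply/eqP; move: z0 w0; rewrite /tor_dif => z0 w0.
by rewrite tens_map_linear z0 w0 scaler0 addr0.
Qed.
HB.instance Definition _ i :=
  GRing.isSubmodClosed.Build A _ (cycle_pred i) (cycle_pred_closed i).
Definition cycle i : submodClosed (copower (basis P i) N) := cycle_pred i.

Definition boundary_pred i : {pred submod (cycle i)} :=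
  [pred z | `[< exists w, tor_dif w = submod_val z >]].

Arguments boundary_pred : clear implicits.

Lemma boundary_pred_closed i : subsemimod_closed (boundary_pred i).
Proof.
apply/GRing.submod_closed_semi; split.
  by apply/asboolP; exists 0; rewrite /tor_dif linear0.
move=> a z w /asboolP[z' zE] /asboolP[w' wE]; apply/asboolP.
by exists (a *: z' + w'); move: zE wE; rewrite /tor_dif tens_map_linear => -> ->.
Qed.
HB.instance Definition _ i :=
  GRing.isSubmodClosed.Build A _ (boundary_pred i) (boundary_pred_closed i).
Definition boundary i : submodClosed (submod (cycle i)) := boundary_pred i.

(* Tor_i^A(M, N), computed from the free resolution P of M as the homology of
   P (x) N; up to isomorphism it does not depend on P. *)
Definition Tor i : lmodType A := lquot (boundary i).
Definition tor_class i (z : submod (cycle i)) : Tor i := lproj (boundary i) z.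
End Tor.

Section Graded.
Variables (A : comPzRingType) (gA : nat -> {pred A}).

(* The degree j part of the direct sum over b of the shifts N(-deg b). *)
Definition shift_comp (N : lmodType A) (gN : nat -> {pred N}) (B : choiceType)
    (deg : B -> nat) (j : nat) : {pred copower B N} :=
  [pred g | `[< forall b, if (deg b <= j)%N
    then submod_val g b \in gN (j - deg b)%N else submod_val g b == 0 >]].

(* Generators in nonnegative degrees: all modules considered are nonnegatively
   graded. *)
Record graded_free_resolution (M : lmodType A) (gM : nat -> {pred M}) :=
  GradedFreeResolution {
  gres :> free_resolution M;
  deg : forall i, basis gres i -> nat;
  aug_deg : forall j v,
    v \in shift_comp (gA : nat -> {pred A^o}) (deg (i := 0)) j ->
    aug gres v \in gM j;
  dif_deg : forall i j v,
    v \in shift_comp (gA : nat -> {pred A^o}) (deg (i := i.+1)) j ->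
    dif gres i v \in shift_comp (gA : nat -> {pred A^o}) (deg (i := i)) j
}.

Arguments deg {M gM} _ i _.

Definition tor_comp (M : lmodType A) (gM : nat -> {pred M})
    (P : graded_free_resolution gM) (N : lmodType A) (gN : nat -> {pred N})
    (i j : nat) : {pred Tor P N i} :=
  [pred t | `[< exists2 z, submod_val z \in shift_comp gN (deg P i) j &
    t = tor_class z >]].

(* The dimension of S as a vector space over K, for K a subring of A that is a
   field and S a subset of L stable under sums and the action of K. *)
Definition has_dim (K : {pred A}) (L : lmodType A) (S : {pred L}) (d : nat) :=
  exists2 v : 'I_d -> L, (forall k, v k \in S) &
    forall x, x \in S -> exists! c : 'I_d -> A,
      (forall k, c k \in K) /\ x = \sum_k c k *: v k.
End Graded.
Arguments tor_comp {A gA M gM} P {N} gN i j _.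

Definition fin_gen (A : pzRingType) (V : lmodType A) (S : {pred V}) : Prop :=
  exists s : seq V, forall x, x \in S <->
    exists c : 'I_(size s) -> A, x = \sum_k c k *: s`_k.

Definition noetherian (R : comNzRingType) : Prop :=
  forall I : submodClosed R^o, fin_gen I.

Definition maximal_ideal (R : comNzRingType) (I : {pred R}) : Prop :=
  idealr_closed I /\
  forall J : {pred R}, idealr_closed J -> {subset I <= J} -> J =i I.

Definition local_ring (R : comNzRingType) (m : {pred R}) : Prop :=
  maximal_ideal m /\ forall I : {pred R}, maximal_ideal I -> I =i m.

(* The coefficient of z^i t^j in z^(k+1) t^a + z^k t^b. *)
Definition cancel_coef (k a b i j : nat) : nat :=
  (((i == k.+1) && (j == a)) + ((i == k) && (j == b)))%N.

(* The series with coefficients q is obtained from that with coefficients p by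
   negative consecutive cancellations; n bounds the (k, a, b) contributing to
   the coefficient of z^i t^j. *)
Definition neg_cancellations (p q : nat -> nat -> nat) : Prop :=
  exists c : nat -> nat -> nat -> nat, forall i j, exists n : nat,
    (forall k a b, (a < b)%N -> (c k a b * cancel_coef k a b i j != 0)%N ->
       (k < n)%N && (b < n)%N) /\
    p i j = (q i j + \sum_(k < n) \sum_(b < n) \sum_(a < b)
                       c k a b * cancel_coef k a b i j)%N.

(* Main.v *)
From HB Require Import structures.
Require Import Defs.
From mathcomp Require Import all_boot all_algebra finmap.
From mathcomp Require Import boolp classical_sets functions cardinality fsbigop.
From mathcomp Require Import zify.

(** Idea of the proof: compute both Tor modules from one filtered complex C and
count dimensions in its spectral sequence.

A finite module M with an m-stable filtration has a resolution F by free
modules of finite rank, filtered by shifts of the m-adic filtration, which is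
strict: it is exact at each step of the filtrations
([filtered_resolution_exists]).  It is built by covering M, then the kernel of
the cover with the induced filtration, and so on; the induced filtration is
stable again by the Artin-Rees lemma ([artin_rees]).  By strictness gr F is a
graded free resolution of gr M over G = gr_m(R) ([gr_resolution]).  Let C be
the tensor product of F and N, filtered by shifts of the filtration of N.  The
homology of C is Tor^R(M, N), which receives from the cycles of C a filtration
that is stable by Artin-Rees, and gr C is the tensor product of gr F and gr N,
whose homology is Tor^G(gr M, gr N).

Both Hilbert series are read off a chain of subspaces of Fil j / Fil j.+1 in
C i.  From the top: the classes of x in Fil j with boundary in Fil b, for
b = j.+1, j.+2, ... ([near_cycle]); the classes of cycles ([cycle_mod]); the
classes of boundaries of elements of Fil a, for a = 0, 1, ..., j ([bdry_mod]).
The extremes are the cycles and the boundaries of gr C, while the two middle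
terms give the graded module of the homology of C.  The differential identifies
the quotient of [near_cycle] at (i.+1, a) between b and b.+1 with the quotient
of [bdry_mod] at (i, b) between a and a.+1 ([bdry_near_cycle_iso]): its
dimension is lost once in the coefficient of z^(i+1) t^a and once in that of
z^i t^b, with a < b.  Artin-Rees makes every chain finite ([strict_image]).
This gives [filtered_complex_cancellations_cancellations].

The resolutions P and Q that define the two Tor modules are arbitrary, possibly
of infinite rank, so they are compared with F and gr F by chain homotopy
equivalences.  One lemma, [homog_resolution_qis], covers both cases: over R all
gradings are concentrated in degree 0.

Artin-Rees is deduced from a Hilbert basis theorem for Noetherian modules with
commuting operators ([adjoin_noeth]), applied to the Rees module. *)

Set Implicit Arguments.
Unset Strict Implicit.
Unset Printing Implicit Defensive.

Import GRing.Theory.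
Local Open Scope ring_scope.

(** * Noetherian modules with operators *)

Section PropSubmodules.
Variables (R : pzRingType) (V : lmodType R).
Implicit Types (X Y : V -> Prop) (s : seq V).

Definition subm X := X 0 /\ forall (a : R) x y, X x -> X y -> X (a *: x + y).

Lemma subm0 X : subm X -> X 0. Proof. by case. Qed.
Lemma submP X a x y : subm X -> X x -> X y -> X (a *: x + y).
Proof. by case=> _; exact. Qed.
Lemma submD X x y : subm X -> X x -> X y -> X (x + y).
Proof. by move=> Xs Xx Xy; rewrite -[x]scale1r; apply: submP. Qed.
Lemma submZ X a x : subm X -> X x -> X (a *: x).
Proof. by move=> Xs Xx; rewrite -[_ *: _]addr0; apply: submP => //; case: Xs. Qed.
Lemma submN X x : subm X -> X x -> X (- x).
Proof. by move=> Xs Xx; rewrite -scaleN1r; apply: submZ. Qed.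
Lemma submB X x y : subm X -> X x -> X y -> X (x - y).
Proof. by move=> Xs Xx Xy; apply: submD => //; apply: submN. Qed.
Lemma subm_sum X (I : Type) (r : seq I) (P : pred I) (F : I -> V) :
  subm X -> (forall i, P i -> X (F i)) -> X (\sum_(i <- r | P i) F i).
Proof.
move=> Xs XF; elim/big_rec: _ => [|i x Pi Xx]; first exact: subm0.
by apply: submD => //; apply: XF.
Qed.

Lemma subm_mem (S : submodClosed V) : subm (fun x => x \in S).
Proof. by split=> [|a x y Sx Sy]; rewrite ?rpred0 ?rpredD ?rpredZ. Qed.

Lemma subm_cap X Y : subm X -> subm Y -> subm (fun x => X x /\ Y x).
Proof.
move=> Xs Ys; split=> [|a x y [Xx Yx] [Xy Yy]]; first by split; apply: subm0.
by split; apply: submP.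
Qed.

(** The span of s is given by its universal property, so that a statement about
it is proved by exhibiting a submodule; coefficients appear only in
[gen_sum]. *)
Definition gen s : V -> Prop :=
  fun x => forall W, subm W -> (forall y, y \in s -> W y) -> W x.

Lemma gen_subm s : subm (gen s).
Proof.
split=> [W Ws _|a x y gx gy W Ws sW]; first exact: subm0.
by apply: submP => //; [apply: gx | apply: gy].
Qed.

Lemma mem_gen s x : x \in s -> gen s x.
Proof. by move=> xs W _; apply. Qed.

Lemma gen_nil x : gen [::] x -> x = 0.
Proof.
move=> gx; apply: (gx (fun x => x = 0)) => //.
by split=> // a y z -> ->; rewrite scaler0 addr0.
Qed.

Lemma gen_cons a s x : gen (a :: s) x -> exists r y, gen s y /\ x = r *: a + y.
Proof.
move=> gx; apply: (gx (fun x => exists r y, gen s y /\ x = r *: a + y)) => [|y].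
  split=> [|c y z [r [y' [gy ->]]] [t [z' [gz ->]]]].
    by exists 0, 0; rewrite scale0r addr0; split=> //; apply: subm0 (gen_subm _).
  exists (c * r + t), (c *: y' + z'); split.
    exact: (submP _ (gen_subm s)).
  by rewrite scalerDr scalerDl scalerA addrACA.
rewrite inE => /orP[/eqP ->|ys].
  by exists 1, 0; rewrite scale1r addr0; split=> //; apply: subm0 (gen_subm _).
by exists 0, y; rewrite scale0r add0r; split=> //; apply: mem_gen.
Qed.

Lemma gen_sum s x : gen s x -> exists c : 'I_(size s) -> R, x = \sum_k c k *: s`_k.
Proof.
elim: s x => [x /gen_nil ->|a s IH x /gen_cons[r [y [/IH[c ->] ->]]]].
  by exists (fun=> 0); rewrite big_ord0.
exists (fun k => if unlift ord0 k is Some j then c j else r).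
rewrite big_ord_recl /= unlift_none; congr (_ + _).
by apply: eq_bigr => k _; rewrite liftK.
Qed.

Lemma fin_genP X : (exists s, forall x, X x <-> gen s x) <->
  (exists s, forall x, X x <-> exists c : 'I_(size s) -> R, x = \sum_k c k *: s`_k).
Proof.
split=> -[s sP]; exists s => x.
  rewrite sP; split=> [/gen_sum//|[c ->]].
  apply: (subm_sum _ (gen_subm s)) => k _.
  by apply: (submZ _ (gen_subm s)); apply: mem_gen; rewrite mem_nth.
rewrite sP; split=> [[c ->]|/gen_sum//].
apply: (subm_sum _ (gen_subm s)) => k _.
by apply: (submZ _ (gen_subm s)); apply: mem_gen; rewrite mem_nth.
Qed.

Definition prop_pred X : {pred V} := fun x => `[< X x >].
Lemma prop_pred_closed X : subm X -> subsemimod_closed (prop_pred X).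
Proof.
move=> Xs; apply/GRing.submod_closed_semi; split.
  by apply/asboolP; apply: subm0.
by move=> a x y /asboolP Xx /asboolP Xy; apply/asboolP; apply: submP.
Qed.
End PropSubmodules.

Section MkSub.
Variables (R : pzRingType) (V : lmodType R) (X : V -> Prop) (Xs : subm X).

(** The proof is a parameter of the predicate so that the instance below can use
it. *)
Definition mk_pred : {pred V} := let _ := Xs in prop_pred X.
HB.instance Definition _ :=
  GRing.isSubmodClosed.Build R V mk_pred (prop_pred_closed Xs).
Definition mk_submod : submodClosed V := mk_pred.
Lemma mk_submodE x : (x \in mk_submod) <-> X x.
Proof. by split=> [/asboolP|Xx]; [|apply/asboolP]. Qed.
End MkSub.

Section Operators.
Variables (R : pzRingType) (V : lmodType R) (T : nat -> {linear V -> V}).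
Hypothesis TC : forall i j x, T i (T j x) = T j (T i x).

Definition opsubm n (W : V -> Prop) :=
  subm W /\ forall i, (i < n)%N -> forall x, W x -> W (T i x).

(** U is a Noetherian module over the algebra generated by T 0, ..., T n.-1; this
form avoids constructing that algebra. *)
Definition noethop n (U : V -> Prop) :=
  forall W, opsubm n W -> (forall x, W x -> U x) ->
  exists2 s : seq V, (forall x, x \in s -> W x) &
    forall W', opsubm n W' -> (forall x, x \in s -> W' x) ->
      forall x, W x -> W' x.

Section Hilbert.
Variables (n : nat) (U : V -> Prop).
Hypotheses (Uop : opsubm n U) (Unoeth : noethop n U).
Let Tn := T n.

(** Polynomials in T n of degree less than d with coefficients in U. *)
Definition low d : V -> Prop := fun x =>
  exists2 u : nat -> V, (forall i, U (u i)) & x = \sum_(i < d) iter i Tn (u i).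
Definition adjoin : V -> Prop := fun x => exists d, low d x.

Let iterT (i : nat) : {linear V -> V}.
Proof.
elim: i => [|i IH]; [exact: idfun | exact: (Tn \o IH)].
Defined.
Let iterTE (i : nat) (x : V) : iterT i x = iter i Tn x.
Proof. by elim: i => //= i <-. Qed.

Lemma iterT_linear i a x y : iter i Tn (a *: x + y) = a *: iter i Tn x + iter i Tn y.
Proof. by rewrite -!iterTE linearP. Qed.

Lemma iterT0 i : iter i Tn 0 = 0.
Proof. by rewrite -iterTE linear0. Qed.

Lemma iterTC i j x : T j (iter i Tn x) = iter i Tn (T j x).
Proof. by elim: i => //= i IH; rewrite TC IH. Qed.

Lemma low_subm d : subm (low d).
Proof.
have [Us _] := Uop; split=> [|a _ _ [u uU ->] [v vU ->]].
  exists (fun=> 0) => [_|]; first exact: subm0.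
  by rewrite big1 // => i _; rewrite iterT0.
exists (fun i => a *: u i + v i) => [i|]; first exact: submP.
rewrite scaler_sumr -big_split; apply: eq_bigr => i _ /=.
by rewrite iterT_linear.
Qed.

Lemma low_op d i x : (i < n)%N -> low d x -> low d (T i x).
Proof.
have [_ Ut] := Uop; move=> ltin [u uU ->].
exists (fun k => T i (u k)) => [k|]; first exact: Ut.
by rewrite linear_sum; apply: eq_bigr => k _; rewrite iterTC.
Qed.

Lemma low_T d x : low d x -> low d.+1 (Tn x).
Proof.
have [Us _] := Uop; move=> [u uU ->].
exists (fun k => if k is k'.+1 then u k' else 0) => [[|k]//|]; first exact: subm0.
rewrite big_ord_recl /= add0r linear_sum; exact: eq_bigr.
Qed.

Lemma low_leq d e x : (d <= e)%N -> low d x -> low e x.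
Proof.
have [Us _] := Uop; move=> lede [u uU ->].
exists (fun k => if (k < d)%N then u k else 0) => [k|].
  by case: ifP => _ //; exact: subm0.
rewrite (big_ord_widen_cond e xpredT (fun i => iter i Tn (u i)) lede).
rewrite [RHS](bigID (fun i : 'I_e => i < d)%N) /= [X in _ + X]big1 ?addr0.
  by apply: eq_bigr => i ->.
by move=> i /negbTE ->; rewrite iterT0.
Qed.

Lemma lowS d x : low d.+1 x -> exists2 u, U u & low d (x - iter d Tn u).
Proof.
move=> [u uU ->]; exists (u d) => //; rewrite big_ord_recr /= addrK.
by exists u.
Qed.

Lemma adjoin_op : opsubm n.+1 adjoin.
Proof.
split=> [|i lein x [d dx]].
  split=> [|a x y [d dx] [e ey]]; first by exists 0%N; apply: subm0 (low_subm 0).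
  exists (maxn d e); apply: (submP _ (low_subm _)).
    by apply: low_leq dx; apply: leq_maxl.
  by apply: low_leq ey; apply: leq_maxr.
move: lein; rewrite ltnS leq_eqVlt => /orP[/eqP ->|ltin].
  by exists d.+1; apply: low_T.
by exists d; apply: low_op.
Qed.

Lemma adjoin_sub x : U x -> adjoin x.
Proof. by move=> Ux; exists 1%N; exists (fun=> x) => //; rewrite big_ord1. Qed.

(** Hilbert's argument.  The leading coefficients of the elements of W of degree
at most d form submodules L d of U that grow with d, and their union is
generated inside one L D.  Lifts of generators of L 0, ..., L D generate W:
subtracting a combination of lifts lowers the degree of any other element. *)
Lemma adjoin_noeth : noethop n.+1 adjoin.
Proof.
have [Us Ut] := Uop.
move=> W [Ws Wt] WU.
pose L Z d x := U x /\ exists2 y, low d y & W (iter d Tn x + y) /\ Z (iter d Tn x + y).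
have Lop Z d : opsubm n.+1 Z -> opsubm n (L Z d).
  move=> [Zs Zt]; split=> [|i ltin x [Ux [y yl [Wy Zy]]]].
    split=> [|a x x' [Ux [y yl [Wy Zy]]] [Ux' [y' yl' [Wy' Zy']]]].
      split; first exact: subm0.
      exists 0; first exact: subm0 (low_subm d).
      by rewrite iterT0 addr0; split; apply: subm0.
    split; first exact: submP.
    exists (a *: y + y'); first exact: (submP _ (low_subm d)).
    by rewrite iterT_linear addrACA -scalerDr; split; apply: submP.
  split; first exact: Ut.
  exists (T i y); first exact: low_op.
  by rewrite -iterTC -linearD; split; [apply: Wt|apply: Zt] => //; apply: ltnW.
have LS Z d x : opsubm n.+1 Z -> L Z d x -> L Z d.+1 x.
  move=> [Zs Zt] [Ux [y yl [Wy Zy]]]; split=> //.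
  exists (Tn y); first exact: low_T.
  by rewrite iterS -linearD; split; [apply: Wt|apply: Zt].
have Lmono Z d e x : opsubm n.+1 Z -> (d <= e)%N -> L Z d x -> L Z e x.
  move=> Zop /subnK <-; elim: (e - d)%N => //= k IH Lx.
  by rewrite addSn; apply: LS => //; apply: IH.
have Wop : opsubm n.+1 W by split.
have [||s sL sG] := Unoeth (W := fun x => exists d, L W d x).
- split=> [|i ltin x [d dx]].
    split=> [|a x y [d dx] [e ey]]; first by exists 0%N; apply: subm0 (Lop W 0%N Wop).1.
    exists (maxn d e); apply: (submP _ (Lop W _ Wop).1).
      by apply: Lmono dx => //; apply: leq_maxl.
    by apply: Lmono ey => //; apply: leq_maxr.
  by exists d; apply: (Lop W d Wop).2.
- by move=> x [d []].
have [D sD] : exists D, forall x, x \in s -> L W D x.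
  elim: s sL {sG} => [|a s IH] sL; first by exists 0%N.
  have [x xs|D DP] := IH; first by apply: sL; rewrite inE xs orbT.
  have [d dP] := sL a (mem_head _ _).
  exists (maxn d D) => x; rewrite inE => /orP[/eqP ->|xs].
    by apply: Lmono dP => //; apply: leq_maxl.
  by apply: Lmono (DP x xs) => //; apply: leq_maxr.
have LD d x : L W d x -> L W D x.
  move=> Lx; apply: (sG (L W D)) => //; first exact: Lop.
  by exists d.
(* Finitely many elements of W whose leading coefficients generate L W d; they
   are used through any submodule Z that contains them. *)
have lifts d : exists2 r : seq V, (forall x, x \in r -> W x) &
    forall Z, opsubm n.+1 Z -> (forall x, x \in r -> Z x) ->
      forall x, L W d x -> L Z d x.
  have [||t tL tG] := Unoeth (W := L W d); [exact: Lop|by move=> x []|].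
  have [r rW rP] : exists2 r : seq V, (forall x, x \in r -> W x) &
      forall Z, (forall x, x \in r -> Z x) -> forall x, x \in t -> L Z d x.
    elim: t tL {tG} => [|a t IH] tL; first by exists [::].
    have [x xs|r rW rP] := IH; first by apply: tL; rewrite inE xs orbT.
    have [Ua [y yl [Wy _]]] := tL a (mem_head _ _).
    exists ((iter d Tn a + y) :: r) => [x|Z rZ x].
      by rewrite inE => /orP[/eqP ->|/rW].
    rewrite inE => /orP[/eqP ->|xt].
      by split=> //; exists y => //; split=> //; apply: rZ; rewrite mem_head.
    by apply: rP => // z zr; apply: rZ; rewrite inE zr orbT.
  exists r => // Z Zop rZ; apply: tG; first exact: Lop.
  exact: rP.
have [r rW rG] : exists2 r : seq V, (forall x, x \in r -> W x) &
    forall Z, opsubm n.+1 Z -> (forall x, x \in r -> Z x) ->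
      forall d, (d <= D)%N -> forall x, L W d x -> L Z d x.
  elim: D {LD sD} => [|D [r rW rG]].
    have [r rW rG] := lifts 0%N; exists r => // Z Zop rZ d.
    by rewrite leqn0 => /eqP ->; apply: rG.
  have [t tW tG] := lifts D.+1; exists (r ++ t) => [x|Z Zop rtZ d].
    by rewrite mem_cat => /orP[/rW|/tW].
  rewrite leq_eqVlt => /orP[/eqP ->|ltdD].
    by apply: tG => // x xt; apply: rtZ; rewrite mem_cat xt orbT.
  by apply: rG => // x xr; apply: rtZ; rewrite mem_cat xr.
exists r => // Z Zop rZ x Wx.
have [d] := WU x Wx; elim: d x Wx => [|d IH] x Wx.
  by move=> [u _ ->]; rewrite big_ord0; apply: subm0 Zop.1.
move=> /lowS[u Uu xu].
have Lu : L W d u.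
  split=> //; exists (x - iter d Tn u) => //.
  by rewrite addrC subrK.
(* Below D a lift is available in degree d; above D one is multiplied by a
   power of T n. *)
have [_ [y yl [Wy Zy]]] : L Z d u.
  have [ledD|ltDd] := leqP d D; first exact: rG.
  apply: (Lmono _ D) => //; first exact: ltnW.
  by apply: rG => //; apply: LD Lu.
rewrite -(subrK (iter d Tn u + y) x); apply: submD Zop.1 _ Zy.
apply: IH; first exact: submB.
by rewrite opprD addrA; apply: submB => //; exact: low_subm.
Qed.
End Hilbert.

Fixpoint adjoins (U : V -> Prop) n : V -> Prop :=
  if n is k.+1 then adjoin k (adjoins U k) else U.

Lemma adjoinsP U n : opsubm 0 U -> noethop 0 U ->
  opsubm n (adjoins U n) /\ noethop n (adjoins U n).
Proof.
move=> Us Un; elim: n => [//|n [IH1 IH2]].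
by split; [apply: adjoin_op | apply: adjoin_noeth].
Qed.

Lemma adjoins_sub U n x : U x -> adjoins U n x.
Proof. by move=> Ux; elim: n => //= n IH; apply: adjoin_sub. Qed.
End Operators.

Section NoetherianRing.
Variables (R : comNzRingType).
Hypothesis Rnoeth : noetherian R.

Lemma noeth_ideal (I : R -> Prop) : subm (I : R^o -> Prop) ->
  exists s : seq R^o, forall x : R^o, I x <-> gen s x.
Proof.
move=> Is; have /fin_genP[s sP] := Rnoeth (mk_submod Is).
by exists s => x; rewrite -sP mk_submodE.
Qed.

Variable V : lmodType R.

Definition noeth (U : V -> Prop) := forall W, subm W -> (forall x, W x -> U x) ->
  exists s, forall x, W x <-> gen s x.

(** Induction on the generators: the coefficients of the first one in elements of
W form an ideal, and the elements of W without it lie in a smaller span. *)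
Lemma noeth_gen (g : seq V) : noeth (gen g).
Proof.
elim: g => [|a g IH] W Ws WU.
  exists [::] => x; split=> [/WU//|/gen_nil ->]; exact: subm0.
pose I r := exists2 y, gen g y & W (r *: a + y).
have Is : subm (I : R^o -> Prop).
  split=> [|c r t [y gy Wy] [z gz Wz]].
    by exists 0; [exact: subm0 (gen_subm _)|rewrite scale0r addr0; exact: subm0].
  exists (c *: y + z); first exact: (submP _ (gen_subm g)).
  rewrite scalerDl addrACA -scalerA -scalerDr; exact: submP.
have [rs rsP] := noeth_ideal Is.
have [|x [_ gx]//|s sP] := IH (fun x => W x /\ gen g x).
  by apply: subm_cap => //; exact: gen_subm.
have [ws wsW wsP] : exists2 ws : seq V, (forall x, x \in ws -> W x) &
    forall r, r \in rs -> exists2 y, gen g y & gen ws (r *: a + y).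
  have : forall r, r \in rs -> I r by move=> r rrs; apply/rsP; apply: mem_gen.
  elim: (rs : seq R) => [|r t IHt] tI; first by exists [::].
  have [z zt|ws wsW wsP] := IHt; first by apply: tI; rewrite inE zt orbT.
  have [y gy Wy] := tI r (mem_head _ _).
  exists (r *: a + y :: ws) => [x|z].
    by rewrite inE => /orP[/eqP ->|/wsW].
  rewrite inE => /orP[/eqP ->|/wsP[y' gy' gz]].
    by exists y => //; apply: mem_gen; rewrite mem_head.
  by exists y' => // Z Zs wZ; apply: gz => // u uw; apply: wZ; rewrite inE uw orbT.
exists (ws ++ s) => x; split=> [Wx|]; last first.
  move=> gx; apply: (gx W) => // y; rewrite mem_cat => /orP[/wsW//|ys].
  by have /sP[] := mem_gen ys.
have [r [y [gy xE]]] := gen_cons (WU x Wx).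
have /rsP gr : I r by exists y => //; rewrite -xE.
have sub1 z : gen ws z -> gen (ws ++ s) z.
  by move=> gz Z Zs sZ; apply: gz => // u uw; apply: sZ; rewrite mem_cat uw.
have sub2 z : gen s z -> gen (ws ++ s) z.
  by move=> gz Z Zs sZ; apply: gz => // u uw; apply: sZ; rewrite mem_cat uw orbT.
have [z gz wz] : exists2 z, gen g z & gen ws (r *: a + z).
  apply: (gr (fun r => exists2 z, gen g z & gen ws (r *: a + z))).
    split=> [|c t t' [u gu wu] [v gv wv]].
      exists 0; first exact: subm0 (gen_subm _).
      rewrite scale0r addr0; exact: subm0 (gen_subm _).
    exists (c *: u + v); first exact: (submP _ (gen_subm g)).
    rewrite scalerDl addrACA -scalerA -scalerDr; exact: (submP _ (gen_subm ws)).
  exact: wsP.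
rewrite -(subrK (r *: a + z) x); apply: (submD (gen_subm _)); last exact: sub1.
apply: sub2; apply/sP; split.
  apply: submB => //; exact: (wz _ Ws wsW).
rewrite xE opprD addrACA subrr add0r; exact: (submB (gen_subm g)).
Qed.
End NoetherianRing.

(** * The Artin-Rees lemma *)

Section IdealTimes.
Variables (R : comPzRingType) (V : lmodType R).
Implicit Types (I : {pred R}) (X : V -> Prop).

Definition ideal_mul I X : V -> Prop := fun x => forall W, subm W ->
  (forall a y, a \in I -> X y -> W (a *: y)) -> W x.

Lemma ideal_mul_subm I X : subm (ideal_mul I X).
Proof.
split=> [W Ws _|a x y gx gy W Ws sW]; first exact: subm0.
by apply: submP => //; [apply: gx | apply: gy].
Qed.

Lemma mem_ideal_mul I X a x : a \in I -> X x -> ideal_mul I X (a *: x).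
Proof. by move=> aI Xx W _; apply. Qed.

Lemma ideal_mul_idealM I (S : submodClosed V) x :
  x \in idealM I S <-> ideal_mul I (fun y => y \in S) x.
Proof.
split=> [/asboolP[s sIS ->] W Ws WI|].
  rewrite big_seq; apply: (subm_sum _ Ws) => u /sIS[]; exact: WI.
move=> gx; apply: (gx (fun x => x \in idealM I S)); first exact: subm_mem.
move=> a y aI yS; apply/asboolP; exists [:: (a, y)]; last by rewrite big_seq1.
by move=> u; rewrite inE => /eqP ->.
Qed.

(** Unlike in [stable_filtration], F 0 may be a proper submodule, so the
filtration induced on a submodule of V is again of this kind. *)
Record stable_fil I (F : nat -> V -> Prop) : Prop := StableFil {
  stable_fil_subm : forall j, subm (F j);
  ps_desc : forall j x, F j.+1 x -> F j x;
  ps_mul : forall j a x, a \in I -> F j x -> F j.+1 (a *: x);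
  ps_stab : exists k, forall j, (k <= j)%N -> forall x, F j.+1 x -> ideal_mul I (F j) x
}.

Lemma ps_leq I F i j x : stable_fil I F -> (i <= j)%N -> F j x -> F i x.
Proof.
move=> Fp /subnK <-; elim: (j - i)%N => //= k IH; rewrite addSn => /(ps_desc Fp).
exact: IH.
Qed.

Lemma stable_fil_of I (F : stable_filtration V I) : stable_fil I (fun j x => x \in F j).
Proof.
split=> [j|j x|j a x aI xF|].
- exact: subm_mem.
- exact: fil_desc.
- by apply: fil_mul; apply/ideal_mul_idealM; apply: mem_ideal_mul.
have [k kP] := fil_stable F; exists k => j kj x.
by rewrite -kP // => /ideal_mul_idealM.
Qed.
End IdealTimes.

Section Shift.
Variables (R : comPzRingType) (V : lmodType R) (a : R).

(** Multiplication by a t on sequences of elements of V, seen as power series in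
t; for a in I it acts on the Rees module. *)
Definition shift_mul (h : nat -> V) : nat -> V :=
  fun n => if n is k.+1 then a *: h k else 0.
Lemma shift_mul_linear : linear shift_mul.
Proof.
move=> c h h'; apply/funext => -[|k] /=.
  by rewrite -[RHS]/(c *: 0 + 0 : V) scaler0 addr0.
rewrite -[RHS]/(c *: (a *: h k) + a *: h' k).
by rewrite -[(c *: h + h') k]/(c *: h k + h' k) scalerDr !scalerA mulrC.
Qed.
HB.instance Definition _ :=
  GRing.isLinear.Build R (nat -> V) (nat -> V) *:%R shift_mul shift_mul_linear.
End Shift.

Section ArtinRees.
Variables (R : comNzRingType) (I : {pred R}) (V : lmodType R).
Variables (F : nat -> V -> Prop) (W : V -> Prop).
Hypotheses (Rnoeth : noetherian R) (Ii : subm (fun a : R^o => a \in I)).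
Hypotheses (Fp : stable_fil I F) (Fn : noeth (F 0%N)) (Ws : subm W).

Let pt (j : nat) (x : V) : nat -> V := fun n => if n == j then x else 0.

Let pt_linear j a x y : pt j (a *: x + y) = a *: pt j x + pt j y.
Proof.
apply/funext => n; rewrite -[RHS]/(a *: pt j x n + pt j y n) /pt.
by case: eqP; rewrite ?scaler0 ?addr0.
Qed.

Let pt0 j : pt j 0 = 0.
Proof. by apply/funext => n; rewrite /pt; case: ifP. Qed.

Let ptS j a x : pt j.+1 (a *: x) = shift_mul a (pt j x).
Proof.
by apply/funext => -[|n] //=; rewrite /pt eqSS; case: eqP; rewrite ?scaler0.
Qed.

Let ptD (h : nat -> V) (n : nat) :
  h = (\sum_(i < n) pt i (h i)) + (fun i => if (i < n)%N then 0 else h i).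
Proof.
elim: n => [|n IH]; first by rewrite big_ord0 add0r.
rewrite {1}IH big_ord_recr /= -addrA; congr (_ + _); apply/funext => i.
rewrite -[RHS]/(pt n (h n) i + if (i < n.+1)%N then 0 else h i) /pt ltnS [(i <=
  n)%N]leq_eqVlt.
by case: (eqVneq i n) => [->|ne] /=; rewrite ?ltnn ?addr0 ?add0r.
Qed.

(** The finitely supported sequences h with h j in F j form the Rees module.  It
is generated by its terms of degree at most k under the operators given by
generators of I, hence it is Noetherian with these operators.  So the
sequences with values in W have finitely many generators, and beyond the
degrees of these every term is a combination of terms one degree lower with
coefficients in I. *)
Lemma artin_rees : stable_fil I (fun j x => W x /\ F j x).
Proof.
have [k kP] := ps_stab Fp.
split=> [j|j x [Wx /(ps_desc Fp)]//|j a x aI [Wx Fx]|].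
- exact: (subm_cap Ws (stable_fil_subm Fp j)).
- by split; [apply: submZ | apply: (ps_mul Fp)].
have [as_ asP] := noeth_ideal Rnoeth Ii.
pose T i : {linear (nat -> V) -> (nat -> V)} := shift_mul (as_`_i : R).
have TC i j (x : nat -> V) : T i (T j x) = T j (T i x).
  apply/funext => -[|[|n]] //=; rewrite ?scaler0 //.
  by rewrite !scalerA mulrC.
have [g gF gP] : exists2 g : seq (nat -> V), (forall h, h \in g -> exists2 j,
  (j <= k)%N & exists2 x, F j x & h = pt j x) &
    forall j, (j <= k)%N -> forall x, F j x -> gen g (pt j x).
  elim: {kP} k => [|k [g gF gP]].
    have [||s sP] := Fn (W := F 0%N) => //; first exact: (stable_fil_subm Fp).
    exists [seq pt 0%N x | x <- s] => [h /mapP[x /mem_gen/sP Fx ->]|j].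
      by exists 0%N => //; exists x.
    rewrite leqn0 => /eqP -> x /sP gx; apply: (gx (fun x => gen _ (pt 0%N x))).
      split=> [|a y z gy gz].
        by rewrite pt0; exact: (subm0 (gen_subm _)).
      rewrite pt_linear; exact: (submP _ (gen_subm _)).
    by move=> y ys; apply: mem_gen; apply: map_f.
  have [||s sP] := Fn (W := F k.+1); first exact: (stable_fil_subm Fp).
    by move=> x; apply: (ps_leq Fp).
  exists ([seq pt k.+1 x | x <- s] ++ g) => [h|j].
    rewrite mem_cat => /orP[/mapP[x /mem_gen/sP Fx ->]|/gF[j jk [x Fx ->]]].
      by exists k.+1 => //; exists x.
    by exists j; [exact: leqW|exists x].
  rewrite leq_eqVlt => /orP[/eqP -> x /sP gx|].
    apply: (gx (fun x => gen _ (pt k.+1 x))).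
      split=> [|a y z gy gz].
        by rewrite pt0; exact: (subm0 (gen_subm _)).
      rewrite pt_linear; exact: (submP _ (gen_subm _)).
    by move=> y ys; apply: mem_gen; rewrite mem_cat map_f.
  rewrite ltnS => jk x /(gP j jk) gx; move=> Z Zs Zg; apply: gx => // y yg.
  by apply: Zg; rewrite mem_cat yg orbT.
have gsub : opsubm T 0 (gen g) by split=> //; exact: gen_subm.
have gnoeth : noethop T 0 (gen g).
  move=> Z [Zs _] ZU; have [s sP] := noeth_gen Rnoeth Zs ZU.
  exists s => [x xs|Z' [Z's _] sZ' x /sP]; first by apply/sP; apply: mem_gen.
  exact.
set n := size as_.
have [Uop Unoeth] := adjoinsP TC n gsub gnoeth.
set U := adjoins T (gen g) n in Uop Unoeth.
have [Us Ut] := Uop.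
have UF j x : F j x -> U (pt j x).
  elim: j x => [|j IH] x Fx; first by apply: adjoins_sub; apply: gP.
  have [jk|kj] := leqP j.+1 k; first by apply: adjoins_sub; apply: gP.
  have Pts i : subm (fun x => U (pt i x)).
    split=> [|a y z Uy Uz].
      by rewrite pt0; exact: (subm0 Us).
    by rewrite pt_linear; exact: submP.
  apply: (kP _ kj _ Fx (fun x => U (pt j.+1 x))) => [|a y aI Fy]; first exact: Pts.
  have /asP/gen_sum[c aE] : (a : R^o) \in I by [].
  rewrite aE scaler_suml; apply: (subm_sum _ (Pts _)) => i _.
  rewrite -[c i *: as_`_i]/(c i * as_`_i) -scalerA; apply: (submZ _ (Pts _)).
  by rewrite ptS; apply: (Ut i (ltn_ord i)); apply: IH.
(* Z is the Rees module of the filtration induced on W. *)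
pose Z (h : nat -> V) := (exists n, forall j, (n <= j)%N -> h j = 0) /\
  forall j, W (h j) /\ F j (h j).
have Fs := stable_fil_subm Fp.
have Zs : subm Z.
  split=> [|a x y [[d dP] xP] [[e eP] yP]].
    split=> [|j]; first by exists 0%N.
    by split; [apply: (subm0 Ws)|apply: (subm0 (Fs j))].
  split=> [|j].
    exists (maxn d e) => j; rewrite geq_max => /andP[dj ej].
    by rewrite -[LHS]/(a *: x j + y j) dP // eP // scaler0 addr0.
  have [[? ?] [? ?]] := (xP j, yP j).
  by split; [apply: (submP _ Ws)|apply: (submP _ (Fs j))].
have ZT i h : (i < n)%N -> Z h -> Z (T i h).
  move=> ltin [[d dP] hP]; split.
    exists d.+1 => -[//|j] /= dj; by rewrite dP ?scaler0.
  have asI : (as_`_i : R^o) \in I by apply/asP; apply: mem_gen; apply: mem_nth.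
  move=> [|j] /=; first by split; [apply: (subm0 Ws)|apply: (subm0 (Fs 0%N))].
  by have [Wh Fh] := hP j; split; [apply: submZ|apply: (ps_mul Fp)].
have ZU h : Z h -> U h.
  move=> [[d dP] hP]; rewrite (ptD h d) [X in _ + X](_ : _ = 0).
    rewrite addr0; apply: (subm_sum _ Us) => i _; apply: UF.
    by have [] := hP i.
  by apply/funext => i; case: ltnP => // /dP.
have [||s sZ sG] := Unoeth Z; [by split=> // i ltin x; apply: ZT | exact: ZU |].
have [D DP] : exists D, forall h, h \in s -> forall j, (D <= j)%N -> h j = 0.
  elim: s sZ {sG} => [|h s IH] sZ; first by exists 0%N.
  have [x xs|D DP] := IH; first by apply: sZ; rewrite inE xs orbT.
  have [[d dP] _] := sZ h (mem_head _ _).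
  exists (maxn d D) => x; rewrite inE => /orP[/eqP ->|xs] j; rewrite geq_max => /andP[? ?].
    exact: dP.
  exact: DP.
exists D => j Dj x [Wx Fx].
have Zx : Z (pt j.+1 x).
  split=> [|l]; first by exists j.+2 => l lj; rewrite /pt gtn_eqF.
  rewrite /pt; case: eqP => [->//|_].
  by split; [apply: (subm0 Ws)|apply: (subm0 (Fs l))].
(* Z' is closed under the operators and contains the generators, which vanish
   beyond D; so it is all of Z. *)
pose Z' h := Z h /\ forall l, (D <= l)%N -> ideal_mul I (fun x => W x /\ F l x) (h l.+1).
have : Z' (pt j.+1 x).
  apply: (sG Z') => // [|h hs].
    split=> [|i ltin h [Zh hM]].
      split=> [|a h h' [Zh hM] [Zh' hM']].
        by split=> [|l _]; [exact: subm0|apply: (subm0 (ideal_mul_subm _ _))].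
      split=> [|l lD]; first exact: submP.
      by apply: (submP _ (ideal_mul_subm _ _)); [apply: hM|apply: hM'].
    split=> [|l lD]; first exact: ZT.
    apply: mem_ideal_mul; first by apply/asP; apply: mem_gen; apply: mem_nth.
    by have [_ ] := Zh; apply.
  split=> [|l lD]; first exact: sZ.
  rewrite (DP h hs) ?leqW //; exact: (subm0 (ideal_mul_subm _ _)).
by case=> _ /(_ j Dj); rewrite /pt eqxx.
Qed.
End ArtinRees.

(** * Dimensions of subquotients over the residue field *)

Section Dimension.
Variables (R : comNzRingType) (m : {pred R}).

(** X / Y is a vector space of dimension d over R / m.  Working with
representatives avoids forming the quotients. *)
Definition dimq (V : lmodType R) (X Y : V -> Prop) (d : nat) : Prop :=
  exists v : 'I_d -> V, [/\ forall k, X (v k),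
    forall x, X x -> exists c : 'I_d -> R, Y (x - \sum_k c k *: v k) &
    forall c : 'I_d -> R, Y (\sum_k c k *: v k) -> forall k, c k \in m].

Hypothesis m1 : 1 \notin m.
Hypothesis minv : forall a, a \notin m -> exists b, 1 - b * a \in m.

Section OneModule.
Variable V : lmodType R.
Implicit Types X Y Z : V -> Prop.

(** A generating family of minimal size is independent: a relation with a
coefficient outside m expresses one of its members through the others. *)
Lemma dimq_exists X Y : subm X -> subm Y -> (forall x, Y x -> X x) ->
  (forall a x, a \in m -> X x -> Y (a *: x)) ->
  (exists s, forall x, X x <-> gen s x) -> exists d, dimq X Y d.
Proof.
move=> Xs Ys YX mXY [s sP].
pose P d := `[< exists v : 'I_d -> V, (forall k, X (v k)) /\
  forall x, X x -> exists c : 'I_d -> R, Y (x - \sum_k c k *: v k) >].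
have Pex : exists d, P d.
  exists (size s); apply/asboolP; exists (fun k => s`_k); split=> [k|x /sP/gen_sum[c ->]].
    by apply/sP; apply: mem_gen; apply: mem_nth.
  by exists c; rewrite subrr; apply: subm0.
case: (ex_minnP Pex) => d /asboolP[v [vX vG]] dmin.
exists d; exists v; split=> // c Yc k; apply: contrapT => /negP ck.
have [b bP] := minv ck.
case: d => [|d] in v vX vG dmin c Yc k ck b bP *; first by case: k {ck bP}.
(* v k is redundant: modulo Y it equals (b * c k) v k, as 1 - b * c k is in m,
   and this is a combination of the others. *)
suff /dmin : P d by rewrite ltnn.
apply/asboolP; exists (fun j => v (lift k j)); split=> // x /vG[c' Yc'].
exists (fun j => c' (lift k j) - c' k * b * c (lift k j)).
have -> : x - \sum_j (c' (lift k j) - c' k * b * c (lift k j)) *: v (lift k j) =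
  (x - \sum_j c' j *: v j) + ((c' k * b) *: \sum_j c j *: v j + c' k *: ((1 - b * c k)
    *: v k)).
  rewrite (bigD1_ord k) //= [in X in _ = _ + (_ *: X + _)](bigD1_ord k) //=.
  under eq_bigr do rewrite scalerBl -scalerA.
  rewrite sumrB -scaler_sumr.
  set A := \sum_(i < d) c' _ *: _; set B := \sum_(i < d) c _ *: _.
  have vE : c' k *: v k =
      (c' k * b) *: (c k *: v k) + c' k *: ((1 - b * c k) *: v k).
    rewrite !scalerA -scalerDl; congr (_ *: _).
    by rewrite mulrBr mulr1 -mulrA addrC subrK.
  rewrite scalerDr [X in _ = _ + X]addrAC -vE opprD.
  rewrite opprK opprD -[RHS]addrA; congr (_ + _).
  by rewrite addrACA addNr add0r.
apply: submD => //; apply: submP => //; apply: submZ => //; exact: mXY.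
Qed.

Lemma dimq_add X Y Z d e : subm Y -> subm Z -> (forall x, Z x -> Y x) ->
  (forall x, Y x -> X x) ->
  (forall a x, a \in m -> X x -> Z (a *: x)) ->
  dimq X Y d -> dimq Y Z e -> dimq X Z (d + e).
Proof.
move=> Ys Zs ZY YX mXZ [v [vX vG vI]] [w [wY wG wI]].
pose u (k : 'I_(d + e)) := match fintype.split k with inl i => v i | inr j => w j end.
have uE (c : 'I_(d + e) -> R) : \sum_k c k *: u k =
    \sum_i c (lshift e i) *: v i + \sum_j c (rshift d j) *: w j.
  rewrite big_split_ord /=; congr (_ + _); apply: eq_bigr => i _.
    by rewrite /u (unsplitK (inl i : 'I_d + 'I_e)).
  by rewrite /u (unsplitK (inr i : 'I_d + 'I_e)).
exists u; split=> [k|x /vG[c /wG[c' Zc]]|c].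
- by rewrite /u; case: (fintype.split k) => // j; apply: YX.
- exists (fun k => match fintype.split k with inl i => c i | inr j => c' j end).
  rewrite uE opprD addrA.
  under eq_bigr => i _ do rewrite (unsplitK (inl i : 'I_d + 'I_e)).
  by under [X in _ - X]eq_bigr => i _ do rewrite (unsplitK (inr i : 'I_d + 'I_e)).
rewrite uE => Zc.
have cm : forall i, c (lshift e i) \in m.
  apply: vI; rewrite -[X in Y X](addrK (\sum_j c (rshift d j) *: w j)).
  apply: submB => //; first exact: ZY.
  by apply: subm_sum => // j _; apply: submZ.
have cm' : forall j, c (rshift d j) \in m.
  apply: wI; rewrite -[X in Z X](addKr (\sum_i c (lshift e i) *: v i)).
  apply: submD => //; apply: submN => //; apply: subm_sum => // j _.
  exact: mXZ.
by move=> k; rewrite -(splitK k); case: (fintype.split k).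
Qed.

Lemma dimq0 X Y d : (forall x, X x -> Y x) -> subm X -> dimq X Y d -> d = 0%N.
Proof.
move=> XY Xs [v [vX _ vI]]; case: d v vX vI => // d v vX vI.
have : (1 : R) \in m.
  apply: (vI (fun=> 1) _ ord0); apply: XY; apply: subm_sum => // k _.
  exact: submZ.
by rewrite (negbTE m1).
Qed.

Lemma dimq_sub X Y X' Y' d : subm X ->
  (forall x, X x -> X' x) -> (forall x, X' x -> exists2 y, X y & Y' (x - y)) ->
  subm Y' -> (forall x, X x -> Y' x <-> Y x) ->
  dimq X Y d -> dimq X' Y' d.
Proof.
move=> Xs XX' X'X Y's Y'Y [v [vX vG vI]].
have Xv c : X (\sum_k c k *: v k) by apply: subm_sum => // k _; apply: submZ.
exists v; split=> [k|x /X'X[y Xy Y'xy]|c Y'c]; first exact: XX'.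
  have [c Yc] := vG y Xy; exists c.
  rewrite -(subrK y x) -addrA; apply: submD => //; apply/Y'Y => //.
  exact: submB.
by apply: vI; apply/Y'Y.
Qed.

Lemma dimq_eq X Y X' Y' d : (forall x, X x <-> X' x) -> (forall x, Y x <-> Y' x) ->
  dimq X Y d -> dimq X' Y' d.
Proof.
move=> XX' YY' [v [vX vG vI]]; exists v; split=> [k|x /XX'/vG[c Yc]|c /YY'/vI//].
  exact/XX'.
by exists c; apply/YY'.
Qed.

(** For a map phi that is semilinear along residue, which identifies R / m with K,
and that induces a bijection from X / Y onto S. *)
Lemma dimq_has_dim (A : comPzRingType) (K : {pred A}) (residue : R -> A)
    (L : lmodType A) (S : {pred L}) (phi : V -> L) X Y d :
  subm X -> subm Y -> (forall x, Y x -> X x) ->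
  (forall a x, a \in m -> X x -> Y (a *: x)) ->
  (forall a, residue a \in K) -> (forall c, c \in K -> exists a, c = residue a) ->
  (forall a b, a - b \in m -> residue a = residue b) ->
  (forall x, X x -> phi x \in S) -> (forall t, t \in S -> exists2 x, X x & t = phi x) ->
  (forall x, X x -> phi x = 0 -> Y x) -> (forall x, Y x -> phi x = 0) ->
  (forall a x y, X x -> X y -> phi (a *: x + y) = residue a *: phi x + phi y) ->
  dimq X Y d -> has_dim K S d.
Proof.
move=> Xs Ys YX mXY kapK Kkap kapm phiS Sphi ker kerY phiP [v [vX vG vI]].
have phi0 : phi 0 = 0 by apply: kerY; apply: subm0.
have Xv c : X (\sum_k c k *: v k) by apply: subm_sum => // k _; apply: submZ.
have phi_sum c : phi (\sum_k c k *: v k) = \sum_k residue (c k) *: phi (v k).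
  pose P x y := X x /\ phi x = y.
  suff [] : P (\sum_k c k *: v k) (\sum_k residue (c k) *: phi (v k)) by [].
  apply: big_rec2 => [|k y x _ [Xx phix]]; first by split=> //; exact: subm0.
  by split; [apply: submP|rewrite phiP // phix].
have phiB x y : X x -> X y -> phi (x - y) = phi x - phi y.
  move=> Xx Xy; apply/eqP; rewrite eq_sym subr_eq; apply/eqP.
  have k1 : residue 1 *: phi (x - y) = phi (x - y).
    have := phiP 1 (x - y) 0 (submB Xs Xx Xy) (subm0 Xs).
    by rewrite phi0 !addr0 scale1r.
  by rewrite -k1 -phiP ?scale1r ?subrK //; exact: submB.
exists (fun k => phi (v k)) => [k|t /Sphi[x Xx ->]]; first exact: phiS.
have [c Yc] := vG x Xx.
have phix : phi x = \sum_k residue (c k) *: phi (v k).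
  by rewrite -phi_sum; apply/eqP; rewrite -subr_eq0 -phiB // kerY.
exists (fun k => residue (c k)); split=> [|c' [c'K xE]]; first by split=> // k.
have [a aE] := choice (fun k => Kkap _ (c'K k)).
apply/funext => k; rewrite aE; apply: kapm.
apply: (vI (fun k => c k - a k)).
apply: ker; first exact: Xv.
under eq_bigr do rewrite scalerBl.
rewrite sumrB phiB // !phi_sum -phix xE; apply/eqP; rewrite subr_eq0.
by apply/eqP; apply: eq_bigr => j _; rewrite aE.
Qed.
End OneModule.
End Dimension.

(** * The spectral sequence of a filtered complex *)

Lemma cancel_sum (c : nat -> nat -> nat -> nat) i j n : (i < n)%N -> (j < n)%N ->
  (\sum_(k < n) \sum_(b < n) \sum_(a < b) c k a b * cancel_coef k a b i j =
   (if i is k.+1 then \sum_(j.+1 <= b < n) c k j b else 0) + \sum_(a < j) c i a j)%N.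
Proof.
move=> ltin ltjn; rewrite /cancel_coef.
under eq_bigr do under eq_bigr do under eq_bigr do rewrite mulnDr.
under eq_bigr do under eq_bigr do rewrite big_split.
under eq_bigr do rewrite big_split.
rewrite big_split; congr (_ + _)%N => /=.
  case: i ltin => [|i] ltin.
    by rewrite big1 // => k _; rewrite big1 // => b _; rewrite big1 // => a _;
      rewrite muln0.
  rewrite (bigD1 (Ordinal (ltnW ltin))) //= [X in (_ + X)%N]big1 ?addn0; last first.
    move=> k ki; rewrite big1 // => b _; rewrite big1 // => a _.
    rewrite eqSS; case: eqP => [ik|_]; last by rewrite muln0.
    by case/eqP: ki; apply: val_inj.
  rewrite big_geq_mkord [RHS]big_mkcond; apply: eq_bigr => b _ /=.
  rewrite eqxx /=; case: ltnP => [jb|bj].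
    rewrite (bigD1 (Ordinal jb)) //= eqxx muln1 big1 ?addn0 // => a aj.
    case: eqP => [ja|_]; last by rewrite muln0.
    by case/eqP: aj; apply: val_inj.
  rewrite big1 // => a _; case: eqP => [ja|_]; last by rewrite muln0.
  by have := ltn_ord a; rewrite -ja ltnNge bj.
rewrite (bigD1 (Ordinal ltin)) //= [X in (_ + X)%N]big1 ?addn0; last first.
  move=> k ki; rewrite big1 // => b _; rewrite big1 // => a _.
  case: eqP => [ik|_]; last by rewrite muln0.
  by case/eqP: ki; apply: val_inj.
rewrite (bigD1 (Ordinal ltjn)) //= [X in (_ + X)%N]big1 ?addn0; last first.
  move=> b bj; rewrite big1 // => a _.
  case: (j =P b) => [ik|_]; last by rewrite andbF muln0.
  by case/eqP: bj; apply: val_inj.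
by apply: eq_bigr => a _; rewrite !eqxx muln1.
Qed.

Section FilteredComplex.
Variables (R : comNzRingType) (m : {pred R}).
Hypotheses (Rnoeth : noetherian R) (mi : subm (fun a : R^o => a \in m)).
Hypotheses (m1 : 1 \notin m) (minv : forall a, a \notin m -> exists b, 1 - b * a \in m).
Variables (C : nat -> lmodType R) (D : forall i, {linear C i.+1 -> C i}).
Variables (Fil : forall i, nat -> C i -> Prop).
Arguments Fil : clear implicits.
Hypotheses (DD : forall i x, D i (D i.+1 x) = 0) (Fp : forall i, stable_fil m (Fil i)).
Hypotheses (F0 : forall i x, Fil i 0 x) (Cn : forall i (U : C i -> Prop), noeth U).

Let Fs i := stable_fil_subm (Fp i).

Definition is_cycle i : C i -> Prop :=
  match i with 0 => fun=> True | k.+1 => fun x => D k x = 0 end.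
Definition dif_in i b : C i -> Prop :=
  match i with 0 => fun=> True | k.+1 => fun x => Fil k b (D k x) end.

(** The elements of Fil i a whose class modulo Fil i a.+1 contains an element with
boundary in Fil b: the (b - a)-th approximation to the cycles in the spectral
sequence. *)
Definition near_cycle i a b (x : C i) : Prop := exists z y,
  [/\ x = z + y, Fil i a z, dif_in b z & Fil i a.+1 y].

(** The limit of [near_cycle] for b going to infinity. *)
Definition cycle_mod i a (x : C i) : Prop := exists z y,
  [/\ x = z + y, Fil i a z, is_cycle z & Fil i a.+1 y].

(** The elements of Fil i b whose class modulo Fil i b.+1 contains the boundary of
an element of Fil i.+1 a. *)
Definition bdry_mod i a b (x : C i) : Prop := exists u y,
  [/\ x = D i u + y, Fil i.+1 a u, Fil i b (D i u) & Fil i b.+1 y].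

Lemma is_cycle_subm i : subm (@is_cycle i).
Proof.
case: i => [|i]; first by split.
by split=> [|a x y] /=; rewrite ?linear0 // => x0 y0; rewrite linearP x0 y0 scaler0 addr0.
Qed.

Lemma dif_in_subm i b : subm (@dif_in i b).
Proof.
case: i => [|i]; first by split.
split=> [|a x y] /=; first by rewrite linear0; apply: subm0 (Fs _ _).
by move=> xF yF; rewrite linearP; apply: (submP _ (Fs _ _)).
Qed.

Lemma dif_in_S i b x : @dif_in i b.+1 x -> dif_in b x.
Proof. by case: i x => //= i x; apply: (ps_desc (Fp i)). Qed.

Lemma is_cycle_dif_in i b x : @is_cycle i x -> dif_in b x.
Proof. by case: i x => //= i x ->; exact: subm0 (Fs _ _). Qed.

Lemma near_cycle_subm i a b : subm (@near_cycle i a b).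
Proof.
split=> [|c _ _ [z [y [-> za zo ya]]] [z' [y' [-> za' zo' ya']]]].
  exists 0, 0; rewrite addr0; split=> //; try exact: subm0 (Fs _ _).
  exact: subm0 (dif_in_subm _ _).
exists (c *: z + z'), (c *: y + y'); split.
- by rewrite scalerDr addrACA.
- exact: (submP _ (Fs _ _)).
- exact: (submP _ (dif_in_subm _ _)).
exact: (submP _ (Fs _ _)).
Qed.

Lemma cycle_mod_subm i a : subm (@cycle_mod i a).
Proof.
split=> [|c _ _ [z [y [-> za zo ya]]] [z' [y' [-> za' zo' ya']]]].
  exists 0, 0; rewrite addr0; split=> //; try exact: subm0 (Fs _ _).
  exact: subm0 (is_cycle_subm _).
exists (c *: z + z'), (c *: y + y'); split.
- by rewrite scalerDr addrACA.
- exact: (submP _ (Fs _ _)).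
- exact: (submP _ (is_cycle_subm _)).
exact: (submP _ (Fs _ _)).
Qed.

Lemma bdry_mod_subm i a b : subm (@bdry_mod i a b).
Proof.
split=> [|c _ _ [z [y [-> za zo ya]]] [z' [y' [-> za' zo' ya']]]].
  exists 0, 0; rewrite linear0 addr0; split=> //; exact: subm0 (Fs _ _).
exists (c *: z + z'), (c *: y + y'); split.
- by rewrite linearP scalerDr addrACA.
- exact: (submP _ (Fs _ _)).
- by rewrite linearP; exact: (submP _ (Fs _ _)).
exact: (submP _ (Fs _ _)).
Qed.

Lemma near_cycle_fil i a b x : @near_cycle i a b x -> Fil i a x.
Proof.
move=> [z [y [-> za _ ya]]]; apply: (submD (Fs _ _)) => //.
exact: (ps_desc (Fp i)).
Qed.

Lemma bdry_mod_fil i a b x : @bdry_mod i a b x -> Fil i b x.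
Proof.
move=> [z [y [-> _ zb yb]]]; apply: (submD (Fs _ _)) => //.
exact: (ps_desc (Fp i)).
Qed.

Lemma fil_near_cycle i a b x : Fil i a.+1 x -> @near_cycle i a b x.
Proof.
move=> xa; exists 0, x; rewrite add0r; split=> //; first exact: subm0 (Fs _ _).
exact: subm0 (dif_in_subm _ _).
Qed.
Lemma fil_bdry_mod i a b x : Fil i b.+1 x -> @bdry_mod i a b x.
Proof.
by move=> xa; exists 0, x; rewrite linear0 add0r; split=> //; exact: subm0 (Fs _ _).
Qed.

Lemma near_cycle_S i a b x : @near_cycle i a b.+1 x -> @near_cycle i a b x.
Proof.
move=> [z [y [-> za zo ya]]]; exists z, y; split=> //.
exact: dif_in_S.
Qed.
Lemma bdry_mod_S i a b x : @bdry_mod i a.+1 b x -> @bdry_mod i a b x.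
Proof.
move=> [z [y [-> za zo ya]]]; exists z, y; split=> //.
exact: (ps_desc (Fp _)).
Qed.
Lemma cycle_mod_near i a b x : @cycle_mod i a x -> @near_cycle i a b x.
Proof.
move=> [z [y [-> za zo ya]]]; exists z, y; split=> //.
exact: is_cycle_dif_in.
Qed.
Lemma is_cycle_bdry i u : is_cycle (D i u).
Proof. by case: i u => [//|i] u; apply: DD. Qed.
Lemma bdry_cycle_mod i a b x : @bdry_mod i a b x -> @cycle_mod i b x.
Proof.
move=> [z [y [-> za zo ya]]]; exists (D i z), y; split=> //.
exact: is_cycle_bdry.
Qed.

(** By Artin-Rees for the image of the differential, an element of the image
that lies far in the filtration is in m^a times the image, hence it is the
boundary of an element of Fil a. *)
Lemma strict_image k a : exists n, forall b, (n <= b)%N -> forall u,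
  Fil k b (D k u) -> exists2 y, Fil k.+1 a y & D k y = D k u.
Proof.
pose W x := exists u, x = D k u.
have Ws : subm W.
  split=> [|c _ _ [u ->] [v ->]]; first by exists 0; rewrite linear0.
  by exists (c *: u + v); rewrite linearP.
have WF := artin_rees Rnoeth mi (Fp k) (@Cn k _) Ws.
have [n nP] := ps_stab WF.
have H : forall x, W x /\ Fil k (n + a)%N x -> exists2 y, Fil k.+1 a y & D k y = x.
  elim: a => [|a IH] x.
    by move=> [[u ->] _]; exists u.
  rewrite addnS => /nP xM; apply: (xM (leq_addr _ _) (fun x => exists2 y,
    Fil k.+1 a.+1 y & D k y = x)).
    split=> [|c _ _ [y ya <-] [z za <-]].
      by exists 0; [exact: subm0 (Fs _ _)|rewrite linear0].
    exists (c *: y + z); [exact: (submP _ (Fs _ _))|exact: linearP].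
  move=> c y cm /IH[z za <-]; exists (c *: z); first exact: (ps_mul (Fp _)).
  exact: linearZ.
exists (n + a)%N => b nb u Du.
by apply: H; split; [exists u|apply: (ps_leq (Fp k)) Du].
Qed.

(** The differential of the spectral sequence.  If the boundary of x is, modulo
Fil k b.+1, the boundary of some u in Fil k.+1 a.+1, then x - u has the class of
x and its boundary lies in Fil k b.+1; so the differential is injective on the
quotients, and it is onto by definition of [bdry_mod]. *)
Lemma bdry_near_cycle_iso k a b d : dimq m (@bdry_mod k a b) (@bdry_mod k a.+1 b) d ->
  dimq m (@near_cycle k.+1 a b) (@near_cycle k.+1 a b.+1) d.
Proof.
move=> [v [vX vG vI]].
have /choice[u uP] : forall j, exists u, exists2 y, v j = D k u + y &
    [/\ Fil k.+1 a u, Fil k b (D k u) & Fil k b.+1 y].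
  by move=> j; have [u [y [? ? ? ?]]] := vX j; exists u, y.
have /choice[y yP] : forall j, exists y, [/\ v j = D k (u j) + y, Fil k.+1 a (u j),
    Fil k b (D k (u j)) & Fil k b.+1 y].
  by move=> j; have [y ? [? ? ?]] := uP j; exists y.
have vE (c : 'I_d -> R) : \sum_j c j *: v j = D k (\sum_j c j *: u j) + \sum_j c j *: y j.
  rewrite linear_sum -big_split; apply: eq_bigr => j _ /=.
  by have [-> _ _ _] := yP j; rewrite scalerDr linearZ.
have uF (c : 'I_d -> R) : Fil k.+1 a (\sum_j c j *: u j).
  by apply: (subm_sum _ (Fs _ _)) => j _; apply: (submZ _ (Fs _ _)); have [] := yP j.
have DuF (c : 'I_d -> R) : Fil k b (D k (\sum_j c j *: u j)).
  rewrite linear_sum; apply: (subm_sum _ (Fs _ _)) => j _; rewrite linearZ.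
  by apply: (submZ _ (Fs _ _)); have [] := yP j.
have yF (c : 'I_d -> R) : Fil k b.+1 (\sum_j c j *: y j).
  by apply: (subm_sum _ (Fs _ _)) => j _; apply: (submZ _ (Fs _ _)); have [] := yP j.
exists u; split=> [j|_ [z [w [-> za zo wa]]]|c [z [w [E za zo wa]]]].
- exists (u j), 0; rewrite addr0; have [_ ? ? _] := yP j.
  split=> //; exact: subm0 (Fs _ _).
- have [|c [u' [y' [E u'a Du'b y'b]]]] := vG (D k z).
    exists z, 0; rewrite addr0; split=> //; exact: subm0 (Fs _ _).
  (* Subtracting u' moves the boundary into Fil k b.+1 and does not affect the
     class modulo Fil k.+1 a.+1. *)
  exists c; exists (z - \sum_j c j *: u j - u'), (u' + w); split.
  + by rewrite addrA subrK addrAC.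
  + apply: (submB (Fs _ _)); last exact: (ps_desc (Fp _)).
    exact: (submB (Fs _ _)).
  + rewrite /= !linearB /=.
    suff -> : D k z - D k (\sum_j c j *: u j) - D k u' = y' + \sum_j c j *: y j.
      exact: (submD (Fs _ _)).
    move: E; rewrite vE opprD addrA => /eqP; rewrite subr_eq => /eqP ->.
    by rewrite -[D k u' + y' + _]addrA [D k u' + (_ + _)]addrC addrK.
  exact: (submD (Fs _ _)).
apply: vI; rewrite vE E.
exists w, (D k z + \sum_j c j *: y j); split=> //.
- by rewrite linearD addrA [D k w + _]addrC.
- suff -> : D k w = D k (\sum_j c j *: u j) - D k z.
    apply: (submB (Fs _ _)) => //; exact: (ps_desc (Fp _)).
  by rewrite E linearD addrC addKr.
exact: (submD (Fs _ _)).
Qed.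

Lemma dimq_chain (V : lmodType R) (X : nat -> V -> Prop) (Y : V -> Prop) (d : nat ->
  nat) a b :
  (a <= b)%N -> (forall i, subm (X i)) -> (forall i x, X i.+1 x -> X i x) ->
  (forall c x, c \in m -> X a x -> Y (c *: x)) -> (forall i x, Y x -> X i x) ->
  (forall i, (a <= i < b)%N -> dimq m (X i) (X i.+1) (d i)) ->
  dimq m (X a) (X b) (\sum_(a <= i < b) d i).
Proof.
move=> /subnK <- Xs XS XY YX; elim: (b - a)%N => [|n IH] Xd.
  rewrite add0n big_geq //; exists (fun=> 0); split=> [k|x Xx|c _ []//].
    exact: subm0.
  by exists (fun=> 0); rewrite big_ord0 subr0.
rewrite addSn big_nat_recr ?leq_addl //=.
apply: (dimq_add (Y := X (n + a)%N)) => //.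
- by move=> x; apply: XS.
- elim: n {IH Xd} => [|n IH] x; first by rewrite add0n.
  by rewrite addSn => /XS; exact: IH.
- by move=> c x cm Xx; apply: YX; apply: XY.
- by apply: IH => i /andP[ai ib]; apply: Xd; rewrite ai addSn ltnS ltnW.
by apply: Xd; rewrite leq_addl addSn ltnS leqnn.
Qed.

Definition fil_cycle i j (x : C i) : Prop := is_cycle x /\ Fil i j x.

(** The part of [fil_cycle] whose homology class already lies in the next step
of the filtration of the homology. *)
Definition fil_cycle_next i j (x : C i) : Prop := fil_cycle j x /\
  exists2 z, fil_cycle j.+1 z & exists w, x - z = D i w.

Lemma fil_cycle_subm i j : subm (@fil_cycle i j).
Proof. exact: (subm_cap (is_cycle_subm i) (Fs i j)). Qed.

Lemma fil_cycle_next_subm i j : subm (@fil_cycle_next i j).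
Proof.
split=> [|a x y [xj [z zj [w zE]]] [yj [z' zj' [w' zE']]]].
  split; first exact: subm0 (fil_cycle_subm _ _).
  exists 0; first exact: subm0 (fil_cycle_subm _ _).
  by exists 0; rewrite linear0 subrr.
split; first exact: (submP _ (fil_cycle_subm _ _)).
exists (a *: z + z'); first exact: (submP _ (fil_cycle_subm _ _)).
by exists (a *: w + w'); rewrite linearP -zE -zE' opprD addrACA scalerBr.
Qed.

(** The numbers p and q are the dimensions in degree (i, j) of the homology of
the associated graded complex and of the graded module of the homology. *)
Lemma filtered_complex_cancellations : exists p q,
  [/\ forall i j, dimq m (@near_cycle i j j.+1) (@bdry_mod i j j) (p i j),
      forall i j, dimq m (@fil_cycle i j) (@fil_cycle_next i j) (q i j) &
      neg_cancellations p q].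
Proof.
have fgC i (U : C i -> Prop) : subm U -> exists s, forall x, U x <-> gen s x.
  by move=> Us; apply: (@Cn i U U).
have mF i j a (x : C i) : a \in m -> Fil i j x -> Fil i j.+1 (a *: x).
  exact: (ps_mul (Fp i)).
have /choice[c cP] : forall t : nat * nat * nat, exists d,
    dimq m (@bdry_mod t.1.1 t.1.2 t.2) (@bdry_mod t.1.1 t.1.2.+1 t.2) d.
  move=> [[k a] b] /=; apply: (dimq_exists minv);
    [exact: bdry_mod_subm|exact: bdry_mod_subm|exact: bdry_mod_S| |].
    by move=> e x em /bdry_mod_fil xb; apply: fil_bdry_mod; apply: mF.
  by apply: fgC; exact: bdry_mod_subm.
have /choice[q qP] : forall t : nat * nat, exists d,
    dimq m (@fil_cycle t.1 t.2) (@fil_cycle_next t.1 t.2) d.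
  move=> [i j] /=; apply: (dimq_exists minv);
    [exact: fil_cycle_subm|exact: fil_cycle_next_subm|by move=> x []| |].
    move=> e x em [xc xj]; split; first by apply: (submZ _ (fil_cycle_subm _ _)).
    exists (e *: x); last by exists 0; rewrite subrr linear0.
    by split; [apply: (submZ _ (is_cycle_subm _))|apply: mF].
  by apply: fgC; exact: fil_cycle_subm.
(* Beyond N (i, j) nothing changes any more, and N also bounds the indices that
   contribute to the coefficient (i, j). *)
have /choice[N NP] : forall t : nat * nat, exists n, [/\ (t.1 < n)%N, (t.2 < n)%N &
    (forall x, @near_cycle t.1 t.2 n x -> @cycle_mod t.1 t.2 x) /\
    forall k b, t.1 = k.+1 -> (n <= b)%N -> c (k, t.2, b) = 0%N].
  move=> [[|i] j] /=.
    exists j.+1; split=> //; split=> //.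
  have [n nP] := strict_image i j.+1.
  exists (maxn n (maxn i.+2 j.+1)); split; [lia|lia|split].
    move=> x [z [y [-> za zo ya]]].
    have [|w wj wE] := nP _ _ _ zo; first by lia.
    exists (z - w), (w + y); split.
    - by rewrite addrA subrK.
    - apply: (submB (Fs _ _)) => //; exact: (ps_desc (Fp _)).
    - by rewrite /= linearB wE subrr.
    exact: (submD (Fs _ _)).
  move=> k b [<-] nb; apply: (dimq0 m1 _ _ (cP (i, j, b))); last exact: bdry_mod_subm.
  move=> x [u [y [-> uj Du yb]]].
  have [|w wj wE] := nP b _ _ Du; first by lia.
  by exists w, y; rewrite wE.
(* The steps of the chain at (i, j): those between cycles are indexed by
   j < b < N, those between boundaries by a < j. *)
pose p i j := (q (i, j) + ((if i is k.+1 then \sum_(j.+1 <= b < N (i, j)) c (k, j,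
  b) else 0)
  + \sum_(a < j) c (i, a : nat, j)))%N.
exists p, (fun i j => q (i, j)); split=> [i j|i j|]; last first.
- exists (fun k a b => c (k, a, b)) => i j; exists (N (i, j)).
  have [iN jN [_ cN]] := NP (i, j); rewrite /= in iN jN cN.
  rewrite (cancel_sum (fun k a b => c (k, a, b))) //; split=> // k a b ab.
  rewrite muln_eq0 negb_or => /andP[c0];
    rewrite /cancel_coef addn_eq0 negb_and !eqb0 !negbK.
  move=> /orP[/andP[/eqP ik /eqP ja]|/andP[/eqP ik /eqP jb]]; last by rewrite -ik -jb iN.
  rewrite (ltn_trans _ iN) ik //= ltnNge; apply: contra c0 => Nb.
  by rewrite -ja (cN k) // ik.
- exact: (qP (i, j)).
have [iN jN [ZN cN]] := NP (i, j); rewrite /= in iN jN ZN cN.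
have filx x : Fil i j.+1 x -> @bdry_mod i j j x by apply: fil_bdry_mod.
have BBle a x : (a <= j)%N -> @bdry_mod i j j x -> @bdry_mod i a j x.
  move=> aj [u [y [-> uj Du yj]]]; exists u, y; split=> //; exact: (ps_leq (Fp _)) uj.
have BB0 x a : @bdry_mod i a j x -> @bdry_mod i 0 j x.
  by move=> [u [y [-> uj Du yj]]]; exists u, y; split.
have dq : dimq m (@cycle_mod i j) (@bdry_mod i 0 j) (q (i, j)).
  apply: (dimq_sub (fil_cycle_subm i j) _ _ _ _ (qP (i, j))) => /=.
  - by move=> x [xc xj]; exists x, 0; rewrite addr0; split=> //; exact: subm0 (Fs _ _).
  - move=> x [z [y [-> zj zc yj]]]; exists z => //.
    by rewrite addrC addKr; apply: fil_bdry_mod.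
  - exact: bdry_mod_subm.
  move=> x [xc xj]; split=> [[u [y [E _ Du yj]]]|[_ [z [zc zj] [w E]]]].
    split=> //; exists y; last by exists u; rewrite E addrK.
    split=> //; have -> : y = x - D i u by rewrite E addrC addKr.
    by apply: (submB (is_cycle_subm _)) => //; exact: is_cycle_bdry.
  exists w, z; rewrite -E subrK; split=> //; apply: (submB (Fs _ _)) => //.
  exact: (ps_desc (Fp _)).
have dB : dimq m (@bdry_mod i 0 j) (@bdry_mod i j j) (\sum_(a < j) c (i, a : nat, j)).
  rewrite -(big_mkord xpredT (fun a => c (i, a : nat, j))).
  apply: (dimq_chain (X := fun a => @bdry_mod i a j) (Y := Fil i j.+1)) => //.
  - by move=> a; exact: bdry_mod_subm.
  - by move=> a; exact: bdry_mod_S.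
  - by move=> e x em /bdry_mod_fil; apply: mF.
  - by move=> a x; apply: fil_bdry_mod.
  by move=> a _; exact: (cP (i, a, j)).
have dZ : dimq m (@near_cycle i j j.+1) (@cycle_mod i j)
    (if i is k.+1 then \sum_(j.+1 <= b < N (i, j)) c (k, j, b) else 0%N).
  have ZE n x : (forall x, @near_cycle i j n x -> @cycle_mod i j x) ->
    @near_cycle i j n x <-> @cycle_mod i j x.
    by move=> H; split=> [/H//|]; apply: cycle_mod_near.
  case: i => [|k] in iN jN ZN cN filx BBle BB0 dq dB ZE *.
    apply: (dimq_eq (X := @cycle_mod 0 j) (Y := @cycle_mod 0 j)) => //.
    exists (fun=> 0); split=> [t|x Xx|e _ []//]; first exact: subm0 (cycle_mod_subm _ _).
    by exists (fun=> 0); rewrite big_ord0 subr0.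
  apply: (dimq_eq (X := @near_cycle k.+1 j j.+1) (Y := @near_cycle k.+1 j (N (k.+1,
    j)))) => //.
    by move=> x; apply: ZE.
  apply: (dimq_chain (X := fun b => @near_cycle k.+1 j b) (Y := Fil k.+1 j.+1)) => //.
  - by move=> b; exact: near_cycle_subm.
  - by move=> b; exact: near_cycle_S.
  - by move=> e x em /near_cycle_fil; apply: mF.
  - by move=> b x; apply: fil_near_cycle.
  by move=> b _; apply: bdry_near_cycle_iso; exact: (cP (k, j, b)).
have BZ x a : @bdry_mod i a j x -> @cycle_mod i j x by apply: bdry_cycle_mod.
rewrite /p addnC addnAC.
apply: (dimq_add (Y := @bdry_mod i 0 j)) dB.
- exact: bdry_mod_subm.
- exact: bdry_mod_subm.
- by move=> x; apply: BB0.
- by move=> x /BZ; apply: cycle_mod_near.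
- by move=> e x em /near_cycle_fil xj; apply: fil_bdry_mod; apply: mF.
apply: (dimq_add (Y := @cycle_mod i j)) dZ dq.
- exact: cycle_mod_subm.
- exact: bdry_mod_subm.
- by move=> x /BZ.
- by move=> x; apply: cycle_mod_near.
by move=> e x em /near_cycle_fil xj; apply: fil_bdry_mod; apply: mF.
Qed.
End FilteredComplex.

(** * Direct sums, tensor products of maps, shifted gradings *)

Notation coval := submod_val.

Lemma ex2_and (T : Type) (P Q : T -> Prop) :
  (exists2 x, P x & Q x) -> exists x, P x /\ Q x.
Proof. by case=> x; exists x. Qed.

Section Copower.
Local Open Scope classical_set_scope.
Variables (A : comPzRingType) (N : lmodType A) (B : choiceType).
Implicit Types (g : copower B N).

Lemma covalD g h b : coval (g + h) b = coval g b + coval h b. Proof. by []. Qed.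
Lemma covalB g h b : coval (g - h) b = coval g b - coval h b. Proof. by []. Qed.
Lemma covalZ a g b : coval (a *: g) b = a *: coval g b. Proof. by []. Qed.
Lemma coval0 b : coval (0 : copower B N) b = 0. Proof. by []. Qed.
Lemma coval_sum (I : Type) (r : seq I) (P : pred I) (F : I -> copower B N) b :
  coval (\sum_(i <- r | P i) F i) b = \sum_(i <- r | P i) coval (F i) b.
Proof. exact: (big_morph (fun g : copower B N => coval g b)). Qed.
Lemma co_eq g h : coval g =1 coval h -> g = h.
Proof. by move=> gh; apply: val_inj; apply/funext. Qed.

Lemma tensE (v : copower B A^o) (n : N) b : coval (tens v n) b = coval v b *: n.
Proof. by []. Qed.
Lemma basis_vecE (b c : B) : coval (basis_vec A b) c = (c == b)%:R. Proof. by []. Qed.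

Lemma co_sum g : exists s : seq B,
  g = \sum_(b <- s) tens (basis_vec A b) (coval g b).
Proof.
have /asboolP[/finite_fsetP[s sP] _] := submod_valP g.
exists (s : seq B); apply: co_eq => c; rewrite coval_sum.
have [cs|cs] := boolP (c \in s).
  rewrite (bigD1_seq c) ?fset_uniq //= eqxx scale1r big1 ?addr0 //.
  by move=> b bc; rewrite eq_sym (negbTE bc) scale0r.
rewrite big_seq big1 => [|b bs].
  apply/eqP/negPn/negP => gc; move/negP: cs; apply.
  by have : [set` s] c by rewrite -sP.
rewrite tensE basis_vecE; case: eqP => [cb|_]; last by rewrite scale0r.
by rewrite cb bs in cs.
Qed.

Lemma co_ind (P : copower B N -> Prop) : P 0 ->
  (forall g h, P g -> P h -> P (g + h)) ->
  (forall b n, P (tens (basis_vec A b) n)) -> forall g, P g.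
Proof.
move=> P0 PD Pt g; have [s ->] := co_sum g.
by elim/big_rec: _ => // b x _; apply: PD.
Qed.

Lemma co_morph_eq (Y : zmodType) (f h : copower B N -> Y) :
  {morph f : x y / x + y} -> {morph h : x y / x + y} ->
  (forall b n, f (tens (basis_vec A b) n) = h (tens (basis_vec A b) n)) -> f =1 h.
Proof.
have add0 (k : copower B N -> Y) : {morph k : x y / x + y} -> k 0 = 0.
  by move=> kD; apply/eqP; rewrite -(subrr (k 0)) eq_sym subr_eq -kD addr0.
move=> fD hD fh; apply: co_ind => [|g g' IH IH'|//]; first by rewrite !add0.
by rewrite fD hD IH IH'.
Qed.

Section FSum.
Variables (Y : lmodType A) (phi : B -> {linear N -> Y}).

(** The map out of the direct sum with components phi b; it is the common form of
[tens_map] and of the maps given by their values on a basis. *)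
Definition fsum g : Y := \sum_(b \in [set: B]) phi b (coval g b).

Lemma fsum_linear : linear fsum.
Proof.
move=> a f g; have /asboolP[ff _] := submod_valP f.
have /asboolP[gf _] := submod_valP g.
have tE (h : copower B N) : [set b | coval h b != 0] `<=`
    [set b | coval f b != 0] `|` [set b | coval g b != 0] ->
  fsum h = \sum_(b <- fset_set ([set b | coval f b != 0] `|`
    [set b | coval g b != 0])) phi b (coval h b).
  move=> hS; apply: fsbigTE => b; rewrite in_fset_set ?finite_setU // => bS.
  have [->|h0] := eqVneq (coval h b) 0; first by rewrite linear0.
  by case/negP: bS; apply/mem_set/hS.
rewrite !tE; first last.
- move=> b /=; apply: contraNP => /not_orP[/negP/negbNE/eqP f0 /negP/negbNE/eqP g0].
  by apply/eqP; rewrite -[LHS]/(a *: coval f b + coval g b) f0 g0 scaler0 addr0.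
- by move=> b; left.
- by move=> b; right.
rewrite scaler_sumr -big_split; apply: eq_bigr => b _ /=.
by rewrite -linearP.
Qed.
HB.instance Definition _ := GRing.isLinear.Build A (copower B N) Y *:%R fsum fsum_linear.

Lemma fsum_tens b n : fsum (tens (basis_vec A b) n) = phi b n.
Proof.
rewrite /fsum (fsbigTE [fset b]%fset) => [|c].
  by rewrite big_seq_fset1 tensE basis_vecE eqxx scale1r.
by rewrite inE => cb; rewrite tensE basis_vecE (negbTE cb) scale0r linear0.
Qed.
End FSum.
End Copower.

Section TensMap.
Variables (A : comPzRingType) (N : lmodType A).
Implicit Types B C D : choiceType.

Lemma tens_mapD B C (d : copower B A^o -> copower C A^o) :
  {morph tens_map (N := N) d : x y / x + y}.
Proof. by move=> x y; rewrite -[x]scale1r tens_map_linear !scale1r. Qed.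

Lemma tens_map_basis B C (d : copower B A^o -> copower C A^o) b (n : N) :
  tens_map d (tens (basis_vec A b) n) = tens (d (basis_vec A b)) n.
Proof. exact: (fsum_tens (fun b => tens (d (basis_vec A b)))). Qed.

Lemma tensDl B (v w : copower B A^o) (n : N) : tens (v + w) n = tens v n + tens w n.
Proof. by apply: co_eq => b; rewrite covalD !tensE covalD scalerDl. Qed.

Lemma tensZl B (a : A) (v : copower B A^o) (n : N) : tens (a *: v) n = tens v (a *: n).
Proof. by apply: co_eq => b; rewrite !tensE covalZ scalerA mulrC. Qed.

Lemma tens1 B (v : copower B A^o) (a : A) : tens v (a : A^o) = a *: v.
Proof. by apply: co_eq => b; rewrite tensE covalZ; exact: mulrC. Qed.

Lemma tens_map_tens B C (d : {linear copower B A^o -> copower C A^o}) v (n : N) :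
  tens_map d (tens v n) = tens (d v) n.
Proof.
move: v; apply: co_morph_eq => [v w|v w|b a].
- by rewrite tensDl tens_mapD.
- by rewrite linearD tensDl.
by rewrite tens1 tensZl tens_map_basis [d (_ *: _)]linearZ tensZl.
Qed.

Lemma tens_map_comp B C D (d : {linear copower B A^o -> copower C A^o})
    (e : {linear copower C A^o -> copower D A^o}) (g : copower B N) :
  tens_map (e \o d) g = tens_map e (tens_map d g).
Proof.
move: g; apply: co_morph_eq => [v w|v w|b a].
- by rewrite tens_mapD.
- by rewrite !tens_mapD.
by rewrite !tens_map_basis tens_map_tens.
Qed.

Lemma tens_map_add B C (d e : {linear copower B A^o -> copower C A^o})
    (g : copower B N) :
  tens_map (d \+ e) g = tens_map d g + tens_map e g.
Proof.
move: g; apply: co_morph_eq => [v w|v w|b a].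
- by rewrite tens_mapD.
- by rewrite !tens_mapD addrACA.
by rewrite !tens_map_basis /= tensDl.
Qed.

Lemma tens_map_id B (g : copower B N) : tens_map idfun g = g.
Proof.
move: g; apply: co_morph_eq => [v w|//|b a].
- by rewrite tens_mapD.
by rewrite tens_map_basis.
Qed.

Lemma eq_tens_map B C (d e : copower B A^o -> copower C A^o) (g : copower B N) :
  d =1 e -> tens_map d g = tens_map e g.
Proof. by move=> /funext ->. Qed.

Lemma tens_map0 B C (g : copower B N) :
  tens_map (fun _ : copower B A^o => 0 : copower C A^o) g = 0.
Proof.
move: g; apply: co_morph_eq => [v w|v w|b a].
- by rewrite tens_mapD.
- by rewrite addr0.
by rewrite tens_map_basis; apply: co_eq => c; rewrite tensE scale0r.
Qed.
End TensMap.

Section LinExt.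
Variables (A : comPzRingType) (Y : lmodType A).
Definition scal (y : Y) (a : A^o) : Y := a *: y.
Lemma scal_linear y : linear (scal y).
Proof. by move=> a b c; rewrite /scal scalerDl scalerA. Qed.
HB.instance Definition _ y := GRing.isLinear.Build A A^o Y *:%R (scal y) (scal_linear y).

Definition lin_ext (B : choiceType) (y : B -> Y) : {linear copower B A^o -> Y} :=
  fsum (fun b => scal (y b)).

Lemma basis_tens (B : choiceType) (b : B) :
  basis_vec A b = tens (basis_vec A b) (1 : A^o).
Proof. by rewrite tens1; apply: esym; exact: scale1r. Qed.

Lemma lin_ext_basis (B : choiceType) (y : B -> Y) b : lin_ext y (basis_vec A b) = y b.
Proof. by rewrite basis_tens /lin_ext /= fsum_tens; exact: scale1r. Qed.

Lemma lin_eq (B : choiceType) (f g : {linear copower B A^o -> Y}) :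
  (forall b, f (basis_vec A b) = g (basis_vec A b)) -> f =1 g.
Proof.
move=> fg; apply: co_morph_eq => [v w|v w|b a]; rewrite ?linearD //.
by rewrite tens1 !linearZ fg.
Qed.
End LinExt.

Section Gradings.
Variables (A : comPzRingType) (gA : nat -> {pred A}).

(** Only the closure properties of the components of a graded module; that the
module is their direct sum is [gdec]. *)
Definition gmod (N : lmodType A) (gN : nat -> {pred N}) : Prop :=
  [/\ forall j, 0 \in gN j, forall j x y, x \in gN j -> y \in gN j -> x - y \in gN j &
    forall i j a x, a \in gA i -> x \in gN j -> a *: x \in gN (i + j)%N].

Lemma gmodD (N : lmodType A) (gN : nat -> {pred N}) j x y :
  gmod gN -> x \in gN j -> y \in gN j -> x + y \in gN j.
Proof.
move=> [gN0 gNS _] xj yj; rewrite -[y]opprK; apply: (gNS) => //.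
by rewrite -sub0r; apply: gNS.
Qed.

Section Shift.
Variables (N : lmodType A) (gN : nat -> {pred N}) (B : choiceType) (dg : B -> nat).
Hypothesis gNP : gmod gN.

Lemma shift_compP j (g : copower B N) : g \in shift_comp gN dg j <->
  forall b, if (dg b <= j)%N then coval g b \in gN (j - dg b)%N else coval g b == 0.
Proof. by split=> [/asboolP|gj]; [|apply/asboolP]. Qed.

Lemma gmod_shift : gmod (shift_comp gN dg).
Proof.
have [gN0 gNB gNZ] := gNP.
split=> [j|j x y /shift_compP xj /shift_compP yj|i j a x aI /shift_compP xj];
  apply/shift_compP => b.
- by case: ifP => // _.
- by have := (xj b, yj b); case: ifP => _ [xb yb]; rewrite covalB;
    [exact: gNB | rewrite (eqP xb) (eqP yb) subrr].
have := xj b; rewrite covalZ; case: (leqP (dg b) j) => [bj|jb] xb.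
  by rewrite (leq_trans bj (leq_addl _ _)) -addnBA //; apply: gNZ.
by rewrite (eqP xb) scaler0; case: ifP.
Qed.

Lemma shift_tens j b (x : N) : (dg b <= j)%N -> x \in gN (j - dg b)%N ->
  tens (basis_vec A b) x \in shift_comp gN dg j.
Proof.
have [gN0 gNB gNZ] := gNP.
move=> bj xj; apply/shift_compP => c; rewrite tensE basis_vecE.
have [->|_] := eqVneq c b; first by rewrite bj scale1r.
by rewrite scale0r; case: ifP.
Qed.

Lemma shift_ind j (P : copower B N -> Prop) : P 0 ->
  (forall g h, P g -> P h -> P (g + h)) ->
  (forall b x, (dg b <= j)%N -> x \in gN (j - dg b)%N -> P (tens (basis_vec A b) x)) ->
  forall g, g \in shift_comp gN dg j -> P g.
Proof.
move=> P0 PD Pt g /shift_compP gj; have [s ->] := co_sum g.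
elim/big_rec: _ => // b x _; apply: PD; have := gj b.
case: ifP => [bj xj|_ /eqP ->]; first exact: Pt.
by rewrite linear0.
Qed.

Lemma fsum_graded (Y : lmodType A) (gY : nat -> {pred Y}) (phi : B -> {linear N -> Y}) :
  gmod gY -> (forall b j x, x \in gN j -> phi b x \in gY (j + dg b)%N) ->
  forall j g, g \in shift_comp gN dg j -> fsum phi g \in gY j.
Proof.
move=> gYP phij j; apply: shift_ind.
- by rewrite linear0; have [] := gYP.
- by move=> g h; rewrite linearD; apply: gmodD.
by move=> b x bj xj; rewrite fsum_tens -(subnK bj); apply: phij.
Qed.
End Shift.

Hypothesis gAP : gmod (gA : nat -> {pred A^o}).
Hypothesis gA1 : 1 \in gA 0.

Lemma shift_basis (B : choiceType) (dg : B -> nat) b :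
  basis_vec A b \in shift_comp (gA : nat -> {pred A^o}) dg (dg b).
Proof. by rewrite basis_tens; apply: shift_tens => //; rewrite subnn. Qed.

Lemma tens_map_graded (B C : choiceType) (dB : B -> nat) (dC : C -> nat)
    (d : copower B A^o -> copower C A^o) (N : lmodType A) (gN : nat -> {pred N}) :
  gmod gN ->
  (forall b, d (basis_vec A b) \in shift_comp (gA : nat -> {pred A^o}) dC (dB b)) ->
  forall j g, g \in shift_comp gN dB j -> tens_map d g \in shift_comp gN dC j.
Proof.
move=> gNP dgr; apply: (fsum_graded (phi := fun b => tens (d (basis_vec A b)))) => //.
  exact: gmod_shift.
have [gN0 _ gNZ] := gNP.
move=> b j x xj; apply/shift_compP => c; have /shift_compP/(_ c) := dgr b.
rewrite tensE; case: (leqP (dC c) (dB b)) => [cb vc|bc /eqP ->].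
  rewrite (leq_trans cb (leq_addl _ _)) -addnBA // addnC; exact: gNZ.
by rewrite scale0r; case: ifP.
Qed.

Lemma lin_ext_graded (B : choiceType) (dB : B -> nat) (Y : lmodType A)
    (gY : nat -> {pred Y}) (y : B -> Y) :
  gmod gY -> (forall b, y b \in gY (dB b)) ->
  forall j g, g \in shift_comp (gA : nat -> {pred A^o}) dB j -> lin_ext y g \in gY j.
Proof.
move=> gYP yP; apply: fsum_graded => // b j x xj.
by have [_ _] := gYP; apply.
Qed.

(** Projectivity among graded modules, for maps e that are onto on homogeneous
elements only. *)
Definition gproj (X : lmodType A) (gX : nat -> {pred X}) : Prop :=
  forall (Y Z : lmodType A) (gY : nat -> {pred Y}) (u : {linear X -> Z})
    (e : {linear Y -> Z}), gmod gY ->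
  (forall j x, x \in gX j -> exists2 y, y \in gY j & e y = u x) ->
  exists2 f : {linear X -> Y}, (forall j x, x \in gX j -> f x \in gY j) &
    forall x, e (f x) = u x.

Lemma gproj_shift (B : choiceType) (dB : B -> nat) :
  gproj (shift_comp (gA : nat -> {pred A^o}) dB).
Proof.
move=> Y Z gY u e gYP ue.
have [y yP] := choice (fun b => ex2_and (ue _ _ (shift_basis dB b))).
exists (lin_ext y).
  by apply: lin_ext_graded => // b; have [] := yP b.
apply: (lin_eq (f := e \o lin_ext y)) => b.
by rewrite -[LHS]/(e (lin_ext y (basis_vec A b))) lin_ext_basis; have [] := yP b.
Qed.

End Gradings.

Section Decomposition.

(** X is the direct sum of the gX j, with projections pr j. *)
Definition gdec (X : zmodType) (gX : nat -> {pred X}) : Prop :=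
  exists pr : nat -> X -> X, [/\ forall j, {morph pr j : x y / x + y},
    forall j l x, x \in gX l -> pr j x = if j == l then x else 0 &
    forall P : X -> Prop, P 0 -> (forall x y, P x -> P y -> P (x + y)) ->
      (forall j x, x \in gX j -> P x) -> forall x, P x].

Lemma morph0 (X Y : zmodType) (f : X -> Y) : {morph f : x y / x + y} -> f 0 = 0.
Proof. by move=> fD; apply/eqP; rewrite -(subrr (f 0)) eq_sym subr_eq -fD addr0. Qed.

(** The component of degree j of a preimage of f x is still a preimage. *)
Lemma gdec_lift (A : comPzRingType) (gA : nat -> {pred A}) (X Y : lmodType A)
  (gX : nat -> {pred X}) (gY : nat -> {pred Y}) (f : X -> Y) :
  gmod gA gX -> gdec gX -> gdec gY -> {morph f : x y / x + y} ->
  (forall j x, x \in gX j -> f x \in gY j) ->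
  forall j x, f x \in gY j -> exists2 x', x' \in gX j & f x' = f x.
Proof.
move=> gXP [p [pD pg pgen]] [q [qD qg _]] fD fg j x fx.
have [gX0 _ _] := gXP.
exists (p j x).
  apply: (pgen (fun x => p j x \in gX j)) => [|y z yj zj|l y yl].
  - by rewrite morph0.
  - by rewrite pD; apply: gmodD gXP _ _.
  by rewrite (pg _ _ _ yl); case: eqP => // ->.
have pq : forall y, f (p j y) = q j (f y).
  apply: pgen => [|y z yj zj|l y yl].
  - by rewrite !morph0.
  - by rewrite pD !fD qD yj zj.
  rewrite (pg _ _ _ yl) (qg _ l) ?fg //; case: eqP => // _; exact: morph0.
by rewrite pq (qg _ _ _ fx) eqxx.
Qed.

Variables (A : comPzRingType) (gA : nat -> {pred A}) (N : lmodType A).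
Variables (gN : nat -> {pred N}) (B : choiceType) (dg : B -> nat).

Lemma gdec_shift : gmod gA gN -> gdec gN -> gdec (shift_comp gN dg).
Proof.
move=> gNP [p [pD pg pgen]].
have p0 j : p j 0 = 0 by apply: morph0.
have qP j (g : copower B N) :
    (fun b => if (dg b <= j)%N then p (j - dg b)%N (coval g b) else 0)
      \in dsum (fun _ : B => full N).
  apply/asboolP; split=> //; have /asboolP[gf _] := submod_valP g.
  apply: sub_finite_set gf => b /=; apply: contraNN => /eqP ->.
  by rewrite p0 if_same.
have qE j g b : coval (Submod (qP j g)) b =
    if (dg b <= j)%N then p (j - dg b)%N (coval g b) else 0 by [].
exists (fun j g => Submod (qP j g)); split=> [j g h|j l g /shift_compP gl|P P0 PD Ph].
- apply: co_eq => b; rewrite covalD !qE covalD; case: ifP => _; rewrite ?pD //.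
  by rewrite addr0.
- apply: co_eq => b; rewrite qE; have := gl b;
  case: (leqP (dg b) l) => [bl gb|lb /eqP gb]; last first.
    by rewrite gb p0 if_same; case: eqP.
  rewrite (pg _ _ _ gb); case: (leqP (dg b) j) => [bj|jb].
    by rewrite -(eqn_add2r (dg b)) !subnK //; case: eqP.
  by case: eqP => // jl; rewrite jl ltnNge bl in jb.
apply: co_ind => // b; apply: pgen => [|x y|j x xj]; first by rewrite linear0.
  by rewrite linearD; apply: PD.
apply: (Ph (j + dg b)%N); apply: (shift_tens gNP); first exact: leq_addl.
by rewrite addnK.
Qed.
End Decomposition.

(** * Comparison of resolutions *)

Lemma dep_choice (T : nat -> Type) (P : forall i, T i -> Prop)
    (Q : forall i, T i -> T i.+1 -> Prop) (t0 : T 0%N) :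
  P 0%N t0 -> (forall i t, P i t -> exists t', Q i t t' /\ P i.+1 t') ->
  exists s : forall i, T i, s 0%N = t0 /\ forall i, P i (s i) /\ Q i (s i) (s i.+1).
Proof.
move=> P0 PS.
pose step i (t : {t : T i | P i t}) : {t : T i.+1 | P i.+1 t} :=
  let w := cid (PS i (sval t) (svalP t)) in exist _ (sval w) (svalP w).2.
pose s := fix s i : {t : T i | P i t} :=
  if i is k.+1 then step k (s k) else exist _ t0 P0.
exists (fun i => sval (s i)); split=> // i; split; first exact: svalP.
exact: (svalP (cid (PS i (sval (s i)) (svalP (s i))))).1.
Qed.

Section Comparison.
Variables (A : comPzRingType) (gA : nat -> {pred A}).
Variables (X Y : nat -> lmodType A) (dX : forall i, {linear X i.+1 -> X i})
  (dY : forall i, {linear Y i.+1 -> Y i})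
  (gX : forall i, nat -> {pred X i}) (gY : forall i, nat -> {pred Y i}).
Arguments gX : clear implicits.
Arguments gY : clear implicits.
Hypotheses (Xproj : forall i, gproj gA (gX i.+1)) (YG : forall i, gmod gA (gY i.+1)).
Hypotheses (dXg : forall i j x, x \in gX i.+2 j -> dX i.+1 x \in gX i.+1 j)
  (dXX : forall i x, dX i (dX i.+1 x) = 0)
  (Yex : forall i j y, y \in gY i.+1 j -> dY i y = 0 ->
     exists2 z, z \in gY i.+2 j & dY i.+1 z = y).

(** Invariant of the recursion: f i composed with dX lifts through dY on
homogeneous elements.  For f i.+1 this follows from exactness, as
dY (f i.+1 (dX x)) = f i (dX (dX x)) = 0. *)
Lemma chain_lift (f0 : {linear X 0%N -> Y 0%N}) :
  (forall j x, x \in gX 1%N j -> exists2 y, y \in gY 1%N j & dY 0%N y = f0 (dX 0%N x)) ->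
  exists f : forall i, {linear X i -> Y i}, [/\ f 0%N = f0,
    forall i j x, x \in gX i.+1 j -> f i.+1 x \in gY i.+1 j &
    forall i x, dY i (f i.+1 x) = f i (dX i x)].
Proof.
move=> f0P.
pose P i (f : {linear X i -> Y i}) := forall j x, x \in gX i.+1 j ->
  exists2 y, y \in gY i.+1 j & dY i y = f (dX i x).
pose Q i (f : {linear X i -> Y i}) (f' : {linear X i.+1 -> Y i.+1}) :=
  (forall j x, x \in gX i.+1 j -> f' x \in gY i.+1 j) /\
  forall x, dY i (f' x) = f (dX i x).
have [|f [f0E fP]] := @dep_choice _ P Q f0 f0P; last first.
  exists f; split=> // [i j x|i x]; have [_ [H1 H2]] := fP i; [exact: H1|exact: H2].
move=> i f fP.
have [|f' f'g f'E] := @Xproj i _ _ (gY i.+1) (f \o dX i) (dY i) (YG i).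
  exact: fP.
exists f'; split=> // j x xj.
apply: Yex; first by apply: f'g; apply: dXg.
by rewrite f'E /= dXX linear0.
Qed.

(** Invariant of the recursion: u i.+1 - h i dX takes values that lift through
dY, which holds by exactness because they are cycles. *)
Lemma chain_homotopy (u : forall i, {linear X i -> Y i}) :
  (forall x, u 0%N x = 0) ->
  (forall i j x, x \in gX i.+1 j -> u i.+1 x \in gY i.+1 j) ->
  (forall i x, dY i (u i.+1 x) = u i (dX i x)) ->
  exists h : forall i, {linear X i -> Y i.+1}, [/\ forall x, h 0%N x = 0,
    forall i j x, x \in gX i.+1 j -> h i.+1 x \in gY i.+2 j &
    forall i x, u i.+1 x = dY i.+1 (h i.+1 x) + h i (dX i x)].
Proof.
move=> u0 ug uE.
pose P i (h : {linear X i -> Y i.+1}) := forall j x, x \in gX i.+1 j ->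
  exists2 y, y \in gY i.+2 j & dY i.+1 y = (u i.+1 \- (h \o dX i)) x.
pose Q i (h : {linear X i -> Y i.+1}) (h' : {linear X i.+1 -> Y i.+2}) :=
  (forall j x, x \in gX i.+1 j -> h' x \in gY i.+2 j) /\
  forall x, u i.+1 x = dY i.+1 (h' x) + h (dX i x).
have P0 : P 0%N (\0 : {linear X 0%N -> Y 1%N}).
  move=> j x xj; rewrite /= subr0; apply: Yex; first exact: ug.
  by rewrite uE u0.
have [|h [h0E hP]] := @dep_choice _ P Q _ P0; last first.
  exists h; split=> [x|i j x|i x]; first by rewrite h0E.
    by have [_ [H1 _]] := hP i; apply: H1.
  by have [_ [_ H2]] := hP i.
move=> i h hP.
have [|h' h'g h'E] := @Xproj i _ _ (gY i.+2) (u i.+1 \- (h \o dX i)) (dY i.+1) (YG _).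
  exact: hP.
have hE x : u i.+1 x = dY i.+1 (h' x) + h (dX i x) by rewrite h'E /= subrK.
exists h'; split=> // j x xj /=.
apply: Yex.
  have [_ YB _] := YG i.+1; apply: YB; first exact: ug.
  by apply: h'g; apply: dXg.
by rewrite linearB uE hE dXX linear0 addr0 subrr.
Qed.
End Comparison.

Section GradedResolutions.
Variables (A : comPzRingType) (gA : nat -> {pred A}).
Hypothesis gAP : gmod gA (gA : nat -> {pred A^o}).
Hypothesis gA1 : 1 \in gA 0.

Local Notation shA := (shift_comp (gA : nat -> {pred A^o})).

(** Exactness on homogeneous elements suffices for the comparison of resolutions,
and it is what strictness of a filtered resolution gives for gr. *)
Record homog_resolution (M : lmodType A) (gM : nat -> {pred M}) := HomogRes {
  gbas : nat -> choiceType;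
  gdeg : forall i, gbas i -> nat;
  gdif : forall i, {linear copower (gbas i.+1) A^o -> copower (gbas i) A^o};
  gaug : {linear copower (gbas 0) A^o -> M};
  gdif_gr : forall i j v, v \in shA (@gdeg i.+1) j -> gdif i v \in shA (@gdeg i) j;
  gaug_surj : forall j x, x \in gM j -> exists2 v, v \in shA (@gdeg 0) j & gaug v = x;
  gaug_gr : forall j v, v \in shA (@gdeg 0) j -> gaug v \in gM j;
  gaug_dif : forall v, gaug (gdif 0 v) = 0;
  gdif_dif : forall i v, gdif i (gdif i.+1 v) = 0;
  gaug_ex : forall j v, v \in shA (@gdeg 0) j -> gaug v = 0 ->
    exists2 w, w \in shA (@gdeg 1) j & gdif 0 w = v;
  gdif_ex : forall i j v, v \in shA (@gdeg i.+1) j -> gdif i v = 0 ->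
    exists2 w, w \in shA (@gdeg i.+2) j & gdif i.+1 w = v }.
Arguments gdeg {M gM} _ i _.

(** The resolved module sits in index 0, so that the augmentation is one of the
differentials and the recursions above start from the identity of M. *)
Definition augm (M : lmodType A) (gM : nat -> {pred M}) (P : homog_resolution gM) (i :
  nat) : lmodType A :=
  if i is k.+1 then copower (gbas P k) A^o else M.
Definition augd (M : lmodType A) (gM : nat -> {pred M}) (P : homog_resolution gM) (i :
  nat) :
    {linear augm P i.+1 -> augm P i} :=
  match i with 0 => gaug P | k.+1 => gdif P k end.
Definition augg (M : lmodType A) (gM : nat -> {pred M}) (P : homog_resolution gM) (i :
  nat) :
    nat -> {pred augm P i} :=
  match i with 0 => gM | k.+1 => shA (gdeg P k) end.

Arguments augm {M gM} P i.
Arguments augd {M gM} P i.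
Arguments augg {M gM} P i _.

Variables (M : lmodType A) (gM : nat -> {pred M}).

Lemma augg_proj (P : homog_resolution gM) i : gproj gA (augg P i.+1).
Proof. exact: gproj_shift. Qed.
Lemma augg_gmod (P : homog_resolution gM) i : gmod gA (augg P i.+1).
Proof. exact: gmod_shift. Qed.
Lemma augd_gr (P : homog_resolution gM) i j x : x \in augg P i.+2 j ->
  augd P i.+1 x \in augg P i.+1 j.
Proof. exact: gdif_gr. Qed.
Lemma augd_augd (P : homog_resolution gM) i x : augd P i (augd P i.+1 x) = 0.
Proof. by case: i x => [|i] x; [apply: gaug_dif | apply: gdif_dif]. Qed.
Lemma augd_ex (P : homog_resolution gM) i j y : y \in augg P i.+1 j -> augd P i y = 0 ->
  exists2 z, z \in augg P i.+2 j & augd P i.+1 z = y.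
Proof. by case: i y => [|i] y; [apply: gaug_ex | apply: gdif_ex]. Qed.

Lemma homog_resolution_map (P Q : homog_resolution gM) : exists f : forall i,
  {linear augm P i -> augm Q i},
  [/\ forall x, f 0%N x = x,
    forall i j x, x \in augg P i.+1 j -> f i.+1 x \in augg Q i.+1 j &
    forall i x, augd Q i (f i.+1 x) = f i (augd P i x)].
Proof.
have [|f [f0 fg fE]] := @chain_lift A gA (augm P) (augm Q) (augd P) (augd Q)
    (augg P) (augg Q) (@augg_proj P) (@augg_gmod Q) (@augd_gr P)
    (@augd_augd P) (@augd_ex Q) idfun.
  by move=> j x xj; apply: gaug_surj; apply: gaug_gr.
by exists f; split=> // x; rewrite f0.
Qed.

Lemma homog_resolution_homotopy (P : homog_resolution gM) (u : forall i,
  {linear augm P i -> augm P i}) :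
  (forall x, u 0%N x = x) ->
  (forall i j x, x \in augg P i.+1 j -> u i.+1 x \in augg P i.+1 j) ->
  (forall i x, augd P i (u i.+1 x) = u i (augd P i x)) ->
  exists h : forall i, {linear augm P i -> augm P i.+1}, [/\ forall x, h 0%N x = 0,
    forall i j x, x \in augg P i.+1 j -> h i.+1 x \in augg P i.+2 j &
    forall i x, u i.+1 x = x + (augd P i.+1 (h i.+1 x) + h i (augd P i x))].
Proof.
move=> u0 ug uE.
have [||i x|h [h0 hg hE]] := @chain_homotopy A gA (augm P) (augm P) (augd P) (augd P)
    (augg P) (augg P) (@augg_proj P) (@augg_gmod P) (@augd_gr P)
    (@augd_augd P) (@augd_ex P) (fun i => u i \- idfun).
- by move=> x; rewrite /= u0 subrr.
- move=> i j x xj; have [_ XB _] := @augg_gmod P i; apply: XB => //; exact: ug.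
- by rewrite /= linearB uE.
by exists h; split=> // i x; rewrite -hE /= addrC subrK.
Qed.

Definition tens_cycle (N : lmodType A) (bas : nat -> choiceType)
    (d : forall i, copower (bas i.+1) A^o -> copower (bas i) A^o) (i : nat) :
    copower (bas i) N -> Prop :=
  match i with 0 => fun=> True | k.+1 => fun z => tens_map (d k) z = 0 end.

(** Two resolutions of M are homotopy equivalent, by homogeneous maps, and the
tensor product with N preserves composition and sums of maps.  The two last
clauses say that phi is onto and injective on homology; the preimage of a
homogeneous cycle is homogeneous. *)
Theorem homog_resolution_qis (P Q : homog_resolution gM) (N : lmodType A) (gN : nat ->
  {pred N}) :
  gmod gA gN -> exists phi : forall i, {linear copower (gbas P i) N ->
    copower (gbas Q i) N},
  [/\ forall i j z, z \in shift_comp gN (gdeg P i) j ->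
    phi i z \in shift_comp gN (gdeg Q i) j,
      forall i z, tens_map (gdif Q i) (phi i.+1 z) = phi i (tens_map (gdif P i) z),
      forall i j z, tens_cycle (gdif Q) z -> z \in shift_comp gN (gdeg Q i) j ->
        exists z0, [/\ tens_cycle (gdif P) z0, z0 \in shift_comp gN (gdeg P i) j &
          exists w, z = phi i z0 + tens_map (gdif Q i) w] &
      forall i z w, tens_cycle (gdif P) z -> phi i z = tens_map (gdif Q i) w ->
        exists w', z = tens_map (gdif P i) w'].
Proof.
move=> gNP.
have [f [f0 fg fE]] := homog_resolution_map P Q; have [g [g0 gg gE]] :=
  homog_resolution_map Q P.
have [||i x|h [h0 hg hE]] := @homog_resolution_homotopy P (fun i => g i \o f i).
- by move=> x; rewrite /= f0 g0.
- by move=> i j x xj; apply: gg; apply: fg.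
- by rewrite /= gE fE.
have [||i x|k [k0 kg kE]] := @homog_resolution_homotopy Q (fun i => f i \o g i).
- by move=> x; rewrite /= g0 f0.
- by move=> i j x xj; apply: fg; apply: gg.
- by rewrite /= fE gE.
pose phi i : {linear copower (gbas P i) N -> copower (gbas Q i) N} :=
  tens_map (f i.+1 : _ -> copower (gbas Q i) A^o).
pose psi i : {linear copower (gbas Q i) N -> copower (gbas P i) N} :=
  tens_map (g i.+1 : _ -> copower (gbas P i) A^o).
have phiE i z : tens_map (gdif Q i) (phi i.+1 z) = phi i (tens_map (gdif P i) z).
  rewrite /phi /= -[LHS](tens_map_comp (f i.+2) (gdif Q i)).
  rewrite -[RHS](tens_map_comp (gdif P i) (f i.+1)).
  by apply: eq_tens_map => x; apply: (fE i.+1).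
have psiE i z : tens_map (gdif P i) (psi i.+1 z) = psi i (tens_map (gdif Q i) z).
  rewrite /psi /= -[LHS](tens_map_comp (g i.+2) (gdif P i)).
  rewrite -[RHS](tens_map_comp (gdif Q i) (g i.+1)).
  by apply: eq_tens_map => x; apply: (gE i.+1).
have hom (S T : homog_resolution gM) (a : forall i, {linear augm S i -> augm T i})
    (b : forall i, {linear augm T i -> augm S i}) (l : forall i, {linear augm S i ->
      augm S i.+1}) :
    (forall x, l 0%N x = 0) ->
    (forall i x, b i.+1 (a i.+1 x) = x + (augd S i.+1 (l i.+1 x) + l i (augd S i x))) ->
    forall i (z : copower (gbas S i) N), tens_cycle (gdif S) z ->
    exists w, tens_map (b i.+1 : _ -> copower (gbas S i) A^o)
      (tens_map (a i.+1 : copower (gbas S i) A^o -> copower (gbas T i) A^o) z) =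
        z + tens_map (gdif S i) w.
  move=> l0 lE i z zc.
  exists (tens_map (l i.+1 : copower (gbas S i) A^o -> copower (gbas S i.+1) A^o) z).
  rewrite -[LHS](tens_map_comp (a i.+1) (b i.+1)).
  rewrite -[X in _ = _ + X](tens_map_comp (l i.+1) (gdif S i)).
  case: i z zc => [|i] z zc.
    rewrite -[X in X + _](tens_map_id z) -[RHS](tens_map_add idfun (gdif S 0 \o l 1%N)).
    by apply: eq_tens_map => x /=; rewrite lE l0 addr0.
  have E : (b i.+2 \o a i.+2 : copower (gbas S i.+1) A^o -> copower (gbas S i.+1) A^o) =1
      (idfun \+ ((gdif S i.+1 \o l i.+2) \+ (l i.+1 \o gdif S i))).
    by move=> x /=; rewrite lE.
  rewrite (eq_tens_map z E).
  rewrite (tens_map_add idfun ((gdif S i.+1 \o l i.+2) \+ (l i.+1 \o gdif S i)))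
    tens_map_id.
  rewrite (tens_map_add (gdif S i.+1 \o l i.+2) (l i.+1 \o gdif S i)).
  rewrite (tens_map_comp (gdif S i) (l i.+1)).
  by move: zc => /= ->; rewrite linear0 addr0.
exists phi; split=> [i j z||i j z zc zj|i z w zc phiz] //.
- by apply: (tens_map_graded gNP) => b; apply: fg; apply: shift_basis.
- exists (psi i z); split.
  + by case: i z zc {zj} => //= i z zc; rewrite psiE zc linear0.
  + by move: zj; apply: (tens_map_graded gNP) => b; apply: gg; apply: shift_basis.
  have [w wE] := hom Q P g f k k0 kE i z zc.
  by exists (- w); rewrite linearN /phi /psi /= wE addrK.
have [w' w'E] := hom P Q f g h h0 hE i z zc.
exists (psi i.+1 w - w').
rewrite linearB /= psiE -phiz; apply/eqP; rewrite eq_sym subr_eq; apply/eqP.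
exact: w'E.
Qed.
End GradedResolutions.

(** * Associated graded modules and shifted filtrations *)

Section Symbols.
Local Open Scope classical_set_scope.
Variables (R : comPzRingType) (m : {pred R}) (M : lmodType R).
Variable F : stable_filtration M m.

Definition delta j (x : M) : nat -> M :=
  fun k => if (k == j) && (x \in F j) then x else 0.

Lemma delta_dsum j x : delta j x \in dsum F.
Proof.
apply/asboolP; split=> [|k]; last first.
  by rewrite /delta; case: eqP => [->|_] /=; [case: ifP|]; rewrite ?rpred0.
apply: (@sub_finite_set _ _ [set j]) => // k /=; rewrite /delta.
by case: (k =P j) => //= _; rewrite eqxx.
Qed.

(** The class of x in F j / F j.+1, made total by sending the x outside F j to
0. *)
Definition gr_class j x : gr F := gr_proj (Submod (delta_dsum j x)).

Lemma gr_classD j x y : x \in F j -> y \in F j -> gr_class j (x + y) =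
  gr_class j x + gr_class j y.
Proof.
move=> xj yj; rewrite -gr_projD; congr gr_proj; apply: val_inj; apply/funext => k.
rewrite -[RHS]/(delta j x k + delta j y k) /= /delta xj yj rpredD //.
by case: eqP => _ //=; rewrite addr0.
Qed.

Lemma gr_class_eq0 j x : x \in F j -> gr_class j x = 0 <-> x \in F j.+1.
Proof.
move=> xj; have -> : 0 = gr_proj (0 : submod (dsum F)) by exact: esym (raddf0 _).
rewrite gr_proj_eq; split=> [/(_ j)|xS k].
  by rewrite -[_ - _]/(delta j x j - 0) subr0 /delta eqxx xj.
rewrite -[_ - _]/(delta j x k - 0) subr0 /delta.
by case: eqP => [->|_] /=; [rewrite xj | rewrite rpred0].
Qed.

Lemma gr_class0 j : gr_class j 0 = 0.
Proof. by apply/gr_class_eq0; rewrite rpred0. Qed.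

Lemma gr_class_comp j x : gr_class j x \in gr_comp (F := F) j.
Proof.
apply/asboolP; exists (Submod (delta_dsum j x)) => // k kj.
by rewrite /= /delta (negbTE kj).
Qed.

Lemma comp_gr_class j t : t \in gr_comp (F := F) j -> exists2 x, x \in F j & t =
  gr_class j x.
Proof.
move=> /asboolP[f f0 ->]; have /asboolP[_ fF] := submod_valP f.
exists (submod_val f j) => //; congr gr_proj; apply: val_inj; apply/funext => k.
by rewrite /= /delta fF; case: eqP => [->|/eqP /f0].
Qed.

Definition gr_part j (t : gr F) : gr F := gr_class j (submod_val (gr_repr t) j).

Lemma gr_partE j f : gr_part j (gr_proj f) = gr_class j (submod_val f j).
Proof.
apply/gr_proj_eq => k /=; rewrite /delta.
have /asboolP[_ fF] := submod_valP f.
have /asboolP[_ fF'] := submod_valP (gr_repr (gr_proj f)).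
rewrite fF fF'; case: eqP => [->|_] /=; last by rewrite subrr rpred0.
by have /gr_proj_eq := gr_reprK (gr_proj f); apply.
Qed.

Lemma gr_gdec : gdec (gr_comp (F := F)).
Proof.
exists gr_part; split=> [j t u|j l t /comp_gr_class[x xl ->]|P P0 PD Pg t].
- rewrite -[t]gr_reprK -[u]gr_reprK -gr_projD !gr_partE.
  have /asboolP[_ tF] := submod_valP (gr_repr t).
  have /asboolP[_ uF] := submod_valP (gr_repr u).
  by rewrite -gr_classD.
- rewrite gr_partE /= /delta xl; case: eqP => [->//|_] /=.
  exact: gr_class0.
rewrite -[t]gr_reprK; move: (gr_repr t) => f.
have /asboolP[/finite_fsetP[s sP] fF] := submod_valP f.
suff -> : gr_proj f = \sum_(j <- s) gr_class j (submod_val f j).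
  by elim/big_rec: _ => // j x _; apply: PD; apply: Pg (gr_class_comp _ _).
rewrite -(raddf_sum (@gr_proj R m M F : {additive _ -> _})).
congr gr_proj; apply: val_inj; apply/funext => k.
rewrite [RHS](big_morph (fun g : submod (dsum F) => submod_val g k) (id1 := 0) (op1 :=
  +%R)) //=.
have [ks|ks] := boolP (k \in s).
  rewrite (bigD1_seq k) ?fset_uniq //= /delta eqxx fF /= big1 ?addr0 //.
  by move=> j jk; rewrite eq_sym (negbTE jk).
rewrite big_seq big1 => [|j js].
  apply/eqP/negPn/negP => fk; move/negP: ks; apply.
  by have : [set` s] k by rewrite -sP.
rewrite /delta; case: eqP => // kj; by rewrite kj js in ks.
Qed.
End Symbols.
Arguments gr_class {R m M} F j x.

Section SymbolAction.
Variables (R : comPzRingType) (m : {pred R}) (M : lmodType R).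
Variable F : stable_filtration M m.

Lemma gr_class_act i j (a : R^o) (x : M) : a \in ideal_power m i -> x \in F j ->
  gr_act (gr_class (adic m) i a) (gr_class F j x) = gr_class F (i + j) (a *: x).
Proof.
move=> ai xj; rewrite gr_actE; congr gr_proj; apply: val_inj; apply/funext => k /=.
rewrite /conv /delta fil_ideal_power // xj andbT.
have -> : (a \in adic m i) = true by exact: ai.
case: (eqVneq k (i + j)%N) => [->|ne].
  have ilt : (i < (i + j).+1)%N by rewrite ltnS leq_addr.
  rewrite (bigD1 (Ordinal ilt)) //= eqxx addKn eqxx big1 ?addr0 // => l ne.
  have -> : (l == i :> nat) = false by apply: contraNF ne => /eqP li; apply/eqP/val_inj.
  by rewrite /= scale0r.
apply: big1 => l _; case: (eqVneq (l : nat) i) => [li|_] /=; last by rewrite scale0r.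
case: eqP => [kl|_] /=; last by rewrite scaler0.
have := ltn_ord l; rewrite ltnS li => ik.
by case/eqP: ne; rewrite -kl li subnKC.
Qed.

Lemma gr_gmod : gmod (gr_ring_comp m) (gr_mod_comp F).
Proof.
split=> [j|j t u /comp_gr_class[x' xj ->] /comp_gr_class[y yj ->]|i j a t].
- by have := gr_class_comp F j 0; rewrite gr_class0.
- have -> : gr_class F j x' - gr_class F j y = gr_class F j (x' - y) :> gr F.
    have xyj : x' - y \in F j by exact: (submB (subm_mem (F j))).
    by apply/eqP; rewrite subr_eq -(gr_classD xyj yj) subrK.
  exact: gr_class_comp.
move=> /comp_gr_class[b bi ->] /comp_gr_class[y yj ->].
rewrite -[_ *: _]/(gr_act (gr_class (adic m) i b) (gr_class F j y)) gr_class_act //.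
exact: gr_class_comp.
Qed.
End SymbolAction.

Section ClassMap.
Variables (R : comPzRingType) (m : {pred R}).
Local Notation G := (gr_ring m).

(** What the results below use of an associated graded module: cl j induces an
isomorphism from F j / F j.+1 onto gL j, compatibly with the action of G.  This
covers gr M, the ring G itself, and finite direct sums with shifts
([class_map_shift]). *)
Record class_map (V : lmodType R) (F : nat -> V -> Prop) (L : lmodType G)
    (gL : nat -> {pred L}) (cl : nat -> V -> L) : Prop := ClassMap {
  cm_stab : stable_fil m F;
  cm_gmod : gmod (gr_ring_comp m) gL;
  cm_D : forall j x y, F j x -> F j y -> cl j (x + y) = cl j x + cl j y;
  cm_0 : forall j x, F j x -> cl j x = 0 <-> F j.+1 x;
  cm_in : forall j x, F j x -> cl j x \in gL j;
  cm_surj : forall j t, t \in gL j -> exists2 x, F j x & t = cl j x;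
  cm_act : forall i j a x, a \in ideal_power m i -> F j x ->
    (gr_class (adic m) i a : G) *: cl j x = cl (i + j)%N ((a : R) *: x) }.

Lemma class_map_gr (M : lmodType R) (F : stable_filtration M m) :
  @class_map M (fun j x => x \in F j) (gr_mod F) (gr_mod_comp F) (gr_class F).
Proof.
split=> [||j x y|j x|j x xj|j t|i j a x].
- exact: stable_fil_of.
- exact: gr_gmod.
- exact: gr_classD.
- exact: gr_class_eq0.
- exact: gr_class_comp.
- exact: comp_gr_class.
exact: gr_class_act.
Qed.

Lemma class_map_adic :
  @class_map R^o (fun j x => x \in ideal_power m j) G^o (gr_ring_comp m) (gr_class
    (adic m)).
Proof.
split=> [||j x y|j x|j x xj|j t|i j a x].
- exact: (stable_fil_of (adic m)).
- exact: (gr_gmod (adic m)).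
- exact: (gr_classD (F := adic m)).
- exact: (gr_class_eq0 (F := adic m)).
- exact: (gr_class_comp (adic m)).
- exact: (comp_gr_class (F := adic m)).
exact: (gr_class_act (F := adic m)).
Qed.

Section ShiftSymb.
Variables (V : lmodType R) (F : nat -> V -> Prop) (L : lmodType G).
Variables (gL : nat -> {pred L}) (cl : nat -> V -> L).
Hypothesis sF : class_map F gL cl.
Variables (n : nat) (d : 'I_n -> nat).

(** With truncated subtraction the summand b is not filtered below degree d b, so
that its graded pieces vanish there, as in [shift_comp]. *)
Definition shift_fil j (g : copower 'I_n V) : Prop := forall b, F (j - d b)%N (coval g b).

Lemma fin_dsum (A : pzRingType) (W : lmodType A) (f : 'I_n -> W) :
  f \in dsum (fun _ : 'I_n => full W).
Proof. by apply/asboolP; split=> //; apply: finite_finset. Qed.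
Definition mkco (A : pzRingType) (W : lmodType A) (f : 'I_n -> W) : copower 'I_n W :=
  Submod (fin_dsum f).

Definition shift_class j (g : copower 'I_n V) : copower 'I_n L :=
  mkco (fun b => if (d b <= j)%N then cl (j - d b)%N (coval g b) else 0).

Lemma shift_classE j g b :
  coval (shift_class j g) b = if (d b <= j)%N then cl (j - d b)%N (coval g b) else 0.
Proof. by []. Qed.

Lemma ps_pow i j (a : R^o) x : stable_fil m F -> a \in ideal_power m i -> F j x ->
  F (i + j)%N ((a : R) *: x).
Proof.
move=> Fp; have Fs := stable_fil_subm Fp.
elim: i a x => [|i IH] a x; first by move=> _ xF; apply: (submZ _ (Fs _)).
move=> /asboolP[s sIS ->] xF; rewrite scaler_suml big_seq.
apply: (subm_sum _ (Fs _)) => u us.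
have [u1 u2] := sIS u us; rewrite -scalerA addSn; apply: (ps_mul Fp) => //.
exact: IH.
Qed.

Lemma cm_00 j : cl j 0 = 0.
Proof.
have Fs := stable_fil_subm (cm_stab sF).
by apply/(cm_0 sF); apply: subm0 (Fs _).
Qed.

Lemma co_ord (g : copower 'I_n V) : g = \sum_(b < n) tens (basis_vec R b) (coval g b).
Proof.
apply: co_eq => c; rewrite coval_sum (bigD1 c) //= eqxx scale1r big1 ?addr0 //.
by move=> b bc; rewrite eq_sym (negbTE bc) scale0r.
Qed.

Lemma shift_fil_subm j : subm (shift_fil j).
Proof.
have Fs := stable_fil_subm (cm_stab sF).
split=> [b|a g h gj hj b]; first exact: subm0 (Fs _).
by rewrite covalD covalZ; apply: (submP _ (Fs _)).
Qed.

Lemma shift_fil_tens j b x : F (j - d b)%N x -> shift_fil j (tens (basis_vec R b) x).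
Proof.
have Fs := stable_fil_subm (cm_stab sF).
move=> xj c; rewrite tensE basis_vecE; case: eqP => [->|_].
  by rewrite scale1r.
by rewrite scale0r; apply: subm0 (Fs _).
Qed.

Lemma shift_fil_ind j (P : copower 'I_n V -> Prop) : P 0 ->
  (forall g h, P g -> P h -> P (g + h)) ->
  (forall b x, F (j - d b)%N x -> P (tens (basis_vec R b) x)) ->
  forall g, shift_fil j g -> P g.
Proof.
move=> P0 PD Pt g gj; rewrite (co_ord g).
elim/big_rec: _ => // b x _; apply: PD; exact: Pt.
Qed.

Lemma shift_stable_fil : stable_fil m shift_fil.
Proof.
have Fp := cm_stab sF; have Fs := stable_fil_subm Fp.
have [k kP] := ps_stab Fp.
split=> [j|j g gj b|j a g am gj b|]; first exact: shift_fil_subm.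
- by apply: (ps_leq Fp) (gj b); rewrite leq_sub2r.
- rewrite covalZ; case: (leqP (d b) j) => [bj|jb].
    by rewrite subSn //; apply: (ps_mul Fp).
  apply: (submZ _ (Fs _)); apply: (ps_leq Fp) (gj b); lia.
exists (k + \sum_b d b)%N => j jk g; apply: shift_fil_ind => [|g' h|b x].
- exact: subm0 (ideal_mul_subm _ _).
- exact: submD (ideal_mul_subm _ _).
have dbk : (d b <= \sum_b d b)%N by rewrite (bigD1 b) //= leq_addr.
rewrite subSn; last by lia.
move=> /kP xM; have {}xM := xM (_ : (k <= j - d b)%N).
apply: (xM _ (fun x => ideal_mul m (shift_fil j) (tens (basis_vec R b) x))).
- by lia.
- split=> [|a y z yP zP]; first by rewrite linear0; apply: subm0 (ideal_mul_subm _ _).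
  by rewrite linearP; apply: (submP _ (ideal_mul_subm _ _)).
move=> a y am Fy; rewrite linearZ; apply: mem_ideal_mul => //; exact: shift_fil_tens.
Qed.

Lemma class_map_shift : class_map shift_fil (shift_comp gL d) shift_class.
Proof.
have Fp := cm_stab sF; have Fs := stable_fil_subm Fp.
have gLP := cm_gmod sF.
split=> [||j x y xj yj|j x xj|j x xj|j t /shift_compP tj|i j a x ai xj].
- exact: shift_stable_fil.
- exact: gmod_shift.
- apply: co_eq => b; rewrite covalD !shift_classE covalD.
  by case: ifP => _; rewrite ?addr0 // (cm_D sF).
- split=> [x0 b|x0].
    have : coval (shift_class j x) b = 0 by rewrite x0.
    rewrite shift_classE.
    case: (leqP (d b) j) => [bj /(cm_0 sF (xj b))|jb _]; first by rewrite subSn.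
    by apply: (ps_leq Fp) (xj b); lia.
  apply: co_eq => b; rewrite shift_classE coval0; case: ifP => // bj.
  by apply/(cm_0 sF (xj b)); rewrite -subSn.
- apply/shift_compP => b; rewrite shift_classE; case: (leqP (d b) j) => bj //;
  exact: (cm_in sF (xj b)).
- have /choice[x xP] b : exists x, F (j - d b)%N x /\
      coval t b = if (d b <= j)%N then cl (j - d b)%N x else 0.
    have := tj b; case: ifP => [bj /(cm_surj sF)[x Fx ->]|bj /eqP ->]; first by exists x.
    by exists 0; split=> //; apply: subm0 (Fs _).
  exists (mkco x) => [b|]; first by have [] := xP b.
  by apply: co_eq => b; rewrite shift_classE /=; have [] := xP b.
apply: co_eq => b; rewrite covalZ !shift_classE covalZ.
case: (leqP (d b) j) => [bj|jb].
  by rewrite (leq_trans bj (leq_addl _ _)) (cm_act sF) // addnBA.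
rewrite scaler0; case: ifP => // bij; apply/esym/(cm_0 sF).
  apply: (ps_leq Fp) (ps_pow Fp ai (xj b)); lia.
apply: (ps_leq Fp) (ps_pow Fp ai (xj b)); lia.
Qed.
End ShiftSymb.
End ClassMap.

(** * Associated graded maps and resolutions *)

Section SymbMaps.
Variables (R : comPzRingType) (m : {pred R}).
Local Notation G := (gr_ring m).

Section FSum.
Variables (V : lmodType R) (F : nat -> V -> Prop) (L : lmodType G).
Variables (gL : nat -> {pred L}) (cl : nat -> V -> L).
Hypothesis sF : class_map F gL cl.
Variables (V' : lmodType R) (F' : nat -> V' -> Prop) (L' : lmodType G).
Variables (gL' : nat -> {pred L'}) (cl' : nat -> V' -> L').
Hypothesis sF' : class_map F' gL' cl'.
Variables (n : nat) (d : 'I_n -> nat).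
Variables (phi : 'I_n -> {linear V -> V'}) (phi' : 'I_n -> {linear L -> L'}).
Hypothesis phiF : forall b j x, F j x -> F' (j + d b)%N (phi b x).
Hypothesis phiE : forall b j x, F j x -> phi' b (cl j x) = cl' (j + d b)%N (phi b x).

Lemma shift_fil_fsum j g : shift_fil F d j g -> F' j (fsum phi g).
Proof.
have Fs' := stable_fil_subm (cm_stab sF').
apply: (shift_fil_ind (P := fun g => F' j (fsum phi g))) => [|g' h|b x xj].
- by rewrite linear0; apply: subm0 (Fs' _).
- by rewrite linearD; apply: submD (Fs' _).
rewrite fsum_tens; apply: (ps_leq (cm_stab sF')) (phiF b xj); lia.
Qed.

(** The associated graded map of a filtered map out of a direct sum has the
associated graded maps of its components.  In the summand b and a degree j below
d b the left-hand side is 0; so is the right-hand side, as phi b then takes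
values in F' j.+1. *)
Lemma shift_class_fsum j g : shift_fil F d j g -> fsum phi' (shift_class cl d j g) =
  cl' j (fsum phi g).
Proof.
have Fp' := cm_stab sF'; have Fs := shift_fil_subm sF d j.
move=> gj; suff [] : shift_fil F d j g /\ fsum phi' (shift_class cl d j g) =
  cl' j (fsum phi g) by [].
have sy := class_map_shift sF d.
move: g gj; apply: (shift_fil_ind (P := fun g => shift_fil F d j g /\
    fsum phi' (shift_class cl d j g) =
      cl' j (fsum phi g))) => [|g h [gj gE] [hj hE]|b x xj].
- split; first exact: (subm0 Fs).
  by rewrite (cm_00 sy) !linear0 (cm_00 sF').
- split; first exact: (submD Fs gj hj).
  rewrite (cm_D sy) // !linearD /= gE hE (cm_D sF') //; exact: shift_fil_fsum.
split; first exact: (shift_fil_tens sF).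
have -> : shift_class cl d j (tens (basis_vec R b) x) =
    if (d b <= j)%N then tens (basis_vec G b) (cl (j - d b)%N x) else 0.
  apply: co_eq => c; rewrite shift_classE tensE basis_vecE.
  have [->|cb] := eqVneq c b.
    case: ifP => bj; last by rewrite coval0.
    by rewrite scale1r tensE basis_vecE eqxx scale1r.
  rewrite scale0r (cm_00 sF) if_same; case: ifP => bj; last by rewrite coval0.
  by rewrite tensE basis_vecE (negbTE cb) scale0r.
rewrite fsum_tens; case: (leqP (d b) j) => [bj|jb].
  by rewrite fsum_tens phiE // subnK.
rewrite linear0; apply/esym/(cm_0 sF').
  apply: (ps_leq Fp') (phiF b xj); lia.
apply: (ps_leq Fp') (phiF b xj); lia.
Qed.
End FSum.

Section TensSym.
Variables (V : lmodType R) (F : nat -> V -> Prop) (L : lmodType G).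
Variables (gL : nat -> {pred L}) (cl : nat -> V -> L).
Hypothesis sF : class_map F gL cl.
Variables (n n' : nat) (d : 'I_n -> nat) (d' : 'I_n' -> nat).
Local Notation mF := (fun j (x : R^o) => x \in ideal_power m j).
Local Notation mcl := (gr_class (adic m) : nat -> R^o -> G^o).
Variable (f : copower 'I_n R^o -> copower 'I_n' R^o).
Variable (f' : copower 'I_n G^o -> copower 'I_n' G^o).
Hypothesis fF : forall b, shift_fil mF d' (d b) (f (basis_vec R b)).
Hypothesis fE : forall b, f' (basis_vec G b) = shift_class mcl d' (d b) (f (basis_vec R b)).

Let phiF b j x : F j x -> shift_fil F d' (j + d b)%N (tens (f (basis_vec R b)) x).
Proof.
move=> xj c; rewrite tensE.
apply: (ps_leq (cm_stab sF)) (ps_pow (cm_stab sF) (fF b c) xj); lia.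
Qed.

Let phiE b j x : F j x -> tens (f' (basis_vec G b)) (cl j x) =
  shift_class cl d' (j + d b)%N (tens (f (basis_vec R b)) x).
Proof.
have Fp := cm_stab sF.
move=> xj; apply: co_eq => c; rewrite fE !tensE !shift_classE.
have fp := ps_pow Fp (fF b c) xj.
case: (leqP (d' c) (d b)) => [cb|bc].
  rewrite (leq_trans cb (leq_addl _ _)) (cm_act sF) //; last exact: fF.
  by rewrite addnC addnBA.
rewrite scale0r; case: ifP => // cbj; apply/esym/(cm_0 sF).
  apply: (ps_leq Fp) fp; lia.
apply: (ps_leq Fp) fp; lia.
Qed.

Lemma shift_fil_tens_map j g : shift_fil F d j g -> shift_fil F d' j (tens_map f g).
Proof.
move=> gj.
exact: (shift_fil_fsum (class_map_shift sF d') phiF gj).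
Qed.

Lemma shift_class_tens_map j g : shift_fil F d j g ->
  tens_map f' (shift_class cl d j g) = shift_class cl d' j (tens_map f g).
Proof.
move=> gj.
exact: (shift_class_fsum sF (class_map_shift sF d') phiF phiE gj).
Qed.
End TensSym.

Section LinSym.
Variables (V' : lmodType R) (F' : nat -> V' -> Prop) (L' : lmodType G).
Variables (gL' : nat -> {pred L'}) (cl' : nat -> V' -> L').
Hypothesis sF' : class_map F' gL' cl'.
Variables (n : nat) (d : 'I_n -> nat).
Local Notation mF := (fun j (x : R^o) => x \in ideal_power m j).
Local Notation mcl := (gr_class (adic m) : nat -> R^o -> G^o).
Variable (f : {linear copower 'I_n R^o -> V'}).
Variable (f' : {linear copower 'I_n G^o -> L'}).
Hypothesis fF : forall b, F' (d b) (f (basis_vec R b)).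
Hypothesis fE : forall b, f' (basis_vec G b) = cl' (d b) (f (basis_vec R b)).

Lemma shift_class_lin j g : shift_fil mF d j g -> f' (shift_class mcl d j g) = cl' j (f g).
Proof.
have EA (A : comPzRingType) (W : lmodType A) (B : choiceType) (h :
  {linear copower B A^o -> W}) :
    h =1 fsum (fun b => scal (h (basis_vec A b))).
  apply: (lin_eq (g := fsum (fun b => scal (h (basis_vec A b))))) => b.
  by apply: esym; exact: (lin_ext_basis (fun b => h (basis_vec A b)) b).
rewrite (EA G _ _ f') (EA R _ _ f).
apply: (shift_class_fsum (class_map_adic m) sF') => b i x xi /=.
  exact: (ps_pow (cm_stab sF') xi (fF b)).
by rewrite fE /scal (cm_act sF').
Qed.
End LinSym.
End SymbMaps.

Section FilteredResolution.
Variables (R : comPzRingType) (m : {pred R}) (M : lmodType R) (FM : stable_filtration M m).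
Local Notation G := (gr_ring m).
Local Notation mF := (fun j (x : R^o) => x \in ideal_power m j).
Local Notation mcl := (gr_class (adic m) : nat -> R^o -> G^o).

(** The lifts in [fres_aug_surj], [fres_aug_ex] and [fres_dif_ex] stay in the same
step of the filtration: this is strictness. *)
Record filtered_resolution := FilteredRes {
  fres_rank : nat -> nat;
  fres_deg : forall i, 'I_(fres_rank i) -> nat;
  fres_dif : forall i, {linear copower 'I_(fres_rank i.+1) R^o ->
    copower 'I_(fres_rank i) R^o};
  fres_aug : {linear copower 'I_(fres_rank 0) R^o -> M};
  fres_dif_f : forall i j v, shift_fil mF (@fres_deg i.+1) j v ->
    shift_fil mF (@fres_deg i) j (fres_dif i v);
  fres_aug_f : forall j v, shift_fil mF (@fres_deg 0) j v -> fres_aug v \in FM j;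
  fres_aug_surj : forall j x, x \in FM j -> exists2 v,
    shift_fil mF (@fres_deg 0) j v & fres_aug v = x;
  fres_aug_dif : forall v, fres_aug (fres_dif 0 v) = 0;
  fres_dif_dif : forall i v, fres_dif i (fres_dif i.+1 v) = 0;
  fres_aug_ex : forall j v, shift_fil mF (@fres_deg 0) j v -> fres_aug v = 0 ->
    exists2 w, shift_fil mF (@fres_deg 1) j w & fres_dif 0 w = v;
  fres_dif_ex : forall i j v, shift_fil mF (@fres_deg i.+1) j v -> fres_dif i v = 0 ->
    exists2 w, shift_fil mF (@fres_deg i.+2) j w & fres_dif i.+1 w = v }.
Arguments fres_deg _ i _ : clear implicits.

Variable (Fr : filtered_resolution).

Lemma shift_fil_basis (n : nat) (d : 'I_n -> nat) b : shift_fil mF d (d b) (basis_vec R b).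
Proof.
rewrite basis_tens; apply: (shift_fil_tens (class_map_adic m)); by rewrite subnn.
Qed.

(** Multiplication by the matrix of the classes of the entries of [fres_dif]. *)
Definition grdif i : {linear copower 'I_(fres_rank Fr i.+1) G^o ->
  copower 'I_(fres_rank Fr i) G^o} :=
  lin_ext (fun b => shift_class mcl (fres_deg Fr i) (fres_deg Fr i.+1 b) (fres_dif Fr i
    (basis_vec R b))).
Definition graug : {linear copower 'I_(fres_rank Fr 0) G^o -> gr_mod FM} :=
  lin_ext (fun b => gr_class FM (fres_deg Fr 0 b) (fres_aug Fr (basis_vec R b)) :
    gr_mod FM).

Let fres_dif_b i b : shift_fil mF (fres_deg Fr i) (fres_deg Fr i.+1 b) (fres_dif Fr i
  (basis_vec R b)).
Proof. by apply: fres_dif_f; apply: shift_fil_basis. Qed.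

Lemma grdif_sym i j v : shift_fil mF (fres_deg Fr i.+1) j v ->
  grdif i (shift_class mcl (fres_deg Fr i.+1) j v) =
    shift_class mcl (fres_deg Fr i) j (fres_dif Fr i v).
Proof.
apply: (shift_class_lin (class_map_shift (class_map_adic m) (fres_deg Fr i))) => b;
  first exact: fres_dif_b.
exact: lin_ext_basis.
Qed.

Lemma graug_sym j v : shift_fil mF (fres_deg Fr 0) j v ->
  graug (shift_class mcl (fres_deg Fr 0) j v) = gr_class FM j (fres_aug Fr v).
Proof.
apply: (shift_class_lin (class_map_gr FM)) => b; first by apply: fres_aug_f;
  apply: shift_fil_basis.
exact: lin_ext_basis.
Qed.

Lemma grdif_tens (N : lmodType R) (F : nat -> N -> Prop) (L : lmodType G)
  (gL : nat -> {pred L}) (cl : nat -> N -> L) (sF : class_map F gL cl) i j g :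
  shift_fil F (fres_deg Fr i.+1) j g ->
  tens_map (grdif i) (shift_class cl (fres_deg Fr i.+1) j g) =
  shift_class cl (fres_deg Fr i) j (tens_map (fres_dif Fr i) g).
Proof.
apply: (shift_class_tens_map sF) => b; first exact: fres_dif_b.
exact: lin_ext_basis.
Qed.

Lemma filtered_resolution_dif_tens_fil (N : lmodType R) (F : nat -> N -> Prop) (L :
  lmodType G)
  (gL : nat -> {pred L}) (cl : nat -> N -> L) (sF : class_map F gL cl) i j g :
  shift_fil F (fres_deg Fr i.+1) j g ->
    shift_fil F (fres_deg Fr i) j (tens_map (fres_dif Fr i) g).
Proof. by apply: (shift_fil_tens_map sF) => b; exact: fres_dif_b. Qed.

Let sy i := class_map_shift (class_map_adic m) (fres_deg Fr i).
Let syM := class_map_gr FM.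
Let pst i := shift_stable_fil (class_map_adic m) (fres_deg Fr i).
Local Notation shG i := (shift_comp (gr_ring_comp m : nat -> {pred G^o}) (fres_deg Fr i)).

Lemma grdif_gr i j v : v \in shG i.+1 j -> grdif i v \in shG i j.
Proof.
move=> /(cm_surj (sy i.+1))[w wj ->].
by rewrite grdif_sym //; apply: (cm_in (sy i)); apply: fres_dif_f.
Qed.

Lemma graug_surj j x : x \in gr_mod_comp FM j ->
  exists2 v, v \in shG 0%N j & graug v = x.
Proof.
move=> /(cm_surj syM)[y yj ->].
have [v vj <-] := fres_aug_surj Fr yj.
exists (shift_class mcl (fres_deg Fr 0) j v); first exact: (cm_in (sy 0%N)).
exact: graug_sym.
Qed.

Lemma graug_gr j v : v \in shG 0%N j -> graug v \in gr_mod_comp FM j.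
Proof.
move=> /(cm_surj (sy 0%N))[w wj ->].
rewrite graug_sym //; apply: (cm_in syM); exact: fres_aug_f.
Qed.

Lemma graug_dif v : graug (grdif 0 v) = 0.
Proof.
apply: (lin_eq (f := graug \o grdif 0) (g := \0)) => b /=.
rewrite lin_ext_basis graug_sym; last exact: fres_dif_b.
by rewrite fres_aug_dif; exact: gr_class0.
Qed.

Lemma grdif_dif i v : grdif i (grdif i.+1 v) = 0.
Proof.
apply: (lin_eq (f := grdif i \o grdif i.+1) (g := \0)) => b /=.
rewrite lin_ext_basis grdif_sym; last exact: fres_dif_b.
by rewrite fres_dif_dif (cm_00 (sy i)).
Qed.

(** A cycle of the associated graded complex is the class of some w whose image
lies in the next step of the filtration.  By strictness this image is also that
of some u in the next step, so w - u is a cycle with the class of w, and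
strictness lifts it. *)
Lemma graug_ex j v : v \in shG 0%N j -> graug v = 0 ->
  exists2 w, w \in shG 1%N j & grdif 0 w = v.
Proof.
move=> /(cm_surj (sy 0%N))[w wj ->]; rewrite graug_sym // => /(cm_0 syM).
move=> /(_ (fres_aug_f wj))/(fres_aug_surj Fr)[u uj uE].
have uj' : shift_fil mF (fres_deg Fr 0) j u by exact: (ps_desc (pst 0%N) uj).
have wuj := submB (shift_fil_subm (class_map_adic m) (fres_deg Fr 0) j) wj uj'.
have [|z zj zE] := @fres_aug_ex Fr j _ wuj; first by rewrite linearB uE subrr.
exists (shift_class mcl (fres_deg Fr 1) j z); first exact: (cm_in (sy 1%N)).
rewrite grdif_sym // zE -{2}(subrK u w) (cm_D (sy 0%N) wuj uj').
by have /(cm_0 (sy 0%N) uj') -> := uj; rewrite addr0.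
Qed.

(** As for [graug_ex], one step further. *)
Lemma grdif_ex i j v : v \in shG i.+1 j -> grdif i v = 0 ->
  exists2 w, w \in shG i.+2 j & grdif i.+1 w = v.
Proof.
move=> /(cm_surj (sy i.+1))[w wj ->]; rewrite grdif_sym // => /(cm_0 (sy i)).
move=> /(_ (fres_dif_f wj)) dw.
have [u uj uE] : exists2 u, shift_fil mF (fres_deg Fr i.+1) j.+1 u & fres_dif Fr i u =
  fres_dif Fr i w.
  case: i v w wj dw => [|i] v w wj dw.
    by apply: (fres_aug_ex dw); rewrite fres_aug_dif.
  by apply: (fres_dif_ex dw); rewrite fres_dif_dif.
have uj' : shift_fil mF (fres_deg Fr i.+1) j u by exact: (ps_desc (pst i.+1) uj).
have wuj := submB (shift_fil_subm (class_map_adic m) (fres_deg Fr i.+1) j) wj uj'.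
have [|z zj zE] := @fres_dif_ex Fr i j _ wuj; first by rewrite linearB uE subrr.
exists (shift_class mcl (fres_deg Fr i.+2) j z); first exact: (cm_in (sy i.+2)).
rewrite grdif_sym // zE -{2}(subrK u w) (cm_D (sy i.+1) wuj uj').
by have /(cm_0 (sy i.+1) uj') -> := uj; rewrite addr0.
Qed.

Definition gr_resolution : homog_resolution (gr_ring_comp m) (gr_mod_comp FM) :=
  HomogRes grdif_gr graug_surj graug_gr graug_dif grdif_dif graug_ex grdif_ex.
End FilteredResolution.

(** * Existence of strict filtered resolutions *)

Lemma choice_dep (I : Type) (T : I -> Type) (P : forall i, T i -> Prop) :
  (forall i, exists t, P i t) -> exists f : forall i, T i, forall i, P i (f i).
Proof. by move=> H; exists (fun i => sval (cid (H i))) => i;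
  exact: (svalP (cid (H i))). Qed.

Section Existence.
Variables (R : comNzRingType) (m : {pred R}).
Hypotheses (Rnoeth : noetherian R) (mi : subm (fun a : R^o => a \in m)).
Local Notation mF := (fun j (x : R^o) => x \in ideal_power m j).

Lemma noeth_sub (V : lmodType R) (U U' : V -> Prop) :
  (forall x, U x -> U' x) -> noeth U' -> noeth U.
Proof. by move=> UU' Un W Ws WU; apply: Un => // x /WU/UU'. Qed.

Lemma fg_copower (V : lmodType R) n : (exists s : seq V, forall x, gen s x) ->
  exists s : seq (copower 'I_n V), forall x, gen s x.
Proof.
move=> [s sP]; exists [seq tens (basis_vec R b) y | b <- enum 'I_n, y <- s] => x.
rewrite (co_ord x); apply: (subm_sum _ (gen_subm _)) => b _.
apply: (sP (coval x b) (fun y => gen _ (tens (basis_vec R b) y))).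
  split=> [|a y z gy gz]; first by rewrite linear0; apply: subm0 (gen_subm _).
  rewrite linearP; exact: (submP _ (gen_subm _)).
move=> y ys; apply: mem_gen; apply/allpairsP; exists (b, y).
by rewrite mem_enum.
Qed.

Lemma noeth_copower (V : lmodType R) n : (exists s : seq V, forall x, gen s x) ->
  forall U : copower 'I_n V -> Prop, noeth U.
Proof.
move=> /(@fg_copower _ n)[s sP] U; apply: (noeth_sub _ (noeth_gen (g := s) Rnoeth)).
by move=> x _; apply: sP.
Qed.

Lemma fg_ring : exists s : seq R^o, forall x, gen s x.
Proof.
exists [:: 1] => x; rewrite -[x]mulr1.
by apply: (submZ (V := R^o) x (gen_subm _)); apply: mem_gen; rewrite mem_head.
Qed.

(** Generators of F 0, ..., F k, each with its degree, where F j.+1 is m F j for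
j >= k: the last property propagates surjectivity to all degrees. *)
Lemma filtered_cover (V : lmodType R) (F : nat -> V -> Prop) :
  stable_fil m F -> noeth (F 0%N) ->
  exists n (d : 'I_n -> nat) (f : {linear copower 'I_n R^o -> V}),
    (forall j v, shift_fil mF d j v -> F j (f v)) /\
    forall j x, F j x -> exists2 v, shift_fil mF d j v & f v = x.
Proof.
move=> Fp Fn; have Fs := stable_fil_subm Fp; have [k kP] := ps_stab Fp.
have [gs gF gP] : exists2 gs : seq (nat * V), (forall p, p \in gs -> F p.1 p.2) &
    forall j, (j <= k)%N -> forall x, F j x -> gen [seq p.2 | p <- gs & p.1 == j] x.
  elim: {kP} k => [|k [gs gF gP]].
    have [||s sP] := Fn (F 0%N) => //.
    exists [seq (0%N, x) | x <- s] => [p /mapP[x xs ->]|j]; first by apply/sP;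
      apply: mem_gen.
    rewrite leqn0 => /eqP -> x /sP gx W Ws gW; apply: gx => // y ys; apply: gW.
    by apply/mapP; exists (0%N, y) => //; rewrite mem_filter eqxx map_f.
  have [||s sP] := Fn (F k.+1) => //; first by move=> x; apply: (ps_leq Fp).
  exists ([seq (k.+1, x) | x <- s] ++ gs) => [p|j].
    rewrite mem_cat => /orP[/mapP[x xs ->]|/gF//]; by apply/sP; apply: mem_gen.
  rewrite leq_eqVlt => /orP[/eqP ->|jk] x.
    move=> /sP gx W Ws gW; apply: gx => // y ys; apply: gW.
    apply/mapP; exists (k.+1, y) => //.
    by rewrite mem_filter eqxx mem_cat map_f.
  move=> /(gP j jk) gx W Ws gW; apply: gx => // y /mapP[p].
  rewrite mem_filter => /andP[pj pg] ->; apply: gW; apply: map_f.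
  by rewrite mem_filter pj mem_cat pg orbT.
pose d (b : 'I_(size gs)) := (nth (0%N, 0) gs b).1.
pose y (b : 'I_(size gs)) : V := (nth (0%N, 0) gs b).2.
have yF b : F (d b) (y b) by apply: gF; apply: mem_nth.
exists (size gs), d, (lin_ext y); split=> [j|].
  apply: (shift_fil_ind (P := fun v => F j (lin_ext y v))) => [|g h|b a aj].
  - by rewrite linear0; apply: subm0 (Fs _).
  - by rewrite linearD; apply: submD (Fs _).
  rewrite tens1 linearZ lin_ext_basis.
  apply: (ps_leq Fp) (ps_pow Fp aj (yF b)); lia.
have sp := shift_stable_fil (class_map_adic m) d.
have Ps j : subm (fun x => exists2 v, shift_fil mF d j v & lin_ext y v = x).
  split=> [|a x z [v vj <-] [w wj <-]].
    by exists 0; [exact: (subm0 (stable_fil_subm sp j))|rewrite linear0].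
  by exists (a *: v + w); [exact: (submP _ (stable_fil_subm sp j))|rewrite linearP].
elim=> [|j IH] x Fx.
  apply: (gP 0%N _ x Fx _ (Ps 0%N)) => // z /mapP[p]; rewrite mem_filter => /andP[_ pg] ->.
  have pi := pg; rewrite -index_mem in pi; exists (basis_vec R (Ordinal pi)) => //.
  by rewrite lin_ext_basis /y /= nth_index.
have [jk|kj] := leqP j.+1 k.
  apply: (gP j.+1 jk x Fx _ (Ps j.+1)) => // z /mapP[p];
    rewrite mem_filter => /andP[/eqP pj pg] ->.
  have pi := pg; rewrite -index_mem in pi; exists (basis_vec R (Ordinal pi)) => //.
    by have := shift_fil_basis m d (Ordinal pi); rewrite {2}/d /= nth_index // pj.
  by rewrite lin_ext_basis /y /= nth_index.
apply: (kP j kj x Fx _ (Ps j.+1)) => a z am /IH[v vj <-].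
exists (a *: v); first exact: (ps_mul sp).
exact: linearZ.
Qed.

(** The last free module built and the kernel that the next one has to cover; the
differentials are recovered from the relation between successive states. *)
Record cover_state := CoverState {
  cn : nat; cdeg : 'I_cn -> nat; cker : copower 'I_cn R^o -> Prop }.

(** The kernel of a strict cover, with the filtration induced by the free module,
is stable by Artin-Rees, so it has a strict cover again. *)
Lemma filtered_resolution_exists (M : lmodType R) (FM : stable_filtration M m) :
  (exists s : seq M, forall x, gen s x) -> inhabited (filtered_resolution FM).
Proof.
move=> [s sP].
have [||n0 [d0 [f0 [f0F f0S]]]] := @filtered_cover M (fun j x => x \in FM j).
- exact: stable_fil_of.
- apply: (noeth_sub _ (noeth_gen (g := s) Rnoeth)) => x _; exact: sP.
pose P (i : nat) (c : cover_state) := subm (cker (c := c)).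
pose cfil (c : cover_state) := shift_fil mF (@cdeg c).
pose Q (i : nat) (c c' : cover_state) :=
  exists f : {linear copower 'I_(cn c') R^o -> copower 'I_(cn c) R^o},
  [/\ forall j v, cfil c' j v -> cker (f v) /\ cfil c j (f v),
      forall j x, cker x -> cfil c j x -> exists2 v, cfil c' j v & f v = x &
      forall v, cker (c := c') v <-> f v = 0].
have kers (V W : lmodType R) (f : {linear V -> W}) : subm (fun v => f v = 0).
  by split=> [|a x y x0 y0]; rewrite ?linear0 // linearP x0 y0 scaler0 addr0.
have [||c [c0 cP]] := @dep_choice (fun=> cover_state) P Q
    (@CoverState n0 d0 (fun v => f0 v = 0)).
- exact: kers.
- move=> i [n d K] Ks.
  have [||n' [d' [f [fF fS]]]] := @filtered_cover (copower 'I_n R^o)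
    (fun j x => K x /\ shift_fil mF d j x).
  + apply: (artin_rees Rnoeth mi) => //;
    first exact: (shift_stable_fil (class_map_adic m) d).
    exact: (noeth_copower fg_ring).
  + exact: (noeth_copower fg_ring).
  exists (@CoverState n' d' (fun v => f v = 0)); split; last exact: kers.
  exists f; split=> // j x Kx xj; exact: fS.
have [f fP] := choice_dep (fun i => (cP i).2).
have all0 (n : nat) (d : 'I_n -> nat) (v : copower 'I_n R^o) : shift_fil mF d 0 v.
  by move=> b; rewrite sub0n.
have kerS i v : cker (c := c i.+1) v <-> f i v = 0 by have [] := fP i.
have imK i v : cker (f i v).
  by have [/(_ 0%N v (all0 _ _ _))[]] := fP i.
have aug : exists g : {linear copower 'I_(cn (c 0%N)) R^o -> M},
  [/\ forall j v, cfil (c 0%N) j v -> g v \in FM j,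
    forall j x, x \in FM j -> exists2 v, cfil (c 0%N) j v & g v = x &
    forall v, cker (c := c 0%N) v <-> g v = 0].
  by rewrite c0; exists f0.
have [g [gF gS gK]] := aug.
have cS i j v : cfil (c i) j v -> cker v -> exists2 w, cfil (c i.+1) j w & f i w = v.
  by move=> vj vK; have [_ fS _] := fP i; apply: fS.
constructor; refine (@FilteredRes _ _ _ _ (fun i => cn (c i)) (fun i => @cdeg (c i)) f
  g _ _ _ _ _ _ _).
- by move=> i j v vj; have [fF _ _] := fP i; have [] := fF j v vj.
- exact: gF.
- exact: gS.
- by move=> v; apply/gK.
- by move=> i v; apply/kerS.
- by move=> j v vj /gK; apply: cS.
by move=> i j v vj /kerS; apply: cS.
Qed.
End Existence.

(** * Resolutions as homogeneous resolutions *)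

Section GradedFree.
Variables (A : comPzRingType) (gA : nat -> {pred A}) (M : lmodType A) (gM : nat ->
  {pred M}).
Hypothesis gAP : gmod gA (gA : nat -> {pred A^o}).
Hypotheses (gAd : gdec (gA : nat -> {pred A^o})) (gMd : gdec gM).

Variable Q : graded_free_resolution gA gM.
Local Notation shQ i := (shift_comp (gA : nat -> {pred A^o}) (deg (g := Q) (i := i))).

Let shP i := gmod_shift (deg (g := Q) (i := i)) gAP.
Let shd i := gdec_shift (deg (g := Q) (i := i)) gAP gAd.

Lemma graded_aug_surj j x : x \in gM j -> exists2 v, v \in shQ 0%N j & aug Q v = x.
Proof.
move=> xj; have [v vE] := aug_surj Q x.
have := gdec_lift (shP 0%N) (shd 0%N) gMd (linearD (aug Q)) (@aug_deg _ _ _ _ Q) (j :=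
  j) (x := v).
by rewrite vE; apply.
Qed.

Lemma graded_aug_dif v : aug Q (dif Q 0 v) = 0.
Proof. by apply/aug_exact; exists v. Qed.

Lemma graded_dif_dif i v : dif Q i (dif Q i.+1 v) = 0.
Proof. by apply/dif_exact; exists v. Qed.

Lemma graded_dif_lift i j v : v \in shQ i j -> (exists w, dif Q i w = v) ->
  exists2 w, w \in shQ i.+1 j & dif Q i w = v.
Proof.
move=> vj [w wE].
have := gdec_lift (shP i.+1) (shd i.+1) (shd i) (linearD (dif Q i))
  (@dif_deg _ _ _ _ Q i) (j := j) (x := w).
by rewrite wE; apply.
Qed.

Lemma graded_aug_ex j v : v \in shQ 0%N j -> aug Q v = 0 ->
  exists2 w, w \in shQ 1%N j & dif Q 0 w = v.
Proof. by move=> vj /aug_exact; apply: graded_dif_lift. Qed.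

Lemma graded_dif_ex i j v : v \in shQ i.+1 j -> dif Q i v = 0 ->
  exists2 w, w \in shQ i.+2 j & dif Q i.+1 w = v.
Proof. by move=> vj /dif_exact; apply: graded_dif_lift. Qed.

Definition graded_homog_resolution : homog_resolution gA gM :=
  HomogRes (@dif_deg _ _ _ _ Q) graded_aug_surj (@aug_deg _ _ _ _ Q)
    graded_aug_dif graded_dif_dif graded_aug_ex graded_dif_ex.
End GradedFree.

Section Trivial.
Variables (A : comPzRingType).

(** Everything in degree 0: resolutions without grading are the special case of
this grading. *)
Definition triv_gr (X : zmodType) : nat -> {pred X} :=
  fun j => if j is 0 then predT else pred1 0.

Arguments triv_gr X j _ : clear implicits.

Lemma triv_gmod (N : lmodType A) : gmod (triv_gr A) (triv_gr N).
Proof.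
split=> [[|j]|[|j] x y|[|i] [|j] a x] //=; rewrite ?inE //.
- by move=> /eqP -> /eqP ->; rewrite subrr.
- by move=> _ /eqP ->; rewrite scaler0.
- by move=> /eqP ->; rewrite scale0r.
by move=> /eqP ->; rewrite scale0r.
Qed.

Lemma triv_shift (N : lmodType A) (B : choiceType) j (v : copower B N) :
  v \in shift_comp (triv_gr N) (fun=> 0%N) j <-> v \in triv_gr (copower B N) j.
Proof.
split=> [/shift_compP vj|vj].
  case: j vj => [//|j] vj; apply/eqP/co_eq => b.
  by have := vj b; rewrite leq0n subn0 => /eqP.
apply/shift_compP => b; rewrite leq0n subn0.
by case: j vj => [//|j] /eqP ->; rewrite inE.
Qed.

Variables (M : lmodType A).

Definition free_homog_resolution (P : free_resolution M) :
  homog_resolution (triv_gr A) (triv_gr M).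
Proof.
refine (@HomogRes _ _ _ _ (basis P) (fun _ _ => 0%N) (dif P) (aug P) _ _ _ _ _ _ _).
- move=> i [|j] v /triv_shift vj; apply/triv_shift => //.
  by rewrite (eqP vj) linear0 inE.
- move=> [|j] x; first by have [v vE] := aug_surj P x; exists v => //; apply/triv_shift.
  by move=> /eqP ->; exists 0; rewrite ?linear0 //; apply/triv_shift; rewrite inE.
- move=> [|j] v /triv_shift vj //.
  by rewrite (eqP vj) linear0 inE.
- by move=> v; apply/aug_exact; exists v.
- by move=> i v; apply/dif_exact; exists v.
- move=> [|j] v /triv_shift vj.
    by move=> /aug_exact[w wE]; exists w => //; apply/triv_shift.
  by move=> _; exists 0; rewrite ?linear0 ?(eqP vj) //; apply/triv_shift; rewrite inE.
- move=> i [|j] v /triv_shift vj.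
    by move=> /dif_exact[w wE]; exists w => //; apply/triv_shift.
  by move=> _; exists 0; rewrite ?linear0 ?(eqP vj) //; apply/triv_shift; rewrite inE.
Defined.
End Trivial.

Section FresFree.
Variables (R : comPzRingType) (m : {pred R}) (M : lmodType R) (FM : stable_filtration M m).
Variable (Fr : filtered_resolution FM).

Let all0 i (v : copower 'I_(fres_rank Fr i) R^o) :
  shift_fil (fun j (x : R^o) => x \in ideal_power m j) (@fres_deg _ _ _ _ Fr i) 0 v.
Proof. by move=> b; rewrite sub0n. Qed.

Definition filtered_resolution_free : free_resolution M.
Proof.
refine (@FreeResolution _ _ (fun i => 'I_(fres_rank Fr i)) (fres_dif Fr) (fres_aug Fr)
  _ _ _).
- by move=> x; have [v _ <-] := fres_aug_surj Fr (fil0 FM x); exists v.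
- move=> v; split=> [|[w <-]]; last exact: fres_aug_dif.
  by move=> /(fres_aug_ex (all0 v))[w _ <-]; exists w.
move=> i v; split=> [|[w <-]]; last exact: fres_dif_dif.
by move=> /(fres_dif_ex (all0 v))[w _ <-]; exists w.
Defined.
End FresFree.

(** * The two Tor modules *)

Section LocalRing.
Variables (R : comNzRingType) (m : {pred R}).
Hypothesis ml : local_ring m.

Lemma local_subm : subm (fun a : R^o => a \in m).
Proof.
have [[[m0 _ mP] _] _] := ml; split=> // a x y xm ym; exact: mP.
Qed.

Lemma local_proper : 1 \notin m.
Proof. by have [[[_ m1 _] _] _] := ml. Qed.

Lemma local_inv a : a \notin m -> exists b, 1 - b * a \in m.
Proof.
have [[[m0 m1 mP] mmax] _] := ml.
(* J is the ideal m + R a; it would equal m if it were proper. *)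
move=> am; pose J : {pred R} := fun x => `[< exists b, x - b * a \in m >].
have [/asboolP//|J1] := boolP (1 \in J).
have Jc : idealr_closed J.
  split=> [||c x y /asboolP[b bm] /asboolP[d dm]]; last 1 first.
  - apply/asboolP; exists (c * b + d).
    by rewrite mulrDl opprD addrACA -mulrA -mulrBr; apply: mP.
  - by apply/asboolP; exists 0; rewrite mul0r subr0.
  - exact: J1.
have mJ : {subset m <= J} by move=> x xm; apply/asboolP; exists 0; rewrite mul0r subr0.
case/negP: am; rewrite -(mmax J Jc mJ); apply/asboolP; exists 1.
by rewrite mul1r subrr.
Qed.
End LocalRing.

Lemma gr_one_comp (R : comPzRingType) (m : {pred R}) : 1 \in gr_ring_comp m 0.
Proof.
have -> : (1 : gr_ring m) = gr_class (adic m) 0 1.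
  congr gr_proj; apply: val_inj; apply/funext => k /=.
  by rewrite /conv1 /delta; case: eqP.
exact: gr_class_comp.
Qed.

Lemma gr_ring_gmod (R : comPzRingType) (m : {pred R}) :
  gmod (gr_ring_comp m) (gr_ring_comp m : nat -> {pred (gr_ring m)^o}).
Proof. exact: (cm_gmod (class_map_adic m)). Qed.

Lemma gr_ring_gdec (R : comPzRingType) (m : {pred R}) :
  gdec (gr_ring_comp m : nat -> {pred (gr_ring m)^o}).
Proof. exact: (gr_gdec (adic m)). Qed.

Lemma gr_mod_gdec (R : comPzRingType) (m : {pred R}) (M : lmodType R)
  (F : stable_filtration M m) : gdec (gr_mod_comp F).
Proof. exact: (gr_gdec F). Qed.

Section Kappa.
Variables (R : comPzRingType) (m : {pred R}).
Definition residue (a : R) : gr_ring m := gr_class (adic m) 0 a.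

Lemma residue_in a : residue a \in residue_field m.
Proof. exact: (gr_class_comp (adic m)). Qed.

Lemma residue_surj c : c \in residue_field m -> exists a, c = residue a.
Proof. by move=> /comp_gr_class[a _ ->]; exists a. Qed.

Lemma residue_eq a b : a - b \in m -> residue a = residue b.
Proof.
move=> abm; apply/eqP; rewrite -subr_eq0; apply/eqP.
have E : residue (a - b) = residue a - residue b.
  apply/eqP; rewrite eq_sym subr_eq; apply/eqP.
  by rewrite -[LHS]/(gr_class (adic m) 0 a) -{1}(subrK b a); apply: (gr_classD (F :=
    adic m)).
rewrite -E; apply/(gr_class_eq0 (F := adic m)) => //.
apply/ideal_mul_idealM; rewrite -[a - b]mulr1.
exact: (mem_ideal_mul (V := R^o)).
Qed.
End Kappa.

Section TorClass.
Variables (A : comPzRingType) (M : lmodType A) (P : free_resolution M) (N : lmodType A).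

(** Total version of [tor_class], meaningful on cycles only. *)
Definition tor_of i (z : copower (basis P i) N) : Tor P N i :=
  tor_class (insubd (0 : submod (Defs.cycle P N i)) z).

Definition tor_cycle i (z : copower (basis P i) N) : Prop := tens_cycle (dif P) z.

Lemma cycleP i z : (z \in Defs.cycle P N i) <-> @tor_cycle i z.
Proof. by case: i z => [//|i] z; split=> [/eqP|zc]; last by apply/eqP. Qed.

Lemma tor_of_val i z : @tor_cycle i z -> submod_val (insubd (0 :
  submod (Defs.cycle P N i)) z) = z.
Proof. by move=> /cycleP zc; exact: (insubdK (0 : submod (Defs.cycle P N i)) zc). Qed.

Lemma tor_of_class i (z : submod (Defs.cycle P N i)) : tor_class z = tor_of (submod_val z).
Proof.
congr tor_class; apply: val_inj.
by rewrite -[RHS]/(submod_val _) tor_of_val //; apply/cycleP; exact: submod_valP.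
Qed.

Lemma tor_cycle_subm i : subm (@tor_cycle i).
Proof.
case: i => [|i]; first by split.
split=> [|a x y] /=; first by rewrite /tor_cycle /= linear0.
by rewrite /tor_cycle /= => x0 y0; rewrite linearP /= x0 y0 scaler0 addr0.
Qed.

Lemma tor_of_linear i a x y : @tor_cycle i x -> tor_cycle y -> tor_of (a *: x + y) =
  a *: tor_of x + tor_of y.
Proof.
move=> xc yc; rewrite /tor_of /tor_class -linearP; congr lproj; apply: val_inj.
rewrite -[RHS]/(a *: submod_val _ + submod_val _) -[LHS]/(submod_val _).
by rewrite !tor_of_val //; apply: (submP _ (tor_cycle_subm _)).
Qed.

Lemma tor_of_sub i x y : @tor_cycle i x -> tor_cycle y -> tor_of (x - y) =
  tor_of x - tor_of y.
Proof.
by move=> xc yc; have := tor_of_linear (-1) yc xc; rewrite !scaleN1r addrC [in RHS]addrC.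
Qed.

Lemma tor_of_eq0 i z : @tor_cycle i z -> tor_of z = 0 <-> exists w,
  tens_map (dif P i) w = z.
Proof.
move=> zc; have -> : (0 : Tor P N i) = tor_class 0 by rewrite /tor_class linear0.
rewrite /tor_of /tor_class lproj_eq subr0; split=> [/asboolP[w wE]|[w wE]].
  by exists w; rewrite -[LHS]/(tor_dif w) wE tor_of_val.
by apply/asboolP; exists w; rewrite tor_of_val.
Qed.

Lemma tor_of_surj i t : exists2 z, @tor_cycle i z & t = tor_of z.
Proof.
exists (submod_val (lrepr t)); first by apply/cycleP; exact: submod_valP.
by rewrite -tor_of_class /tor_class lreprK.
Qed.
End TorClass.

Section FilteredTensor.
Variables (R : comPzRingType) (m : {pred R}) (M N : lmodType R).
Variables (FM : stable_filtration M m) (FN : stable_filtration N m) (Fr :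
  filtered_resolution FM).

Lemma fres_dif_tens_dif i (x : copower 'I_(fres_rank Fr i.+2) N) :
  tens_map (fres_dif Fr i) (tens_map (fres_dif Fr i.+1) x) = 0.
Proof.
rewrite -(tens_map_comp (fres_dif Fr i.+1) (fres_dif Fr i)).
transitivity (tens_map (fun=> 0 : copower 'I_(fres_rank Fr i) R^o) x);
  last exact: tens_map0.
by apply: eq_tens_map => v /=; rewrite fres_dif_dif.
Qed.

Lemma shift_fil_all n (d : 'I_n -> nat) (x : copower 'I_n N) :
  shift_fil (fun j x => x \in FN j) d 0 x.
Proof. by move=> b; rewrite sub0n; exact: fil0. Qed.
End FilteredTensor.

Section MainProof.
Variables (R : comNzRingType) (m : {pred R}) (M N : lmodType R).
Variables (FM : stable_filtration M m) (FN : stable_filtration N m).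
Variables (P : free_resolution M).
Variables (Q : graded_free_resolution (gr_ring_comp m) (gr_mod_comp FM)).
Hypotheses (Rnoeth : noetherian R) (ml : local_ring m).
Variable Fr : filtered_resolution FM.
Hypothesis Nfg : exists s : seq N, forall x, gen s x.

Local Notation G := (gr_ring m).
Let mi := local_subm ml.
Let C (i : nat) : lmodType R := copower 'I_(fres_rank Fr i) N.
Let D i : {linear C i.+1 -> C i} := tens_map (fres_dif Fr i).
Let Fil i : nat -> C i -> Prop :=
  shift_fil (fun j x => x \in FN j) (@fres_deg _ _ _ _ Fr i).
Arguments Fil : clear implicits.
Let syN := class_map_gr FN.
Let Fp i : stable_fil m (Fil i) := shift_stable_fil syN (@fres_deg _ _ _ _ Fr i).
Let DD i x : D i (D i.+1 x) = 0 := fres_dif_tens_dif x.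
Let Cn i (U : C i -> Prop) : noeth U := noeth_copower Rnoeth Nfg (U := U).

Local Notation zc := (@is_cycle R C D _).
Local Notation HS i j := (@fil_cycle R C D Fil i j).
Let HSs i j : subm (HS i j) := fil_cycle_subm D Fp i j.

(** The j-th step of the filtration on Tor consists of the classes of the cycles in
Fil i j, carried along a homotopy equivalence from the filtered resolution to
P.  It is stable because the filtration of the cycles is, by Artin-Rees. *)
Lemma tor_fil_exists i : exists FT : stable_filtration (Tor P N i) m,
  forall j q, dimq m (HS i j) (@fil_cycle_next R C D Fil i j) q ->
    has_dim (residue_field m) (gr_mod_comp FT j) q.
Proof.
have [phi [_ phid phis phii]] := homog_resolution_qis (triv_gmod R^o) isT
  (free_homog_resolution (filtered_resolution_free Fr)) (free_homog_resolution P)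
    (triv_gmod N).
have phid' k (z : C k.+1) : tens_map (dif P k) (phi k.+1 z) = phi k (D k z) by exact: phid.
have phic k (z : C k) : zc z -> tor_cycle (phi k z).
  case: k z => [//|k] z zc0; rewrite /tor_cycle /=.
  by rewrite [LHS]phid' zc0 linear0.
pose tau (x : C i) : Tor P N i := tor_of (phi i x).
have zcs : subm (zc : C i -> Prop) := is_cycle_subm D i.
have tauP a x y : zc x -> zc y -> tau (a *: x + y) = a *: tau x + tau y.
  by move=> xc yc; rewrite /tau linearP tor_of_linear //; apply: phic.
have tau0 : tau 0 = 0.
  by apply/(tor_of_eq0 (phic _ _ (subm0 zcs))); exists 0; rewrite !linear0.
have tauZ a x : zc x -> tau (a *: x) = a *: tau x.
  by move=> xc; have := tauP a x 0 xc (subm0 zcs); rewrite tau0 !addr0.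
have tauB x y : zc x -> zc y -> tau (x - y) = tau x - tau y.
  by move=> xc yc; rewrite /tau linearB tor_of_sub //; apply: phic.
have tau_eq0 x : zc x -> tau x = 0 <-> exists w, x = D i w.
  move=> xc; rewrite (tor_of_eq0 (phic _ _ xc)); split=> [[w wE]|[w ->]].
    exact: (phii i x w xc (esym wE)).
  by exists (phi i.+1 w); rewrite phid'.
have tau_surj t : exists2 x, zc x & t = tau x.
  have [z zcz ->] := tor_of_surj t.
  have [||z0 [z0c _ [w wE]]] := phis i 0%N z; [exact: zcz|exact/triv_shift|].
  exists z0; first exact: z0c.
  have p0c := phic _ _ z0c.
  apply/eqP; rewrite -subr_eq0 -tor_of_sub //; apply/eqP/tor_of_eq0.
    exact: (submB (@tor_cycle_subm _ _ P N i) zcz p0c).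
  by exists w; rewrite wE addrC addKr.
(* The steps of the filtration on Tor. *)
pose T j (t : Tor P N i) := exists2 x, HS i j x & t = tau x.
have Ts j : subm (T j).
  split=> [|a _ _ [x xj ->] [y yj ->]]; first by exists 0; [exact: subm0 (HSs _ _)|].
  exists (a *: x + y); first exact: (submP _ (HSs _ _)).
  by rewrite tauP //; [case: xj|case: yj].
have Fdesc := fun j => ps_desc (Fp i) (j := j).
have TE j t : (t \in mk_submod (Ts j)) <-> T j t by exact: mk_submodE.
have T0 t : t \in mk_submod (Ts 0%N).
  by apply/TE; have [x xc ->] := tau_surj t; exists x => //; split=> //;
    exact: shift_fil_all.
have Tdesc j : {subset mk_submod (Ts j.+1) <= mk_submod (Ts j)}.
  move=> t /TE[x [xc xj] ->]; apply/TE; exists x => //; split=> //; exact: Fdesc.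
have Tmul j : {subset idealM m (mk_submod (Ts j)) <= mk_submod (Ts j.+1)}.
  move=> t /ideal_mul_idealM tM; apply/TE;
    apply: (tM _ (Ts j.+1)) => a y am /TE[x [xc xj] ->].
  exists (a *: x); last by rewrite tauZ.
  by split; [exact: (submZ _ zcs)|exact: (ps_mul (Fp i))].
have Tst : exists k, forall j, (k <= j)%N ->
    idealM m (mk_submod (Ts j)) =i mk_submod (Ts j.+1).
  have [k kP] := ps_stab (artin_rees Rnoeth mi (Fp i) (@Cn i _) zcs).
  exists k => j kj t; apply/idP/idP; first exact: Tmul.
  move=> /TE[x xj ->]; apply/ideal_mul_idealM.
  suff [] : zc x /\ ideal_mul m (fun t => t \in mk_submod (Ts j)) (tau x) by [].
  apply: (kP j kj x xj (fun x => zc x /\ ideal_mul m (fun t => t \in mk_submod (Ts j))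
    (tau x))).
    split=> [|a y z [yc yM] [zc' zM]].
      by split; [exact: (subm0 zcs)|rewrite tau0; exact: subm0 (ideal_mul_subm _ _)].
    split; first exact: (submP _ zcs).
    by rewrite tauP //; exact: (submP _ (ideal_mul_subm _ _)).
  move=> a y am yj; have [yc _] := yj; split; first exact: (submZ _ zcs).
  by rewrite tauZ //; apply: mem_ideal_mul => //; apply/TE; exists y.
exists (StableFiltration T0 Tdesc Tmul Tst) => j q.
set FT := StableFiltration _ _ _ _.
have syT := class_map_gr FT.
have tin k x : HS i k x -> tau x \in FT k by move=> xk; apply/TE; exists x.
have xz k x : HS i k x -> zc x by case.
apply: (dimq_has_dim (residue := residue m) (phi := fun x => gr_class FT j (tau x) :
  gr_mod FT)).
- exact: HSs.
- exact: (fil_cycle_next_subm D Fp).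
- by move=> x [].
- move=> a x am xj; have [xc xF] := xj; split; first exact: (submZ _ (HSs _ _)).
  exists (a *: x); last by exists 0; rewrite subrr linear0.
  by split; [exact: (submZ _ zcs)|exact: (ps_mul (Fp i))].
- exact: residue_in.
- exact: residue_surj.
- exact: residue_eq.
- by move=> x xj; apply: (cm_in syT); apply: tin.
- by move=> t /(cm_surj syT)[u /TE[x xj ->] ->]; exists x.
- move=> x xj /(cm_0 syT (tin _ _ xj))/TE[z zj /eqP].
  rewrite -subr_eq0 -tauB; try exact: (xz _ _ xj); try exact: (xz _ _ zj).
  move=> /eqP/tau_eq0[|w wE].
    by apply: (submB zcs); [exact: (xz _ _ xj)|exact: (xz _ _ zj)].
  by split=> //; exists z => //; exists w.
- move=> x [xj [z zj [w wE]]]; apply/(cm_0 syT (tin _ _ xj))/TE; exists z => //.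
  apply/eqP; rewrite -subr_eq0 -tauB; try exact: (xz _ _ xj); try exact: (xz _ _ zj).
  apply/eqP/tau_eq0; last by exists w.
  by apply: (submB zcs); [exact: (xz _ _ xj)|exact: (xz _ _ zj)].
move=> a x y xj yj; rewrite tauP; try exact: (xz _ _ xj); try exact: (xz _ _ yj).
rewrite (cm_D syT); [|by apply: (submZ _ (subm_mem _)); apply: tin|exact: tin].
by rewrite (cm_act syT) //; exact: tin.
Qed.

(** Classes in the associated graded complex identify its cycles and boundaries in
degree j with [near_cycle] at b = j.+1 and [bdry_mod] at a = j, modulo
Fil i j.+1; a homogeneous homotopy equivalence leads from there to Q. *)
Lemma gr_tor_dim i j p :
  dimq m (@near_cycle R C D Fil i j j.+1) (@bdry_mod R C D Fil i j j) p ->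
  has_dim (residue_field m) (tor_comp Q (gr_mod_comp FN) i j) p.
Proof.
pose Qg := graded_homog_resolution (gr_ring_gmod m) (gr_ring_gdec m) (gr_mod_gdec FM) Q.
have gNP := cm_gmod syN.
have [phi [phig phid phis phii]] := homog_resolution_qis (gr_ring_gmod m)
  (gr_one_comp m) (gr_resolution Fr) Qg gNP.
pose sy k := class_map_shift syN (@fres_deg _ _ _ _ Fr k).
pose L k : lmodType G := copower 'I_(fres_rank Fr k) (gr_mod FN).
pose sgm k j' (x : C k) : L k := shift_class (gr_class FN : nat -> N ->
  gr_mod FN) (@fres_deg _ _ _ _ Fr k) j' x.
pose dG k : {linear L k.+1 -> L k} := tens_map (grdif Fr k).
have dGE k j' x : Fil k.+1 j' x -> dG k (sgm k.+1 j' x) = sgm k j' (D k x).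
  exact: (grdif_tens syN).
have DFil k j' x : Fil k.+1 j' x ->
  Fil k j' (D k x) by exact: (filtered_resolution_dif_tens_fil syN).
pose cycG k (z : L k) : Prop := tens_cycle (N := gr_mod FN) (grdif Fr) (i := k) z.
have phid' k (z : L k.+1) : tens_map (dif Q k) (phi k.+1 z) = phi k (dG k z) by exact: phid.
have phic k (z : L k) : cycG k z -> tor_cycle (phi k z).
  case: k z => [//|k] z zc0; rewrite /tor_cycle /=.
  by rewrite [LHS]phid' [dG k z]zc0 linear0.
have Xfil x : @near_cycle R C D Fil i j j.+1 x -> Fil i j x by exact: (near_cycle_fil Fp).
have Xout x : @near_cycle R C D Fil i j j.+1 x -> dif_in D Fil j.+1 x.
  move=> [z [y [-> _ zo yj]]]; apply: (submD (dif_in_subm D Fp i j.+1) zo).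
  by case: (i) y yj => //= k y yj; exact: DFil.
have out_cyc k x : Fil k j x -> dif_in D Fil j.+1 x -> cycG k (sgm k j x).
  case: k x => [//|k] x xj xo; rewrite /cycG /= -[LHS]/(dG k (sgm k.+1 j x)) dGE //.
  by apply/(cm_0 (sy k)) => //; exact: DFil.
have tens_cycle_out k x : Fil k j x -> cycG k (sgm k j x) -> dif_in D Fil j.+1 x.
  case: k x => [//|k] x xj xo; apply/(cm_0 (sy k)); first exact: DFil.
  by rewrite -[LHS]/(sgm k j (D k x)) -dGE.
have sgm_lin k a x y : Fil k j x -> Fil k j y ->
    sgm k j (a *: x + y) = (residue m a : G) *: sgm k j x + sgm k j y.
  move=> xj yj; rewrite /sgm (cm_D (sy k)) //;
    last exact: (submZ _ (stable_fil_subm (Fp k) j)).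
  by rewrite (cm_act (sy k)).
pose tau (x : C i) : Tor Q (gr_mod FN) i := tor_of (phi i (sgm i j x)).
have Xtc x : @near_cycle R C D Fil i j j.+1 x -> tor_cycle (phi i (sgm i j x)).
  by move=> xX; apply: phic; apply: out_cyc; [apply: Xfil|apply: Xout].
apply: (dimq_has_dim (residue := residue m) (phi := tau)).
- exact: (near_cycle_subm D Fp).
- exact: (bdry_mod_subm D Fp).
- move=> x /(bdry_cycle_mod DD); exact: (cycle_mod_near Fp).
- by move=> a x am /Xfil xj; apply: (fil_bdry_mod D Fp); exact: (ps_mul (Fp i)).
- exact: residue_in.
- exact: residue_surj.
- exact: residue_eq.
- move=> x xX; apply/asboolP; exists (insubd (0 :
  submod (Defs.cycle Q (gr_mod FN) i)) (phi i (sgm i j x))) => //.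
  rewrite tor_of_val; last exact: Xtc.
  by apply: phig; apply: (cm_in (sy i)); exact: Xfil.
- move=> t /asboolP[z zj ->]; rewrite tor_of_class.
  have zc0 : tor_cycle (submod_val z) by apply/cycleP; exact: submod_valP.
  have [||z0 [z0c /(cm_surj (sy i))[x xj z0E] [w wE]]] := phis i j (submod_val z);
    [exact: zc0|exact: zj|].
  have xo : dif_in D Fil j.+1 x by apply: tens_cycle_out => //; rewrite /sgm -z0E.
  have xX : @near_cycle R C D Fil i j j.+1 x.
    by exists x, 0; rewrite addr0; split=> //; exact: subm0 (stable_fil_subm (Fp i) _).
  exists x => //; apply/eqP; rewrite -subr_eq0 -tor_of_sub //; last exact: Xtc.
  apply/eqP/tor_of_eq0; first exact: (submB (@tor_cycle_subm _ _ Q _ i) zc0 (Xtc x xX)).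
  by exists w; rewrite wE z0E addrC addKr.
- move=> x xX /(tor_of_eq0 (Xtc x xX))[w wE].
  have [w' w'E] := phii i (sgm i j x) w (out_cyc i x (Xfil x xX) (Xout x xX)) (esym wE).
  have sgx : dG i w' \in shift_comp (gr_mod_comp FN) (@fres_deg _ _ _ _ Fr i) j.
    have -> : dG i w' = sgm i j x by exact: esym w'E.
    by apply: (cm_in (sy i)); exact: Xfil.
  have [w2 /(cm_surj (sy i.+1))[u uj w2E] dw2] := gdec_lift
    (gmod_shift (@fres_deg _ _ _ _ Fr i.+1) gNP)
    (gdec_shift (@fres_deg _ _ _ _ Fr i.+1) gNP (gr_mod_gdec FN))
    (gdec_shift (@fres_deg _ _ _ _ Fr i) gNP (gr_mod_gdec FN))
    (linearD (dG i)) (fun j' => tens_map_graded gNP (fun b => grdif_gr (shift_basis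
      (gr_ring_gmod m) (gr_one_comp m) _ b)) (j := j')) sgx.
  exists u, (x - D i u); rewrite addrC subrK; split=> //; first exact: DFil.
  have xj := Xfil x xX.
  have Duj := DFil i j u uj.
  apply/(cm_0 (sy i)); first exact: (submB (stable_fil_subm (Fp i) j)).
  apply: (addIr (sgm i j (D i u))); rewrite add0r -(cm_D (sy i)) //;
    last exact: (submB (stable_fil_subm (Fp i) j)).
  rewrite subrK -[RHS]/(sgm i j (D i u)) -dGE //.
  transitivity (dG i w2); last by rewrite w2E.
  rewrite dw2; exact: w'E.
- move=> x xB; have [u [y [E uj Duj yj]]] := xB.
  have xX : @near_cycle R C D Fil i j j.+1 x by apply: (cycle_mod_near Fp);
    exact: (bdry_cycle_mod DD xB).
  apply/(tor_of_eq0 (Xtc x xX)).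
  exists (phi i.+1 (sgm i.+1 j u)); rewrite phid' dGE // E.
  have yj' : Fil i j y by exact: (ps_desc (Fp i)).
  rewrite /sgm (cm_D (sy i)) //.
  by have /(cm_0 (sy i) yj') -> := yj; rewrite addr0.
move=> a x y xX yX; rewrite /tau sgm_lin; [|exact: Xfil|exact: Xfil].
by rewrite linearP tor_of_linear //; exact: Xtc.
Qed.
End MainProof.

Theorem theorem2 (R : comNzRingType) (m : {pred R}) (M N : lmodType R)
    (FM : stable_filtration M m) (FN : stable_filtration N m)
    (P : free_resolution M)
    (Q : graded_free_resolution (gr_ring_comp m) (gr_mod_comp FM)) :
  noetherian R -> local_ring m -> fin_gen (full M) -> fin_gen (full N) ->
  exists FT : forall i : nat, stable_filtration (Tor P N i) m,
  exists p q : nat -> nat -> nat,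
  [/\ forall i j, has_dim (residue_field m)
        (tor_comp Q (gr_mod_comp FN) i j) (p i j),
      forall i j, has_dim (residue_field m) (gr_mod_comp (FT i) j) (q i j) &
      neg_cancellations p q].
Proof.
move=> Rnoeth ml /fin_genP[s sP] /fin_genP[t tP].
have Mfg : exists s : seq M, forall x, gen s x by exists s => x; apply/sP.
have Nfg : exists s : seq N, forall x, gen s x by exists t => x; apply/tP.
have mi := local_subm ml.
have [Fr] := filtered_resolution_exists Rnoeth mi FM Mfg.
pose C (i : nat) : lmodType R := copower 'I_(fres_rank Fr i) N.
pose D i : {linear C i.+1 -> C i} := tens_map (fres_dif Fr i).
have DD i x : D i (D i.+1 x) = 0 by exact: fres_dif_tens_dif.
have [p [q [pP qP pq]]] := @filtered_complex_cancellations R m Rnoeth mi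
  (local_proper ml) (local_inv ml) C D
  (fun i => shift_fil (fun j x => x \in FN j) (@fres_deg _ _ _ _ Fr i)) DD
  (fun i => shift_stable_fil (class_map_gr FN) (@fres_deg _ _ _ _ Fr i))
  (fun i x => shift_fil_all FN (@fres_deg _ _ _ _ Fr i) x)
  (fun i U => noeth_copower Rnoeth Nfg (U := U)).
have [FT FTP] := choice_dep (tor_fil_exists FN P Rnoeth ml Fr Nfg).
exists FT, p, q; split=> // i j; last by apply: FTP; exact: qP.
by apply: gr_tor_dim (pP i j).
Qed.
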